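(* Let $h\geq k>1$ be integers. Let $M$ be any matroid of rank $k$ on a finite set $E$, $W$ any finite group acting on $E$ preserving the set of bases of $M$, $H$ any stressed hyperplane of $M$ with $|H|=h$, and $\tilde M$ the matroid obtained by relaxing all hyperplanes in the $W$-orbit of $H$. Then $$P_{\tilde M}^W(t)=P_M^W(t)+\operatorname{Ind}_{W_H}^W\operatorname{Res}_{W_H}^{\mathfrak{S}_h}p_{k,h}^{\mathfrak{S}_h}(t),\qquad Q_{\tilde M}^W(t)=Q_M^W(t)+\operatorname{Ind}_{W_H}^W\operatorname{Res}_{W_H}^{\mathfrak{S}_h}q_{k,h}^{\mathfrak{S}_h}(t),$$ where $$p_{k,h}^{\mathfrak{S}_h}(t)=\sum_{0<i<k/2}V_{[h-2i+1,(k-2i+1)^i]/[k-2i,(k-2i-1)^{i-1}]}\,t^i,$$ $$q_{k,h}^{\mathfrak{S}_h}(t)=\sum_{0\le i<k/2}\Big(V_{[h-k+2,2^{i-1},1^{k-2i}]}+V_{[h-k+1,2^i,1^{k-2i-1}]}\Big)t^i,$$ with the convention that in $q_{k,h}^{\mathfrak{S}_h}(t)$ the first term is $0$ when $i=0$, and the second term is $0$ when $i>0$ and $k=h$.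
   Context: All matroids are on finite ground sets. For a matroid $M$ on $E$ with rank function $\operatorname{rk}$ and a finite group $W$ acting on $E$ by permutations preserving the set of bases of $M$: for $S\subseteq E$, $W_S$ denotes the setwise stabilizer of $S$ in $W$, $M^S$ the restriction of $M$ to $S$ (deletion of $E\setminus S$), and $M_S$ the contraction of $M$ by $S$; both carry actions of $W_S$. $\tau_W$ is the trivial representation of $W$. Polynomials have coefficients in the ring of virtual rational representations of the relevant group; $\operatorname{Ind}$, $\operatorname{Res}$ and $\otimes$ are applied coefficientwise. The equivariant Kazhdan–Lusztig polynomial $P_M^W(t)$ and the equivariant $Z$-polynomial $Z_M^W(t)$ are uniquely characterized by: (i) if $E=\emptyset$ then $P_M^W(t)=Z_M^W(t)=\tau_W$; (ii) if $E\neq\emptyset$ then $\deg P_M^W(t)<\operatorname{rk}M/2$; (iii) $t^{\operatorname{rk}M}Z_M^W(t^{-1})=Z_M^W(t)$; (iv) $Z_M^W(t)=\sum_{[S]\in 2^E/W}t^{\operatorname{rk}S}\operatorname{Ind}_{W_S}^W P_{M_S}^{W_S}(t)$, the sum over $W$-orbits of subsets of $E$ with a representative $S$ chosen in each orbit. The equivariant inverse Kazhdan–Lusztig polynomial $Q_M^W(t)$ is characterized by $Q_M^W(t)=\tau_W$ if $E=\emptyset$ and, if $E\neq\emptyset$, $\sum_{[S]\in 2^E/W}(-1)^{\operatorname{rk}S}\operatorname{Ind}_{W_S}^W\big(Q_{M^S}^{W_S}(t)\otimes P_{M_S}^{W_S}(t)\big)=0$. (With these conventions $P$ and $Q$ vanish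 for matroids with loops.) A hyperplane $H$ (flat of rank $k-1$) of a rank-$k$ matroid $M$ is stressed if every $k$-element subset of $H$ is a circuit; relaxing $H$ produces the matroid whose bases are the bases of $M$ together with all $k$-element subsets of $H$. Every hyperplane in the $W$-orbit of a stressed hyperplane is stressed, and $\tilde M$ is obtained by relaxing all of them; $W$ acts on $\tilde M$. $W_H$ acts on $H$, giving a homomorphism $W_H\to\mathfrak{S}_H\cong\mathfrak{S}_h$ (after fixing an ordering of $H$); $\operatorname{Res}_{W_H}^{\mathfrak{S}_h}V$ denotes the pullback of an $\mathfrak{S}_h$-representation $V$ along this homomorphism. Partition notation: $[a_1,a_2,\dots]$ lists parts, and $b^j$ denotes $j$ parts equal to $b$ (zero parts if $j=0$). $V_\lambda$ is the Specht module (irreducible rational representation of $\mathfrak{S}_{|\lambda|}$) of $\lambda$. For partitions $\mu\subseteq\lambda$ with $|\lambda|-|\mu|=h$, the skew Specht module $V_{\lambda/\mu}$ is the $\mathfrak{S}_h$-representation in which the multiplicity of $V_\nu$ ($\nu\vdash h$) equals the multiplicity of $V_\lambda$ in $\operatorname{Ind}_{\mathfrak{S}_{|\mu|}\times\mathfrak{S}_h}^{\mathfrak{S}_{|\lambda|}}(V_\mu\boxtimes V_\nu)$. *)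

(* Defs.v *)
From HB Require Import structures.
From mathcomp Require Import all_boot all_order all_algebra all_fingroup all_solvable all_field all_character.
Set Implicit Arguments. Unset Strict Implicit. Unset Printing Implicit Defensive.
Import Order.TTheory GRing.Theory Num.Theory.
Local Open Scope ring_scope.

(* Generic helpers                                                    *)

(* the class function on G agreeing with f on (representatives of) the
   conjugacy classes of G; for a class function f this is f on G, 0 off G *)
Definition mkCF (aT : finGroupType) (G : {group aT}) (f : aT -> algC) : 'CF(G) :=
  \sum_(C in classes G) f (repr C) *: cfun_indicator G C.

(* the permutation of T given by f, if f is injective (identity otherwise) *)
Definition mkperm (T : finType) (f : T -> T) : {perm T} :=
  match injectiveP f with ReflectT finj => perm finj | ReflectF _ => 1%g end.

(* Matroids on a subset A of a finite type E, given by their bases     *)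
Section Matroids.
Variable E : finType.
Implicit Types (A S X H : {set E}) (Bs : {set {set E}}).
Local Open Scope nat_scope.

Definition is_matroid A Bs : bool :=
  [&& Bs != set0, [forall B in Bs, B \subset A] &
      [forall B1 in Bs, forall B2 in Bs, forall x in B1 :\: B2,
         exists y in B2 :\: B1, (y |: (B1 :\ x)) \in Bs]].

(* rank function *)
Definition rk Bs X : nat := \max_(B in Bs) #|X :&: B|.

Definition indep Bs X : bool := [exists B in Bs, X \subset B].
Definition circuit Bs X : bool :=
  ~~ indep Bs X && [forall x in X, indep Bs (X :\ x)].

Definition is_flat Bs A X : bool :=
  (X \subset A) && [forall x in A :\: X, rk Bs X < rk Bs (x |: X)].
Definition is_hyperplane Bs A X : bool :=
  is_flat Bs A X && (rk Bs X == (rk Bs A).-1).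
Definition stressed_hyperplane Bs A H : bool :=
  is_hyperplane Bs A H &&
  [forall X : {set E}, ((X \subset H) && (#|X| == rk Bs A)) ==> circuit Bs X].

(* restriction M^S (deletion of A \ S) and contraction M_S *)
Definition restrB Bs S : {set {set E}} :=
  [set B :&: S | B in [set B in Bs | #|B :&: S| == rk Bs S]].
Definition contrB Bs S : {set {set E}} :=
  [set B :\: S | B in [set B in Bs | #|B :&: S| == rk Bs S]].
End Matroids.

(* Group actions on matroids; equivariant KL, Z and inverse KL         *)
(* polynomials (with coefficients in class functions = characters of   *)
(* virtual representations)                                           *)
Section Equivariant.
Variables (E : finType) (gT : finGroupType) (to : {action gT &-> E}).
Implicit Types (A S X H : {set E}) (Bs : {set {set E}}) (G : {group gT}).

Definition preserves G Bs : bool :=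
  [forall g in G, forall B : {set E}, ((setact to B g) \in Bs) == (B \in Bs)].

(* M = (A, Bs) is a matroid on A and G acts on A preserving the bases *)
Definition admissible A Bs G : bool :=
  [&& is_matroid A Bs, [acts G, on A | to] & preserves G Bs].

Definition polyfam := forall A Bs G, {poly 'CF(G)}.

(* the characterization (i)-(iv) of P (KL) and Z, for all matroids on
   subsets of E and all groups of gT acting on them *)
Definition is_KL_system (P Z : polyfam) : Prop :=
  forall A Bs G, admissible A Bs G ->
  [/\ A = set0 -> P A Bs G = 1 /\ Z A Bs G = 1,
      A != set0 -> forall i : nat, (rk Bs A <= i.*2)%N -> (P A Bs G)`_i = 0,
      forall i : nat, (Z A Bs G)`_i =
                if (i <= rk Bs A)%N then (Z A Bs G)`_(rk Bs A - i) else 0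
    & Z A Bs G =
      \sum_(S in orbit_transversal (to^*)%act G (powerset A))
         'X^(rk Bs S) *
         map_poly (@cfInd gT G 'N_G(S | to))
                  (P (A :\: S) (contrB Bs S) 'N_G(S | to)%G)].

(* the characterization of the inverse KL polynomial Q, given P *)
Definition is_invKL (P Q : polyfam) : Prop :=
  forall A Bs G, admissible A Bs G ->
  (A = set0 -> Q A Bs G = 1) /\
  (A != set0 ->
     \sum_(S in orbit_transversal (to^*)%act G (powerset A))
        (-1) ^+ (rk Bs S) *
        map_poly (@cfInd gT G 'N_G(S | to))
           (Q S (restrB Bs S) 'N_G(S | to)%G *
            P (A :\: S) (contrB Bs S) 'N_G(S | to)%G) = 0).

(* relaxation of all hyperplanes in the W-orbit of H (of rank k-1) *)
Definition relax (W : {group gT}) Bs H : {set {set E}} :=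
  [set X : {set E} | (X \in Bs) ||
     [exists g in W, (X \subset setact to H g) && (#|X| == rk Bs [set: E])]].

(* W_H -> S_H ~ S_h, using the ordering enum H of H *)
Definition Hperm (h : nat) H (g : gT) : {perm 'I_h} :=
  mkperm (fun i : 'I_h =>
    match [pick x in H] with
    | Some x0 => insubd i (index (to (nth x0 (enum H) i) g) (enum H))
    | None => i
    end).

(* Res_{W_H}^{S_h}: pullback along W_H -> S_h *)
Definition resH (h : nat) (W : {group gT}) H
    (phi : 'CF([set: {perm 'I_h}])) : 'CF('N_W(H | to)) :=
  mkCF 'N_W(H | to)%G (fun g => phi (Hperm h H g)).
End Equivariant.

(* Specht modules (as characters)                                     *)
Definition Sym (n : nat) : {group {perm 'I_n}} := [set: {perm 'I_n}]%G.

(* block index of position i for the composition mu *)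
Definition blk (mu : seq nat) (i : nat) : nat :=
  count (fun j => (\sum_(k <- take j.+1 mu) k <= i)%N) (iota 0 (size mu)).

(* Young subgroup S_mu of S_n (blocks of consecutive positions) *)
Definition YoungSet (n : nat) (mu : seq nat) : {set {perm 'I_n}} :=
  [set s : {perm 'I_n} | [forall i : 'I_n, blk mu (s i) == blk mu i]].
Definition Young (n : nat) (mu : seq nat) : {group {perm 'I_n}} :=
  <<YoungSet n mu>>%G.

(* conjugate partition *)
Definition conjp (lam : seq nat) : seq nat :=
  mkseq (fun j => count (fun p => (j < p)%N) lam) (\max_(p <- lam) p)%N.

(* sign character of S_n *)
Definition sgnCF (n : nat) : 'CF(Sym n) :=
  mkCF (Sym n) (fun s => (-1) ^+ odd_perm s).

(* V_lam: the unique common irreducible constituent of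
   Ind_{S_lam}^{S_n} 1 and Ind_{S_lam'}^{S_n} sgn (image of the Young
   symmetrizer); lam a partition of n *)
Definition Specht (n : nat) (lam : seq nat) : 'CF(Sym n) :=
  \sum_(i : Iirr (Sym n) |
          ('['chi_i, 'Ind[Sym n] (1 : 'CF(Young n lam))] != 0) &&
          ('['chi_i, 'Ind[Sym n] ('Res[Young n (conjp lam)] (sgnCF n))] != 0))
     'chi_i.

(* partitions of n (nonincreasing sequences of positive parts) *)
Fixpoint parts_aux (fuel n b : nat) : seq (seq nat) :=
  match fuel with
  | 0 => if n == 0%N then [:: [::]] else [::]
  | f.+1 => if n == 0%N then [:: [::]] else
      flatten [seq [seq k :: p | p <- parts_aux f (n - k) k] | k <- iota 1 (minn n b)]
  end.
Definition partitions (n : nat) : seq (seq nat) := parts_aux n n n.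

(* V_mu (x) V_nu as a class function on S_m x S_h = S_(m,h) <= S_(m+h) *)
Definition sig1 (m h : nat) (g : {perm 'I_(m + h)}) : {perm 'I_m} :=
  mkperm (fun i : 'I_m => insubd i (val (g (lshift h i)))).
Definition sig2 (m h : nat) (g : {perm 'I_(m + h)}) : {perm 'I_h} :=
  mkperm (fun j : 'I_h => insubd j (val (g (rshift m j)) - m)%N).
Definition boxCF (m h : nat) (a : 'CF(Sym m)) (b : 'CF(Sym h))
  : 'CF(Young (m + h) [:: m; h]) :=
  mkCF (Young (m + h) [:: m; h]) (fun g => a (sig1 g) * b (sig2 g)).

(* skew Specht module V_{lam/mu} for S_h, |lam| = |mu| + h *)
Definition skewSpecht (h : nat) (lam mu : seq nat) : 'CF(Sym h) :=
  \sum_(nu <- partitions h)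
     '['Ind[Sym (sumn mu + h)] (boxCF (Specht (sumn mu) mu) (Specht h nu)),
       Specht (sumn mu + h) lam] *: Specht h nu.

(* p_{k,h} and q_{k,h} *)
Section PQ.
Local Open Scope nat_scope.
(* [h-2i+1, (k-2i+1)^i] and [k-2i, (k-2i-1)^(i-1)] *)
Definition p_lam (k h i : nat) : seq nat := (h - i.*2 + 1) :: nseq i (k - i.*2 + 1).
Definition p_mu (k h i : nat) : seq nat := (k - i.*2) :: nseq i.-1 (k - i.*2 - 1).
(* [h-k+2, 2^(i-1), 1^(k-2i)] and [h-k+1, 2^i, 1^(k-2i-1)] *)
Definition q_lam1 (k h i : nat) : seq nat := (h - k + 2) :: (nseq i.-1 2 ++ nseq (k - i.*2) 1).
Definition q_lam2 (k h i : nat) : seq nat := (h - k + 1) :: (nseq i 2 ++ nseq (k - i.*2 - 1) 1).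
End PQ.

Definition p_kh (k h : nat) : {poly 'CF(Sym h)} :=
  \sum_(i < k | (0 < i)%N && (i.*2 < k)%N)
     (skewSpecht h (p_lam k h i) (p_mu k h i))%:P * 'X^i.

Definition q_kh (k h : nat) : {poly 'CF(Sym h)} :=
  \sum_(i < k | (i.*2 < k)%N)
     ((if i == 0%N :> nat then 0 else Specht h (q_lam1 k h i)) +
      (if (0 < i)%N && (k == h) then 0 else Specht h (q_lam2 k h i)))%:P
     * 'X^i.

(* Main.v *)
Require Import Defs.
From HB Require Import structures.
From mathcomp Require Import all_boot all_order all_algebra all_fingroup all_solvable all_field all_character.
From mathcomp Require Import mpoly.
From mathcomp Require Import zify ring.
(* [perm] also defines [Sym]. *)
Import Defs.
Set Implicit Arguments. Unset Strict Implicit. Unset Printing Implicit Defensive.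

(** Everything is evaluated at one group element g. A sum over W-orbits of
subsets of characters induced from stabilizers becomes a sum over the g-stable
subsets, and the values of P and Q at g depend only on the matroid and on g. The
values at g of the characters of symmetric groups attached to g-stable subsets
multiply in the convolution algebra of set functions, where the complete
symmetric function h_n is the indicator of the g-stable sets of size n.

Contracting a relaxation by a set S inside a stressed hyperplane H gives, for
|S| < k, the relaxation of the contraction along H \ S; for |S| >= k it turns a
rank one matroid, loopless exactly when S = H, into one of rank zero; and nothing
changes for S in no relaxed hyperplane. Hence P~ - P satisfies a recursion with
one contribution per g-stable hyperplane of the orbit, and the palindromicity of
Z~ - Z pins that contribution down as an explicit antisymmetrized expression in
hooks and elementary symmetric functions. The recursion for Q~ - Q has the same
shape, with the restrictions to H (uniform matroids of rank k - 1) and to its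
small subsets (Boolean matroids) as extra input.

The Specht characters enter through the Jacobi-Trudi formula. The alternating sum
of permutation characters attached to lam has norm 1, by the bialternant identity
and Burnside counting, and pairs to 1 with the sign-twisted permutation character
of the conjugate partition, hence is the common constituent defining V_lam;
expanding the determinants of the shapes in the statement gives the same
expressions in hooks and elementary symmetric functions. *)

(** * Matroids, relaxations and minors *)

(** The antisymmetrized expression arises by solving the palindromicity condition. A correction
    spread over the subsets of H enters Z as a convolution with the h's, and the term lost at S = H
    leaves a defect in the degrees 1 and k - 1 only. For i + b = k this defect is f(i) f'(b) - f(b)
    f'(i), evaluated at H, where f(n) = h_(c+n) with c = |H| + 1 - k and f' is the indicator of n =
    1. Dividing f and f' by the series of the h's gives signed hooks and shifted signed elementary
    functions, and the degree bound makes the solution unique. Uniform matroids are solved in the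
    same way with n = 0 in place of n = 1. For Q, the Boolean restrictions contribute signed
    elementary functions, which cancel the h's again.

    The contraction by S keeps only the hyperplanes containing S, which need not form an orbit; so
    the induction runs over families of stressed hyperplanes stable under g.

    The skew characters are defined through multiplicities for all partitions of h, so the
    partitions must be shown to exhaust the irreducible characters; an induction on a dominance
    weight does this, starting from the regular character. *)

Section Matroid.
Variable E : finType.
Implicit Types (A S X H I B Y Z G : {set E}) (Bs HH : {set {set E}}).

Lemma mat_ne A Bs : is_matroid A Bs -> exists B, B \in Bs.
Proof. by case/and3P => /set0Pn. Qed.

Lemma mat_sub A Bs B : is_matroid A Bs -> B \in Bs -> B \subset A.
Proof. by case/and3P => _ /forall_inP h _; apply: h. Qed.

Lemma mat_ex A Bs B1 B2 x : is_matroid A Bs -> B1 \in Bs -> B2 \in Bs -> x \in B1 -> x \notin B2 ->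
  exists2 y, y \in B2 & (y \notin B1) && ((y |: (B1 :\ x)) \in Bs).
Proof.
case/and3P => _ _ /forall_inP h b1 b2 x1 x2.
have /forall_inP/(_ x) := forall_inP (h _ b1) _ b2; rewrite !inE x1 x2 => /(_ isT) /exists_inP[y].
by rewrite inE => /andP[y1 y2] yb; exists y => //; rewrite y1.
Qed.

Lemma is_matroidI A Bs : (exists B, B \in Bs) -> (forall B, B \in Bs -> B \subset A) ->
  (forall B1 B2 x, B1 \in Bs -> B2 \in Bs -> x \in B1 -> x \notin B2 ->
    exists2 y, y \in B2 & (y \notin B1) && ((y |: (B1 :\ x)) \in Bs)) -> is_matroid A Bs.
Proof.
move=> ne sub ex; apply/and3P; split; first exact/set0Pn.
  by apply/forall_inP.
apply/forall_inP => B1 b1; apply/forall_inP => B2 b2; apply/forall_inP => x.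
rewrite inE => /andP[x2 x1]; have [y y2 /andP[y1 yb]] := ex _ _ _ b1 b2 x1 x2.
by apply/exists_inP; exists y => //; rewrite inE y1.
Qed.

Lemma card_swap B x y : x \in B -> y \notin B -> #|y |: (B :\ x)| = #|B|.
Proof.
move=> xB yB; rewrite cardsU1 !inE (negPf yB) andbF /= add1n (cardsD1 x B) xB.
by rewrite add1n.
Qed.

Lemma mat_card A Bs B1 B2 : is_matroid A Bs -> B1 \in Bs -> B2 \in Bs -> #|B1| = #|B2|.
Proof.
move=> m b1 b2; have [n] := ubnP #|B1 :\: B2|; elim: n B1 b1 => // n IH B1 b1 lt.
have [e|[x]] := set_0Vmem (B1 :\: B2).
  have s12 : B1 \subset B2 by rewrite -setD_eq0 e.
  have [e'|[x]] := set_0Vmem (B2 :\: B1).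
    by congr #|pred_of_set _|; apply/eqP; rewrite eqEsubset s12 -setD_eq0 e' eqxx.
  rewrite inE => /andP[x1 x2]; have [y y1 /andP[y2 _]] := mat_ex m b2 b1 x2 x1.
  by rewrite (subsetP s12 _ y1) in y2.
rewrite inE => /andP[x2 x1]; have [y y2 /andP[y1 yb]] := mat_ex m b1 b2 x1 x2.
rewrite -(card_swap x1 y1); apply: IH => //; move: lt; rewrite ltnS; apply: leq_trans.
apply: proper_card; apply/properP; split.
  apply/subsetP => z; rewrite !inE => /andP[z2 /orP[/eqP e|/andP[_ ->]]]; rewrite ?z2 //.
  by rewrite e y2 in z2.
by exists x; rewrite !inE ?x1 ?x2 // eqxx /= orbF; apply/negP => /eqP e; rewrite -e x1 in y1.
Qed.

Lemma rk_ge Bs B X : B \in Bs -> #|X :&: B| <= rk Bs X.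
Proof. by move=> b; rewrite /rk; apply: (leq_bigmax_cond (F := fun B => #|X :&: B|)). Qed.

Lemma rk_le Bs X m : (forall B, B \in Bs -> #|X :&: B| <= m) -> rk Bs X <= m.
Proof. by move=> h; apply/bigmax_leqP. Qed.

Lemma rk_attain Bs X : (exists B, B \in Bs) -> exists2 B, B \in Bs & #|X :&: B| = rk Bs X.
Proof.
case=> B0 b0; have [|B b e] := @eq_bigmax_cond _ (mem Bs) (fun B => #|X :&: B|).
  by apply/card_gt0P; exists B0.
by exists B.
Qed.

Lemma rk_full A Bs B : is_matroid A Bs -> B \in Bs -> rk Bs A = #|B|.
Proof.
move=> m b; apply/eqP; rewrite eqn_leq; apply/andP; split.
  apply: rk_le => B' b'; rewrite (mat_card m b b'); apply: subset_leq_card; exact: subsetIr.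
by have := rk_ge A b; rewrite (setIidPr (mat_sub m b)).
Qed.

Lemma rk_eq Bs S B r : B \in Bs -> #|S :&: B| = r -> (forall B', B' \in Bs -> #|S :&: B'| <= r) -> rk Bs S = r.
Proof. by move=> b e le; apply/eqP; rewrite eqn_leq rk_le //= -e rk_ge. Qed.

(** Exchanging an element of the basis outside [I :|: B1] for one of [B1] keeps [I] and shrinks the
    part outside [I :|: B1], so the process ends inside that union. *)
Lemma mat_ext A Bs I B1 B2 : is_matroid A Bs -> B1 \in Bs -> B2 \in Bs -> I \subset B2 ->
  exists B, [/\ B \in Bs, I \subset B & B \subset I :|: B1].
Proof.
move=> m b1 b2 iB2; have [n] := ubnP #|B2 :\: (I :|: B1)|; elim: n B2 b2 iB2 => // n IH B b iB lt.
have [e|[x]] := set_0Vmem (B :\: (I :|: B1)).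
  by exists B; split=> //; rewrite -setD_eq0 e.
rewrite !inE negb_or => /andP[/andP[xI x1] xB].
have [y y1 /andP[yB yb]] := mat_ex m b b1 xB x1.
apply: (IH _ yb).
  apply/subsetP => z zI; rewrite !inE (subsetP iB _ zI) andbT orbC; apply/orP; left.
  by apply: contraNneq xI => <-.
move: lt; rewrite ltnS; apply: leq_trans; apply: proper_card; apply/properP; split.
  apply/subsetP => z; rewrite !inE => /andP[z1 /orP[/eqP e|/andP[_ ->]]]; rewrite ?z1 //.
  by rewrite e y1 orbT in z1.
exists x; rewrite !inE ?negb_or ?xI ?x1 ?xB // eqxx /= orbF.
by apply/negP => /eqP e; rewrite -e xB in yB.
Qed.

Lemma mem_contr Bs S X : reflect (exists B, [/\ B \in Bs, #|S :&: B| = rk Bs S & X = B :\: S]) (X \in contrB Bs S).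
Proof.
apply: (iffP imsetP) => [[B]|[B [b e ->]]].
  by rewrite inE setIC => /andP[b /eqP e] ->; exists B.
by exists B => //; rewrite inE b setIC e eqxx.
Qed.

Lemma mem_restr Bs S X : reflect (exists B, [/\ B \in Bs, #|S :&: B| = rk Bs S & X = S :&: B]) (X \in restrB Bs S).
Proof.
apply: (iffP imsetP) => [[B]|[B [b e ->]]].
  by rewrite inE setIC => /andP[b /eqP e] ->; exists B; split=> //; exact: setIC.
by exists B; [rewrite inE b setIC e eqxx|exact: setIC].
Qed.

(** A basis that extends [S :&: B2] by elements of [B1] cannot meet [S] in more than the rank of
    [S], so its size forces it to be this union. Hence bases of the restriction to [S] and of the
    contraction by [S] combine freely. *)
Lemma mat_mix A Bs S B1 B2 : is_matroid A Bs -> B1 \in Bs -> B2 \in Bs ->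
  #|S :&: B1| = rk Bs S -> #|S :&: B2| = rk Bs S -> (S :&: B2) :|: (B1 :\: S) \in Bs.
Proof.
move=> m b1 b2 e1 e2; have [B [b iB sB]] := mat_ext m b1 b2 (subsetIr S B2).
suff -> : (S :&: B2) :|: (B1 :\: S) = B by [].
have eS : S :&: B = S :&: B2.
  apply/eqP; rewrite eq_sym eqEcard e2 rk_ge // andbT subsetI subsetIl /=; exact: iB.
have eD : B :\: S = B1 :\: S.
  apply/eqP; rewrite eqEcard; apply/andP; split.
    apply/subsetP => z; rewrite !inE => /andP[zS zB]; have := subsetP sB _ zB.
    by rewrite !inE (negPf zS) /=.
  have c := mat_card m b1 b; have := cardsID S B; have := cardsID S B1.
  rewrite ![_ :&: S]setIC e1 eS e2 c; lia.
by rewrite -eS -eD setIC setUC setDE -setIUr setUC setUCr setIT.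
Qed.

Lemma contr_matroid A Bs S : is_matroid A Bs -> is_matroid (A :\: S) (contrB Bs S).
Proof.
move=> m; apply: is_matroidI.
- have [B b e] := rk_attain S (mat_ne m); exists (B :\: S); apply/mem_contr; by exists B.
- by move=> X /mem_contr[B [b _ ->]]; rewrite setSD // (mat_sub m).
move=> X1 X2 x /mem_contr[B1 [b1 e1 ->]] /mem_contr[B2 [b2 e2 ->]].
rewrite !inE => /andP[xS x1]; rewrite xS /= => x2.
(* The mixed basis agrees with [B2] on [S], so the element that the exchange brings in from [B2]
   lies outside [S]. *)
have b := mat_mix m b1 b2 e1 e2; set B := _ :|: _ in b.
have xB : x \in B by rewrite !inE xS x1 (negPf x2) andbF.
have [y y2 /andP[yB yb]] := mat_ex m b b2 xB x2.
have yS : y \notin S by apply: contra yB => yS; rewrite !inE yS y2.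
have y1 : y \notin B1 by apply: contra yB => y1; rewrite !inE yS y1 orbT.
exists y; rewrite !inE ?yS ?y2 // (negPf y1) andbF /=; apply/mem_contr; exists (y |: (B :\ x)); split=> //.
  rewrite -e2; congr #|pred_of_set _|; apply/setP => z; rewrite !inE; case: (boolP (z \in S)) => zS //=.
  have -> : (z == y) = false by apply: contraNF yS => /eqP <-.
  have -> : (z == x) = false by apply: contraNF xS => /eqP <-.
  by rewrite orbF.
apply/setP => z; rewrite !inE; case: (boolP (z \in S)) => zS //=.
by rewrite andbF orbF; apply: contraNF yS => /eqP <-.
Qed.

Lemma restr_matroid A Bs S : is_matroid A Bs -> is_matroid S (restrB Bs S).
Proof.
move=> m; apply: is_matroidI.
- have [B b e] := rk_attain S (mat_ne m); exists (S :&: B); apply/mem_restr; by exists B.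
- by move=> X /mem_restr[B [b _ ->]]; rewrite subsetIl.
move=> X1 X2 x /mem_restr[B1 [b1 e1 ->]] /mem_restr[B2 [b2 e2 ->]].
rewrite !inE => /andP[xS x1]; rewrite xS /= => x2.
(* With the roles swapped, the mixed basis agrees with [B2] outside [S], so the exchange brings in
   an element of [S]. *)
have b := mat_mix m b2 b1 e2 e1; set B := _ :|: _ in b.
have xB : x \in B by rewrite !inE xS x1.
have [y y2 /andP[yB yb]] := mat_ex m b b2 xB x2.
have yS : y \in S by apply: contraR yB => yS; rewrite !inE yS y2 orbT.
have y1 : y \notin B1 by apply: contra yB => y1; rewrite !inE yS y1.
exists y; rewrite !inE ?yS ?y2 // (negPf y1) /=; apply/mem_restr; exists (y |: (B :\ x)).
have eX : y |: (S :&: B1) :\ x = S :&: (y |: B :\ x).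
  apply/setP => z; rewrite !inE; case: (boolP (z \in S)) => zS //=; first by rewrite orbF.
  by rewrite andbF orbF; apply: contraNF zS => /eqP ->.
split=> //; rewrite -eX card_swap ?inE ?xS //; by rewrite ?yS.
Qed.

(** An exchange form of the definition by circuits, derived in [stressed_hyperplaneP]. It produces
    old bases directly, and it passes to contractions by subsets of [H] of size less than [k], where
    the rank and the size of [H] drop by the same amount. *)
Definition stressed k A Bs H := [/\ H \subset A, k <= #|H|, (forall B, B \in Bs -> ~~ (B \subset H)) &
  forall X x, X \subset H -> #|X|.+1 = k -> x \in A -> x \notin H -> x |: X \in Bs].

Definition relaxF k Bs (HH : {set {set E}}) : {set {set E}} :=
  [set X : {set E} | (X \in Bs) || [exists H in HH, (X \subset H) && (#|X| == k)]].

Lemma mem_relaxF k Bs HH X :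
  reflect (X \in Bs \/ exists H, [/\ H \in HH, X \subset H & #|X| = k]) (X \in relaxF k Bs HH).
Proof.
rewrite inE; apply: (iffP orP) => -[]; try by left.
  by move=> /exists_inP[H h /andP[s /eqP c]]; right; exists H.
by move=> [H [h s c]]; right; apply/exists_inP; exists H; rewrite // s c eqxx.
Qed.

Lemma ex_draw X d : d <= #|X| -> exists2 Y : {set E}, Y \subset X & #|Y| = d.
Proof.
move=> dX; have : 0 < #|[set Y : {set E} | Y \subset X & #|Y| == d]| by rewrite cards_draws bin_gt0.
by case/card_gt0P => Y; rewrite inE => /andP[? /eqP ?]; exists Y.
Qed.

Section Relax.
Variables (A : {set E}) (Bs HH : {set {set E}}) (k : nat).
Hypotheses (m : is_matroid A Bs) (rkA : rk Bs A = k).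
Hypothesis sH : forall H, H \in HH -> stressed k A Bs H.
Hypothesis k0 : 0 < k.

Lemma card_basis B : B \in Bs -> #|B| = k.
Proof. by move=> b; rewrite -rkA (rk_full m b). Qed.

Lemma stressed_out H : H \in HH -> exists2 x, x \in A & x \notin H.
Proof.
move=> h; have [B b] := mat_ne m; have [_ _ /(_ _ b) /subsetPn[x xB xH] _] := sH h.
by exists x => //; apply: (subsetP (mat_sub m b)).
Qed.

Lemma relax_matroid : is_matroid A (relaxF k Bs HH).
Proof.
have cardR B : B \in relaxF k Bs HH -> #|B| = k.
  by case/mem_relaxF => [/card_basis //|[H [_ _ //]]].
apply: is_matroidI.
- by have [B b] := mat_ne m; exists B; apply/mem_relaxF; left.
- move=> B /mem_relaxF[/(mat_sub m) //|[H [h s _]]]; have [sA _ _ _] := sH h; exact: subset_trans s sA.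
move=> B1 B2 x r1 r2 x1 x2.
have [y0 y02 y01] : exists2 y, y \in B2 & y \notin B1.
  apply/subsetPn/negP => s; have e : B2 = B1 by apply/eqP; rewrite eqEcard s (cardR _ r1) (cardR _ r2) leqnn.
  by rewrite e x1 in x2.
have c1 : #|B1 :\ x|.+1 = k by have := cardR _ r1; rewrite (cardsD1 x) x1.
case/mem_relaxF: (r1) => [b1|[H [h s1 _]]].
  case/mem_relaxF: (r2) => [b2|[H [h s2 _]]].
    have [y y2 /andP[y1 yb]] := mat_ex m b1 b2 x1 x2.
    by exists y => //; rewrite y1; apply/mem_relaxF; left.
  have [sA _ nB sw] := sH h.
  case: (boolP (B1 :\ x \subset H)) => [s1|/subsetPn[s sB sH']].
    exists y0; rewrite // y01; apply/mem_relaxF; right; exists H; split=> //.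
      by rewrite subUset s1 sub1set (subsetP s2).
    by rewrite card_swap // cardR.
  move: sB; rewrite !inE => /andP[sx s1].
  have c2 : #|B2 :\ y0|.+1 = k by have := cardR _ r2; rewrite (cardsD1 y0) y02.
  (* Trading [y0] for the point [s] outside [H] turns the new basis [B2] into an old one, to which
     exchange in M applies. The element returned is not [s], which already lies in [B1]. *)
  have b2' : s |: (B2 :\ y0) \in Bs.
    apply: sw => //; first exact: subset_trans (subsetDl _ _) s2.
    exact: (subsetP (mat_sub m b1)).
  have xn : x \notin s |: (B2 :\ y0) by rewrite !inE negb_or eq_sym sx (negPf x2) andbF.
  have [y] := mat_ex m b1 b2' x1 xn; rewrite !inE => /orP[/eqP ->|/andP[_ y2]]; first by rewrite s1.
  by move=> /andP[y1 yb]; exists y => //; rewrite y1; apply/mem_relaxF; left.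
have [sA _ nB sw] := sH h.
have s1x : B1 :\ x \subset H by apply: subset_trans (subsetDl _ _) s1.
case: (boolP (B2 \subset H)) => [s2|/subsetPn[y y2 yH]].
  exists y0; rewrite // y01; apply/mem_relaxF; right; exists H; split=> //.
    by rewrite subUset s1x sub1set (subsetP s2).
  by rewrite card_swap // cardR.
exists y => //; apply/andP; split; first by apply: contra yH; apply: (subsetP s1).
apply/mem_relaxF; left; apply: sw => //.
case/mem_relaxF: r2 => [b2|[H' [h' s' _]]]; first exact: (subsetP (mat_sub m b2)).
have [sA' _ _ _] := sH h'; exact: (subsetP sA' _ (subsetP s' _ y2)).
Qed.

(** A point of one hyperplane outside the other would form a basis with k - 1 common points, inside
    a stressed hyperplane. So a set with at least k - 1 elements determines the relaxed hyperplane
    that contains it. *)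
Lemma stressed_inter H H' X : H \in HH -> H' \in HH -> X \subset H -> X \subset H' -> k <= #|X|.+1 -> H = H'.
Proof.
move=> h h' s s' c.
wlog cX : X s s' c / #|X|.+1 = k.
  move=> W; have [|Y sY cY] := @ex_draw X k.-1; first by lia.
  by apply: (W Y); rewrite ?(subset_trans sY) // cY; lia.
have sub G G' : G \in HH -> G' \in HH -> X \subset G -> X \subset G' -> G' \subset G.
  move=> g g' sg sg'; apply/subsetP => x xG'; apply: contraT => xG.
  have [_ _ _ sw] := sH g; have [sA' _ nB' _] := sH g'.
  by have := nB' _ (sw X x sg cX (subsetP sA' _ xG') xG); rewrite subUset sg' sub1set xG'.
by apply/eqP; rewrite eqEsubset (sub H' H) ?(sub H H').
Qed.

Lemma stressed_indep H S : H \in HH -> S \subset H -> #|S| < k -> exists2 B, B \in Bs & S \subset B.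
Proof.
move=> h sS cS; have [sA kH nB sw] := sH h; have [x xA xH] := stressed_out h.
have [X [sX cX SX]] : exists X : {set E}, [/\ X \subset H, #|X|.+1 = k & S \subset X].
  have : 0 < #|[set Y : {set E} | Y \subset H :\: S & #|Y| == k.-1 - #|S|]|.
    by rewrite cards_draws bin_gt0 cardsD (setIidPr sS); lia.
  case/card_gt0P => Y; rewrite inE subsetD => /andP[/andP[sY dYS] /eqP cY]; exists (S :|: Y); split.
  - by rewrite subUset sS.
  - rewrite cardsU (_ : S :&: Y = set0) ?cards0; last by apply/eqP; rewrite setI_eq0 disjoint_sym.
    by rewrite cY; lia.
  - exact: subsetUl.
exists (x |: X); first exact: sw.
exact: subset_trans SX (subsetUr _ _).
Qed.

Section NotIn.
Variable S : {set E}.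
Hypothesis (sSA : S \subset A) (nS : forall H, H \in HH -> ~~ (S \subset H)).

(** Replacing a point of [X] outside [S] by a point of [S] outside [H] gives an old basis that meets
    [S] in one element more. A new basis can therefore attain the rank of [S] only if it lies in
    [S]. *)
Lemma new_lt X H : H \in HH -> X \subset H -> #|X| = k -> #|S :&: X| < k -> #|S :&: X| < rk Bs S.
Proof.
move=> h sX cX lt; have [sA _ nB sw] := sH h; have /subsetPn[s sS sH'] := nS h.
have [x xX xS] : exists2 x, x \in X & x \notin S.
  apply/subsetPn/negP => XS; move: lt; by rewrite (setIidPr XS) cX ltnn.
have b : s |: (X :\ x) \in Bs.
  apply: sw => //; [exact: subset_trans (subsetDl _ _) sX| |exact: (subsetP sSA)].
  by have := cX; rewrite (cardsD1 x) xX.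
apply: leq_trans (rk_ge S b); apply: proper_card; apply/properP; split.
  apply/subsetP => z; rewrite !inE => /andP[zS zX]; rewrite zS zX andbT /= orbC.
  by apply/orP; left; apply: contraNneq xS => <-.
by exists s; rewrite !inE ?sS ?eqxx // negb_and; apply/orP; right; apply: contra sH'; apply: (subsetP sX).
Qed.

Lemma rk_relax_notin : rk (relaxF k Bs HH) S = rk Bs S.
Proof.
have [B b e] := rk_attain S (mat_ne m).
apply: (rk_eq (B := B)) => //; first by apply/mem_relaxF; left.
move=> X /mem_relaxF[b'|[H [h sX cX]]]; first exact: rk_ge.
case: (ltnP #|S :&: X| k) => lt; first exact: ltnW (new_lt h sX cX lt).
have XS : X \subset S.
  have /eqP <- : S :&: X == X by rewrite eqEcard subsetIr cX.
  exact: subsetIl.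
have /subsetPn[s sS sH'] := nS h; have [sA _ nB sw] := sH h.
have [x xX] : exists x, x \in X by apply/card_gt0P; rewrite cX.
have b' : s |: (X :\ x) \in Bs.
  apply: sw => //; [exact: subset_trans (subsetDl _ _) sX| |exact: (subsetP sSA)].
  by have := cX; rewrite (cardsD1 x) xX.
have sB' : s |: (X :\ x) \subset S.
  by rewrite subUset sub1set sS; apply: subset_trans (subsetDl _ _) XS.
have := rk_ge S b'; rewrite (setIidPr sB') (card_basis b') => le; apply: leq_trans le.
by rewrite -cX subset_leq_card ?subsetIr.
Qed.

Lemma contr_relax_notin : contrB (relaxF k Bs HH) S = contrB Bs S.
Proof.
apply/setP => Y; apply/mem_contr/mem_contr; rewrite rk_relax_notin => -[B [b e ->]]; last first.
  by exists B; split=> //; apply/mem_relaxF; left.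
case/mem_relaxF: b => [b|[H [h sX cX]]]; first by exists B.
case: (ltnP #|S :&: B| k) => lt; first by have := new_lt h sX cX lt; rewrite e ltnn.
have BS : B \subset S.
  have /eqP <- : S :&: B == B by rewrite eqEcard subsetIr cX.
  exact: subsetIl.
have [B' b' e'] := rk_attain S (mat_ne m).
exists B'; split=> //; have -> : B :\: S = set0 by apply/eqP; rewrite setD_eq0.
apply/esym/eqP; rewrite setD_eq0.
have /eqP <- : S :&: B' == B' by rewrite eqEcard subsetIr card_basis // e' -e.
exact: subsetIl.
Qed.

(** The rank bound excludes sets that contain a basis: such a set may contain k-subsets of a relaxed
    hyperplane, and these become bases of its restriction. *)
Lemma restr_relax_notin : rk Bs S < k -> restrB (relaxF k Bs HH) S = restrB Bs S.
Proof.
move=> rS; apply/setP => Y; apply/mem_restr/mem_restr; rewrite rk_relax_notin => -[B [b e ->]]; last first.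
  by exists B; split=> //; apply/mem_relaxF; left.
case/mem_relaxF: b => [b|[H [h sX cX]]]; first by exists B.
by have := new_lt h sX cX; rewrite e rS ltnn => /(_ isT).
Qed.
End NotIn.

Section InSmall.
Variables (S H0 : {set E}).
Hypothesis (h0 : H0 \in HH) (sS : S \subset H0) (cS : #|S| < k).

Lemma rk_small : rk Bs S = #|S|.
Proof.
have [B b SB] := stressed_indep h0 sS cS; apply: (rk_eq b); first by rewrite (setIidPl SB).
by move=> B' _; apply: subset_leq_card; apply: subsetIl.
Qed.

Lemma rk_relax_small : rk (relaxF k Bs HH) S = #|S|.
Proof.
have [B b SB] := stressed_indep h0 sS cS; apply: (rk_eq (B := B)); first by apply/mem_relaxF; left.
  by rewrite (setIidPl SB).
by move=> B' _; apply: subset_leq_card; apply: subsetIl.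
Qed.

Lemma full_cap B : #|S :&: B| = #|S| -> S \subset B.
Proof.
move=> e; have /eqP <- : S :&: B == S by rewrite eqEcard subsetIl e leqnn.
exact: subsetIr.
Qed.

Lemma contr_relax_small :
  contrB (relaxF k Bs HH) S =
  relaxF (k - #|S|) (contrB Bs S) [set H :\: S | H in [set H in HH | S \subset H]].
Proof.
apply/setP => Y; apply/mem_contr/mem_relaxF; rewrite ?rk_relax_small.
  move=> [B [b /full_cap SB ->]]; case/mem_relaxF: b => [b|[H [h sX cX]]].
    by left; apply/mem_contr; exists B; rewrite rk_small (setIidPl SB).
  right; exists (H :\: S); split; last by rewrite cardsD (setIidPr SB) cX.
    by apply: imset_f; rewrite inE h (subset_trans SB).
  exact: setSD.
case=> [/mem_contr[B [b e ->]]|[H' [/imsetP[H]]]].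
  by exists B; split=> //; [apply/mem_relaxF; left | rewrite e rk_small].
rewrite inE => /andP[h SH] -> sY cY.
have dYS : [disjoint Y & S] by move: sY; rewrite subsetD => /andP[].
have DY : (Y :|: S) :\: S = Y by rewrite setDUl setDv setU0; apply/setDidPl.
exists (Y :|: S); split=> //; last by rewrite (setIidPl (subsetUr _ _)).
apply/mem_relaxF; right; exists H; split=> //.
  by rewrite subUset SH andbT; apply: subset_trans sY (subsetDl _ _).
rewrite cardsU (_ : Y :&: S = set0) ?cards0; last by apply/eqP; rewrite setI_eq0.
by rewrite cY; lia.
Qed.

Lemma stressed_contr H : H \in HH -> S \subset H -> stressed (k - #|S|) (A :\: S) (contrB Bs S) (H :\: S).
Proof.
move=> h SH; have [sA kH nB sw] := sH h; split.
- exact: setSD.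
- by rewrite cardsD (setIidPr SH); lia.
- move=> Y /mem_contr[B [b _ ->]]; apply: contra (nB _ b) => s; apply/subsetP => x xB.
  by case: (boolP (x \in S)) => xS; [exact: (subsetP SH)|have := subsetP s x; rewrite !inE xS xB => /(_ isT)].
move=> X x sX cX; rewrite !inE => /andP[xS xA]; rewrite xS /= => xH.
have dXS : [disjoint X & S] by move: sX; rewrite subsetD => /andP[].
apply/mem_contr; exists (x |: (X :|: S)); split.
- apply: sw => //; first by rewrite subUset SH andbT; apply: subset_trans sX (subsetDl _ _).
  rewrite cardsU (_ : X :&: S = set0) ?cards0; last by apply/eqP; rewrite setI_eq0.
  by lia.
- rewrite rk_small (setIidPl _) // ; apply: subset_trans (subsetUr _ _); exact: subsetUr.
- rewrite !setDUl setDv setU0 (setDidPl dXS); congr (_ :|: _); apply/esym/setDidPl.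
  by rewrite disjoints1.
Qed.

Lemma restr_small : restrB Bs S = [set S].
Proof.
apply/setP => Y; rewrite inE; apply/mem_restr/eqP => [[B [b]]|->].
  by rewrite rk_small => /full_cap/setIidPl -> ->.
by have [B b SB] := stressed_indep h0 sS cS; exists B; rewrite rk_small (setIidPl SB).
Qed.

Lemma restr_relax_small : restrB (relaxF k Bs HH) S = [set S].
Proof.
apply/setP => Y; rewrite inE; apply/mem_restr/eqP => [[B [b]]|->].
  by rewrite rk_relax_small => /full_cap/setIidPl -> ->.
have [B b SB] := stressed_indep h0 sS cS; exists B; rewrite rk_relax_small (setIidPl SB); split=> //.
by apply/mem_relaxF; left.
Qed.
End InSmall.

Section InLarge.
Variables (S H0 : {set E}).
Hypothesis (h0 : H0 \in HH) (sS : S \subset H0) (cS : k <= #|S|).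

Lemma rk_large : rk Bs S = k.-1.
Proof.
have [sA kH nB sw] := sH h0; have [x xA xH] := stressed_out h0.
have [|Y sY cY] := @ex_draw S k.-1; first by lia.
have b : x |: Y \in Bs by apply: sw => //; [exact: subset_trans sY sS|lia].
apply: (rk_eq b).
  rewrite setIUr (setIidPr sY) (_ : S :&: [set x] = set0) ?set0U //.
  by apply/eqP; rewrite setIC setI_eq0 disjoints1; apply: contra xH; apply: (subsetP sS).
move=> B b'; have : #|S :&: B| <= k by rewrite -(card_basis b') subset_leq_card // subsetIr.
rewrite leq_eqVlt => /orP[/eqP e|]; last by lia.
case/negP: (nB _ b'); have /eqP <- : S :&: B == B by rewrite eqEcard subsetIr e (card_basis b') leqnn.
exact: subset_trans (subsetIl _ _) sS.
Qed.

Lemma contr_large : contrB Bs S = [set [set x] | x in A :\: H0].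
Proof.
have [sA kH nB sw] := sH h0.
apply/setP => Z; apply/mem_contr/imsetP; rewrite rk_large.
  move=> [B [b e ->]]; have /subsetPn[x xB xH] := nB _ b.
  exists x; first by rewrite inE xH (subsetP (mat_sub m b)).
  apply/esym/eqP; rewrite eqEcard sub1set !inE xB andbT; apply/andP; split.
    by apply: contra xH; apply: (subsetP sS).
  by rewrite cards1 cardsD setIC e card_basis //; lia.
move=> [x]; rewrite inE => /andP[xH xA] ->.
have [|Y sY cY] := @ex_draw S k.-1; first by lia.
have xS : x \notin S by apply: contra xH; apply: (subsetP sS).
exists (x |: Y); split.
- by apply: sw => //; [exact: subset_trans sY sS|lia].
- rewrite setIUr (setIidPr sY) (_ : S :&: [set x] = set0) ?set0U //.
  by apply/eqP; rewrite setIC setI_eq0 disjoints1.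
rewrite setDUl (_ : Y :\: S = set0) ?setU0; last by apply/eqP; rewrite setD_eq0.
by apply/esym/setDidPl; rewrite disjoints1.
Qed.

Lemma contr_relax_large : contrB (relaxF k Bs HH) S = [set set0].
Proof.
have [Y sY cY] := ex_draw cS.
have bY : Y \in relaxF k Bs HH.
  by apply/mem_relaxF; right; exists H0; split=> //; apply: subset_trans sY sS.
have rkS : rk (relaxF k Bs HH) S = k.
  apply: (rk_eq bY); first by rewrite (setIidPr sY).
  move=> B /mem_relaxF[b|[H [_ _ c]]]; rewrite -?(card_basis b) -?c subset_leq_card // subsetIr //.
apply/setP => Z; rewrite inE; apply/mem_contr/eqP; rewrite rkS; last first.
  by move=> ->; exists Y; split=> //; [rewrite (setIidPr sY)|apply/esym/eqP; rewrite setD_eq0].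
move=> [B [b e ->]]; apply/eqP; rewrite setD_eq0.
have cB : #|B| = k by case/mem_relaxF: b => [/card_basis //|[H [_ _ //]]].
have /eqP <- : S :&: B == B by rewrite eqEcard subsetIr e cB leqnn.
exact: subsetIl.
Qed.
End InLarge.

Lemma restr_hyper H : H \in HH -> restrB Bs H = [set X : {set E} | X \subset H & #|X| == k.-1].
Proof.
move=> h; have [sA kH nB sw] := sH h; have [x xA xH] := stressed_out h.
apply/setP => X; rewrite inE; apply/mem_restr/andP; rewrite (rk_large h (subxx H) kH).
  by move=> [B [b e ->]]; rewrite subsetIl e.
move=> [sX /eqP cX]; exists (x |: X).
have e : H :&: (x |: X) = X.
  rewrite setIUr (setIidPr sX) (_ : H :&: [set x] = set0) ?set0U //.
  by apply/eqP; rewrite setIC setI_eq0 disjoints1.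
by split; rewrite ?e //; apply: sw => //; lia.
Qed.
End Relax.
End Matroid.

Import Order.TTheory GRing.Theory Num.Theory.
Local Open Scope ring_scope.

(** * The convolution algebra of set functions *)

Section SetAlg.
Variables (T : finType) (K : comNzRingType).

Definition setalg := {ffun {set T} -> K}.
HB.instance Definition _ := GRing.Zmodule.on setalg.

Implicit Types f g : setalg.

Definition sa_one : setalg := [ffun A : {set T} => (A == set0)%:R].
(* The product is the value, at a permutation fixed once and for all, of the
   induction product of characters of symmetric groups. *)
Definition sa_mul f g : setalg :=
  [ffun A : {set T} => \sum_(S : {set T} | S \subset A) f S * g (A :\: S)].

Lemma sa_mulC : commutative sa_mul.
Proof.
move=> f g; apply/ffunP=> A; rewrite !ffunE.
rewrite (reindex_onto (fun S => A :\: S) (fun S => A :\: S)) /=; last first.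
  by move=> S sSA; rewrite setDDr setDv set0U; apply/setIidPr.
apply: eq_big => S.
  rewrite subsetDl /= setDDr setDv set0U.
  by apply/eqP/idP => [<-|/setIidPr //]; rewrite subsetIl.
by move=> /andP[_ /eqP e]; rewrite e mulrC.
Qed.

Lemma sa_mulA : associative sa_mul.
Proof.
move=> f g k; apply/ffunP=> A; rewrite !ffunE.
transitivity (\sum_(S : {set T} | S \subset A)
   \sum_(V : {set T} | (V \subset A) && (S \subset V)) f S * g (V :\: S) * k (A :\: V)).
  apply: eq_bigr => S sSA; rewrite ffunE big_distrr /=.
  rewrite (reindex_onto (fun V => V :\: S) (fun U => U :|: S)) /=; last first.
    move=> U; rewrite subsetD => /andP[_ dUS].
    by rewrite setDUl setDv setU0; apply/setDidPl.
  apply: eq_big => V.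
    rewrite (_ : (V :\: S) :|: S = V :|: S); last first.
      by apply/setP=> x; rewrite !inE; case: (x \in S); rewrite ?orbT ?orbF.
    apply/andP/andP => [[sV /eqP <-]|[sVA sSV]].
      split; last exact: subsetUr.
      rewrite subUset sSA andbT; apply/subsetP => x xV.
      case: (boolP (x \in S)) => xS; first exact: (subsetP sSA).
      by have := subsetP sV x; rewrite !inE xV xS => /(_ isT).
    split; first by rewrite setSD.
    by apply/eqP/setUidPl.
  move=> /andP[_ /eqP e]; rewrite mulrA; congr (_ * _ * k _).
  apply/setP=> x; rewrite -{2}e !inE; by case: (x \in S); case: (x \in V).
rewrite (exchange_big_dep (fun V : {set T} => V \subset A)) /=; last by move=> S V _ /andP[].
apply: eq_bigr => V sVA; rewrite ffunE big_distrl /=.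
apply: eq_big => [S|//]; rewrite sVA /=.
by apply/andP/idP => [[]//|sSV]; rewrite (subset_trans sSV).
Qed.

Lemma sa_mul1 : left_id sa_one sa_mul.
Proof.
move=> f; apply/ffunP=> A; rewrite !ffunE (bigD1 set0) ?sub0set //= ffunE eqxx mul1r setD0.
by rewrite big1 ?addr0 // => S /andP[_ nS]; rewrite ffunE (negPf nS) mul0r.
Qed.

Lemma sa_mulDl : left_distributive sa_mul +%R.
Proof.
move=> f g k; apply/ffunP=> A; rewrite !ffunE -big_split /=.
by apply: eq_bigr => S _; rewrite !ffunE mulrDl.
Qed.

Lemma sa_one_neq0 : sa_one != 0.
Proof.
by apply/negP=> /eqP/ffunP/(_ set0); rewrite !ffunE eqxx; apply/eqP/oner_neq0.
Qed.

HB.instance Definition _ := GRing.Zmodule_isComNzRing.Build setalg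
  sa_mulA sa_mulC sa_mul1 sa_mulDl sa_one_neq0.

Lemma sa_mulE f g A : (f * g) A = \sum_(S : {set T} | S \subset A) f S * g (A :\: S).
Proof. by rewrite [LHS]ffunE. Qed.
Lemma sa_oneE (A : {set T}) : (1 : setalg) A = (A == set0)%:R.
Proof. by rewrite [LHS]ffunE. Qed.
Lemma sa_addE f g A : (f + g) A = f A + g A.
Proof. by rewrite [LHS]ffunE. Qed.
Lemma sa_oppE f A : (- f) A = - f A.
Proof. by rewrite [LHS]ffunE. Qed.
Lemma sa_zeroE (A : {set T}) : (0 : setalg) A = 0.
Proof. by rewrite [LHS]ffunE. Qed.
Lemma sa_sumE (I : Type) (r : seq I) (p : pred I) (F : I -> setalg) A :
  (\sum_(i <- r | p i) F i) A = \sum_(i <- r | p i) F i A.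
Proof.
elim/big_rec2: _ => [|i y1 y2 _ <-]; first exact: sa_zeroE.
by rewrite sa_addE.
Qed.
Lemma sa_signE (n : nat) f A : ((-1) ^+ n * f) A = (-1) ^+ n * f A.
Proof. rewrite -signr_odd -[X in _ = X * _]signr_odd.
by case: odd; rewrite /= ?expr0 ?expr1 ?mul1r ?mulN1r ?sa_oppE. Qed.

Definition hset (st : pred {set T}) (n : nat) : setalg :=
  [ffun A : {set T} => (st A && (#|A| == n))%:R].

Lemma hset0 (st : pred {set T}) : st set0 -> hset st 0 = 1.
Proof.
move=> st0; apply/ffunP=> A; rewrite sa_oneE ffunE cards_eq0.
by case: eqP => [->|]; rewrite ?st0 ?andbF.
Qed.

Lemma hset_mulE st n f (A : {set T}) :
  (hset st n * f) A = \sum_(S : {set T} | [&& S \subset A, st S & #|S| == n]) f (A :\: S).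
Proof.
rewrite sa_mulE [RHS]big_mkcondr /=; apply: eq_bigr => S _; rewrite ffunE.
by case: ifP; rewrite ?mul1r ?mul0r.
Qed.

End SetAlg.

Section Pullback.
Variables (T U : finType) (K : comNzRingType) (j : T -> U).
Hypothesis injj : injective j.

(** Numbering the points of [H] and translating by a group element both act on set functions in this
    way. It is a ring morphism that preserves the h's of compatible permutations, so any polynomial
    expression in the h's may be evaluated on either side. *)
Definition sa_pull (f : setalg U K) : setalg T K := [ffun A : {set T} => f (j @: A)].

Lemma sa_pull_is_additive : zmod_morphism sa_pull.
Proof. by move=> f g; apply/ffunP=> A; rewrite sa_addE sa_oppE !ffunE. Qed.

Lemma sa_pull_is_multiplicative : monoid_morphism sa_pull.
Proof.
split=> [|f g]; apply/ffunP=> A.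
  rewrite ffunE !sa_oneE; congr (_%:R); by rewrite -!cards_eq0 card_imset.
rewrite ffunE !sa_mulE.
rewrite (reindex_onto (fun S : {set T} => j @: S) (fun S => j @^-1: S)) /=; last first.
  move=> S sSA; apply/setP=> x; apply/imsetP/idP => [[y]|xS].
    by rewrite inE => ? ->.
  have /imsetP[y yA e] := subsetP sSA x xS; exists y => //; by rewrite inE -e.
have jK (S : {set T}) : j @^-1: (j @: S) = S.
  apply/setP=> x; rewrite inE; apply/imsetP/idP => [[y yS /injj ->]//|xS]; by exists x.
apply: eq_big => S.
  rewrite jK eqxx andbT; apply/idP/idP => [s|]; last exact: imsetS.
  by apply/subsetP=> x xS; rewrite -(jK A) inE; apply: (subsetP s); apply: imset_f.
move=> /andP[sSA _]; rewrite !ffunE; congr (_ * g _).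
apply/setP=> x; rewrite inE; apply/andP/imsetP => [[nx /imsetP[y yA e]]|[y]].
  exists y => //; rewrite inE yA andbT; apply: contra nx => yS; by rewrite e imset_f.
rewrite inE => /andP[nyS yA] ->; split; last exact: imset_f.
by apply: contra nyS; rewrite -{2}(jK S) inE.
Qed.

HB.instance Definition _ := GRing.isZmodMorphism.Build (setalg U K) (setalg T K) sa_pull sa_pull_is_additive.
HB.instance Definition _ := GRing.isMonoidMorphism.Build (setalg U K) (setalg T K) sa_pull sa_pull_is_multiplicative.

Lemma sa_pull_hset (stU : pred {set U}) (stT : pred {set T}) n : (forall A : {set T}, stU (j @: A) = stT A) ->
  sa_pull (hset K stU n) = hset K stT n.
Proof. by move=> e; apply/ffunP=> A; rewrite !ffunE e card_imset. Qed.
End Pullback.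

(** * Hook and elementary symmetric functions over an abstract sequence of complete ones *)

Section Hooks.
Variables (R : comNzRingType) (h : nat -> R).

(* If [h] are the complete symmetric functions, [hook c r] is the Schur function
   of the hook (c, 1^r), including the junk case c = 0 (see [hook0]). *)
Fixpoint hook (c r : nat) : R :=
  if r is r'.+1 then h c * hook 1 r' - hook c.+1 r' else h c.

Definition elem (n : nat) : R := if n is r.+1 then hook 1 r else 1.

Lemma hookS c r : hook c r.+1 = h c * elem r.+1 - hook c.+1 r.
Proof. by []. Qed.

(** The Pieri recurrence defining [hook], iterated until the leg is used up. *)
Lemma sum_elem_h c r :
  \sum_(j < r.+1) (-1) ^+ (r - j) * elem j * h (c + (r - j)) = hook c r.
Proof.
elim: r c => [|r IH] c; first by rewrite big_ord1 /= addn0 mulr1 mul1r.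
rewrite hookS -IH big_ord_recr -sumrN [LHS]addrC subnn addn0 expr0 mul1r.
rewrite [X in X + _ = _]mulrC; congr (_ + _).
apply: eq_bigr => j _; have jr : (j <= r)%N by rewrite -ltnS.
by rewrite subSn // addnS addSn exprS !mulNr mul1r.
Qed.

Hypothesis h0 : h 0 = 1.

Lemma hook0 r : hook 0 r = (r == 0)%:R.
Proof. by case: r => [|r]; rewrite /= h0 ?mul1r ?subrr. Qed.

Lemma sum_elem_h0 n :
  \sum_(j < n.+1) (-1) ^+ j * elem j * h (n - j) = (n == 0)%:R.
Proof.
transitivity ((-1) ^+ n * hook 0 n); last by rewrite hook0; case: n => [|n]; rewrite ?mulr0 ?mul1r.
rewrite -sum_elem_h big_distrr /=; apply: eq_bigr => j _.
have jn : (j <= n)%N by rewrite -ltnS.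
rewrite add0n !mulrA -exprD; congr (_ * _ * _).
rewrite (_ : (n + (n - j) = j + 2 * (n - j))%N); last by lia.
by rewrite exprD exprM sqrrN !expr1n mulr1.
Qed.

Lemma sum_h_elem n : \sum_(j < n.+1) h (n - j) * ((-1) ^+ j * elem j) = (n == 0)%:R.
Proof. by rewrite -sum_elem_h0; apply: eq_bigr => j _; rewrite mulrC. Qed.

(** In generating series: the signed hooks with fixed [c] sum to the h-series with its first [c]
    terms removed and shifted down, divided by the full h-series. Convolution with the h's undoes
    the division. *)
Lemma sum_h_hook c n :
  \sum_(w < n.+1) h (n - w) * ((-1) ^+ w * hook c w) = h (c + n).
Proof.
elim: n c => [|n IH] c; first by rewrite big_ord1 /= h0 addn0 !mul1r.
rewrite big_ord_recl /= expr0 mul1r subn0.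
transitivity (h c * \sum_(j < n.+2) h (n.+1 - j) * ((-1) ^+ j * elem j)
   + \sum_(w < n.+1) h (n - w) * ((-1) ^+ w * hook c.+1 w)).
  rewrite [X in _ = _ * X + _]big_ord_recl /= mulrDr -addrA subn0 expr0 !mulr1 [_ * h c]mulrC; congr (_ + _).
  rewrite big_distrr -big_split /=; apply: eq_bigr => w _.
  rewrite /bump /= add1n subSS exprS; ring.
by rewrite IH sum_h_elem mulr0 add0r addSnnS.
Qed.

Section Antisym.
Variables x y : nat -> R.
(* [lower k i] is the coefficient of t^i of a polynomial of degree < k/2; by
   [lower_sym], completing it with the h's is palindromic up to a defect that
   depends only on the h-convolutions of x and y. This is how the Z-polynomial
   identities below determine P. *)
Definition asym i i' := x i * y i' - x i' * y i.
Definition lower k i := \sum_(r < k.+1 | (i.*2 < r)%N) h (k - r) * asym i (r - i).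

Lemma lower_eq0 k i : (k <= i.*2)%N -> lower k i = 0.
Proof. by move=> ki; rewrite /lower big1 // => r; have := ltn_ord r; lia. Qed.

Lemma lowerE b i : lower (b + i) i = \sum_(i' < b.+1 | (i < i')%N) h (b - i') * asym i i'.
Proof.
rewrite /lower -!(big_mkord (fun r => i.*2 < r)%N (fun r => h (b + i - r) * asym i (r - i))).
rewrite -(big_mkord (fun r => i < r)%N (fun r => h (b - r) * asym i r)).
rewrite (big_cat_nat (n := i)) //=; last by lia.
rewrite big_nat_cond big1 ?add0r; last by move=> r; lia.
rewrite -{1}(add0n i) big_addn -addSn addnK.
by apply: eq_big => r; [lia | move=> _; rewrite addnK subnDr].
Qed.

Lemma lower_sym m b :
  \sum_(i < m.+1) h (m - i) * lower (b + i) i - \sum_(i < b.+1) h (b - i) * lower (m + i) i =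
  (\sum_(i < m.+1) h (m - i) * x i) * (\sum_(i < b.+1) h (b - i) * y i) -
  (\sum_(i < b.+1) h (b - i) * x i) * (\sum_(i < m.+1) h (m - i) * y i).
Proof.
pose F i i' := h (m - i) * h (b - i') * asym i i'.
have -> : \sum_(i < m.+1) h (m - i) * lower (b + i) i =
  \sum_(i < m.+1) \sum_(i' < b.+1 | (i < i')%N) F i i'.
  by apply: eq_bigr => i _; rewrite lowerE big_distrr; apply: eq_bigr => i' _; rewrite /F /=; ring.
have -> : \sum_(i < b.+1) h (b - i) * lower (m + i) i =
  - \sum_(i < m.+1) \sum_(i' < b.+1 | (i' < i)%N) F i i'.
  under [X in - X]eq_bigr do rewrite big_mkcond.
  rewrite exchange_big /= -sumrN; apply: eq_bigr => i' _.
  rewrite lowerE big_distrr -sumrN [LHS]big_mkcond; apply: eq_bigr => i _.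
  by case: ifP => _; rewrite ?oppr0 // /F /asym /=; ring.
(* The pairs with i < i' come from the first sum and those with i' < i from the second; antisymmetry
   supplies the sign, and the diagonal vanishes. *)
transitivity (\sum_(i < m.+1) \sum_(i' < b.+1) F i i').
  rewrite opprK -big_split /=; apply: eq_bigr => i _.
  rewrite big_mkcond [X in _ + X]big_mkcond -big_split /=; apply: eq_bigr => i' _.
  by case: ltngtP => [||->]; rewrite ?addr0 ?add0r // /F /asym subrr mulr0.
rewrite !big_distrlr /=.
rewrite [X in _ - X]exchange_big /= -sumrB; apply: eq_bigr => i _.
by rewrite -sumrB; apply: eq_bigr => i' _; rewrite /F /asym; ring.
Qed.
End Antisym.
End Hooks.

(** * The Jacobi-Trudi formula *)

Definition hsub (R : nzRingType) (h : nat -> R) (a b : nat) : R :=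
  if (b <= a)%N then h (a - b)%N else 0.

Definition stair (N : nat) (i : 'I_N) : nat := (N - i.+1)%N.

Section Bialternant.
Variables (K : comNzRingType) (N B : nat) (y : 'I_N -> K).
Hypothesis NB : (N <= B)%N.

(** The truncation at degree [B] keeps everything polynomial: for m < B, [hcoef m] is still the
    complete symmetric polynomial of degree m in the y's. *)
Definition geom (j : 'I_N) : {poly K} := \sum_(a < B) (y j *: 'X) ^+ a.
Definition hpoly : {poly K} := \prod_j geom j.
Definition hcoef (m : nat) : K := hpoly`_m.
Definition altmx (g : 'I_N -> nat) : 'M[K]_N := \matrix_(i, j) y j ^+ g i.
Definition hmx (g : 'I_N -> nat) : 'M[K]_N := \matrix_(i, j) hsub hcoef (g i) (stair j).

Lemma geomE j m : (m < B)%N -> (geom j)`_m = y j ^+ m.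
Proof.
move=> mB; rewrite /geom.
rewrite (eq_bigr (fun a : 'I_B => y j ^+ a *: 'X^a)); last by move=> a _; rewrite exprZn.
by rewrite -poly_def coef_poly mB.
Qed.

Lemma geom_inv j : geom j * (1 - y j *: 'X) = 1 - y j ^+ B *: 'X^B.
Proof.
have := subrX1 (y j *: 'X : {poly K}) B; rewrite exprZn => e.
by rewrite /geom -[1 - y j ^+ B *: _]opprB e mulrC -mulNr opprB.
Qed.

Lemma coef_mul_low (F : {poly K}) c m : (m < B)%N -> (F * (1 - c *: 'X^B))`_m = F`_m.
Proof. by move=> mB; rewrite mulrBr mulr1 coefB -scalerAr coefZ coefMXn mB mulr0 subr0. Qed.

Definition cofac (j : 'I_N) : {poly K} := \prod_(i | i != j) (1 - y i *: 'X).

Lemma size_cofac j : (size (cofac j) <= N)%N.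
Proof.
apply: (leq_trans (size_poly_prod_leq _ _)).
have s i : (size (1 - y i *: 'X : {poly K})%R <= 2)%N.
  apply: (leq_trans (size_polyD _ _)); rewrite size_poly1 geq_max /= size_polyN.
  by apply: (leq_trans (size_scale_leq _ _)); rewrite size_polyX.
have le : (\sum_(i < N | i != j) size (1 - y i *: 'X : {poly K})%R <= \sum_(i < N | i != j) 2)%N.
  by apply: leq_sum => i _; exact: s.
have cN : #|[pred i | i != j]| = N.-1 by rewrite cardC1 card_ord.
rewrite sum_nat_const cN in le.
rewrite leq_subLR.
apply: (leq_trans (n := (N.-1 * 2).+1)); first by rewrite ltnS.
by have := ltn_ord j; rewrite cN; lia.
Qed.

(** Multiplying the product of all geometric series by the factors 1 - y_i X with i different from j
    leaves the series of the powers of y_j, up to terms of degree at least [B]. Reading off one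
    coefficient factors the power of [y j] through the h's. *)
Lemma expr_cofac j m : (m < B)%N ->
  y j ^+ m = \sum_(k < N) hsub hcoef m (stair k) * (cofac j)`_(stair k).
Proof.
move=> mB.
have e : cofac j * hpoly = geom j * \prod_(i | i != j) (1 - y i ^+ B *: 'X^B).
  rewrite /hpoly (bigD1 j) //= mulrCA -big_split /=; congr (_ * _).
  by apply: eq_bigr => i _; rewrite mulrC geom_inv.
have {e}-> : y j ^+ m = (cofac j * hpoly)`_m.
  rewrite e -geomE //; elim/big_rec: _ => [|i F _ IH]; first by rewrite mulr1.
  by rewrite [_ * F]mulrC mulrA coef_mul_low.
pose F k := hsub hcoef m k * (cofac j)`_k.
transitivity (\sum_(k < N) F k); last first.
  rewrite (reindex_inj rev_ord_inj) /=; apply: eq_bigr => k _.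
  by rewrite /F /stair.
transitivity (\sum_(k < maxn N m.+1) F k).
  rewrite coefM [LHS](eq_bigr (fun k : 'I_m.+1 => F k)).
    rewrite (big_ord_widen _ F (leq_maxr N m.+1)) big_mkcond /=.
    apply: eq_bigr => k _; case: ifP => // mk.
    by rewrite /F /hsub; case: leqP => [|_]; rewrite ?mul0r //; lia.
  by move=> k _; rewrite /F /hsub -ltnS ltn_ord mulrC.
rewrite (big_ord_widen _ F (leq_maxl N m.+1)) [RHS]big_mkcond /=.
apply: eq_bigr => k _; case: ifP => // nk.
rewrite /F nth_default ?mulr0 //; apply: leq_trans (size_cofac j) _; lia.
Qed.

Lemma stair_lt (i : 'I_N) : (stair i < N)%N.
Proof. by have := ltn_ord i; rewrite /stair; lia. Qed.

(** By [expr_cofac] every alternant is [hmx] times one fixed matrix. For the exponents [stair] the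
    factor [hmx] is unitriangular, so the determinant of the fixed matrix is the Vandermonde. *)
Lemma bialternant (g : 'I_N -> nat) : (forall i, g i < B)%N ->
  \det (altmx g) = \det (hmx g) * \det (altmx (@stair N)).
Proof.
pose C : 'M[K]_N := \matrix_(k, j) (cofac j)`_(stair k).
have fac f : (forall i, f i < B)%N -> \det (altmx f) = \det (hmx f) * \det C.
  move=> fB; rewrite -det_mulmx; congr (\det _); apply/matrixP=> i j; rewrite !mxE.
  by rewrite expr_cofac //; apply: eq_bigr => k _; rewrite !mxE.
move=> gB; rewrite (fac g gB) (fac (@stair N)); last by move=> i; apply: leq_trans (stair_lt i) NB.
suff -> : \det (hmx (@stair N)) = 1 by rewrite mul1r.
rewrite -det_tr det_trig; last first.
  apply/is_trig_mxP => i j ij; rewrite !mxE /hsub /stair ifF //.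
  by have := ltn_ord j; have := ltn_ord i; lia.
apply: big1 => i _; rewrite !mxE /hsub leqnn subnn /hcoef /hpoly.
have : (0 < B)%N by have := ltn_ord i; lia.
move=> B0; elim/big_rec: _ => [|j F _ e]; first by rewrite coef1.
by rewrite coef0M geomE // expr0 e mulr1.
Qed.
End Bialternant.

(** * Burnside counting of colourings and orthogonality of the Jacobi-Trudi characters *)

Section Colorings.
Variables (n : nat) (C : finType).
Implicit Types (F : {ffun 'I_n -> C}) (s t : {perm 'I_n}).

Definition inv_col s F := [forall x, F (s x) == F x].
Definition cnt F (c : C) : nat := #|[set x | F x == c]|.

Lemma cnt_perm F s c : cnt [ffun x => F (s x)] c = cnt F c.
Proof.
rewrite /cnt -(card_imset _ (@perm_inj _ s)); congr #|pred_of_set _|.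
apply/setP=> x; apply/imsetP/idP => [[z]|].
  by rewrite !inE ffunE => zc ->.
by rewrite inE => xc; exists (s^-1%g x); rewrite ?inE ?ffunE permKV.
Qed.

Lemma sum_cnt F : (\sum_c cnt F c)%N = n.
Proof.
rewrite -[RHS]card_ord -sum1_card (partition_big F xpredT) //=.
by apply: eq_bigr => c _; rewrite /cnt sum1dep_card.
Qed.

Lemma cnt_eq_perm F F0 : (forall c, cnt F c = cnt F0 c) ->
  exists s, forall x, F x = F0 (s x).
Proof.
move=> e.
have ct (G : {ffun 'I_n -> C}) c : count_mem c (codom G) = cnt G c.
  rewrite codomE count_map /cnt cardE size_filter /= -enumT.
  by apply: eq_in_count => x _; rewrite !inE.
have st (G : {ffun 'I_n -> C}) : size (codom G) == n by rewrite size_codom card_ord.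
have : perm_eq (Tuple (st F)) (Tuple (st F0)).
  by apply/allP => c _ /=; rewrite !ct e.
case/tuple_permP => s es; exists s => x.
have nG (G : {ffun 'I_n -> C}) z : tnth (Tuple (st G)) z = G z.
  by rewrite (tnth_nth (G z)) /= codomE (nth_map z) ?size_enum_ord // nth_ord_enum.
have := congr1 (fun u => nth (F x) u x) es; rewrite -[nth _ (tval (Tuple _)) _]tnth_nth nG.
by move=> ->; rewrite -tnth_nth tnth_mktuple nG.
Qed.

Lemma ex_cnt (X : C -> nat) : (\sum_c X c)%N = n -> exists F, forall c, cnt F c = X c.
Proof.
move=> eX; pose l := flatten [seq nseq (X c) c | c <- enum C].
have sl : size l == n.
  rewrite size_flatten /shape -map_comp sumnE big_map -eX big_enum /=.
  by apply/eqP/eq_bigr => c _; rewrite size_nseq.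
exists [ffun x => tnth (Tuple sl) x] => c.
have -> : cnt [ffun x => tnth (Tuple sl) x] c = count_mem c l.
  transitivity (count_mem c [seq tnth (Tuple sl) i | i <- enum 'I_n]); last by rewrite map_tnth_enum.
  rewrite /cnt count_map cardE size_filter -enumT.
  by apply: eq_in_count => x _; rewrite !inE ffunE.
rewrite /l count_flatten -map_comp sumnE big_map big_enum /= (bigD1 c) //= count_nseq /= eqxx mul1n.
by rewrite big1 ?addn0 // => d dc; rewrite count_nseq /= (negPf dc).
Qed.

Variables (b : nat).
Hypothesis nb : (n <= b)%N.
Definition cntf F : {ffun C -> 'I_b.+1} := [ffun c => inord (cnt F c)].

Lemma cnt_le F c : (cnt F c <= n)%N.
Proof. by rewrite -[X in (_ <= X)%N]card_ord max_card. Qed.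

Lemma cntfE F c : cntf F c = cnt F c :> nat.
Proof. by rewrite ffunE inordK // ltnS (leq_trans (cnt_le F c)). Qed.

(** The permutations that carry [F0] to [F] form a coset of the stabilizer of [F]. *)
Lemma card_inv_col F F0 : (forall c, cnt F c = cnt F0 c) ->
  #|[set s | inv_col s F]| = #|[set s : {perm 'I_n} | [ffun x => F0 (s x)] == F]|.
Proof.
move=> /cnt_eq_perm[s0 e].
rewrite -(card_imset _ (mulIg s0)); congr #|pred_of_set _|.
apply/setP=> t; apply/imsetP/idP => [[s]|].
  rewrite !inE => /forallP i ->; apply/eqP/ffunP=> x; rewrite ffunE permM -e.
  exact/eqP.
rewrite inE => /eqP/ffunP i; exists (t * s0^-1)%g; last by rewrite mulgKV.
rewrite inE; apply/forallP=> x; rewrite e permM permKV -i ffunE //.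
Qed.

(** The possible contents label the orbits of the symmetric group on colourings, and each orbit
    contributes n! times its common weight. *)
Lemma burnside_col (K : comNzRingType) (w : {ffun C -> 'I_b.+1} -> K) :
  \sum_(s : {perm 'I_n}) \sum_(F | inv_col s F) w (cntf F) =
  n`!%:R * \sum_(X : {ffun C -> 'I_b.+1} | (\sum_c X c)%N == n) w X.
Proof.
rewrite (exchange_big_dep xpredT) //=.
rewrite (partition_big cntf (fun X => (\sum_c X c)%N == n)) /=; last first.
  by move=> F _; under eq_bigr do rewrite cntfE; rewrite sum_cnt.
rewrite big_distrr /=; apply: eq_bigr => X /eqP eX.
have [F0 e0] := ex_cnt eX.
transitivity (\sum_(F | cntf F == X) \sum_(s : {perm 'I_n} | [ffun x => F0 (s x)] == F) w X).
  apply: eq_bigr => F /eqP eF; rewrite eF !sumr_const; congr (_ *+ _).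
  have := @card_inv_col F F0 _; rewrite !cardsE; apply=> c.
  by rewrite e0 -eF cntfE.
rewrite -(partition_big (fun s : {perm 'I_n} => [ffun x => F0 (s x)]) (fun F => cntf F == X) (P := xpredT)) /=.
  by rewrite sumr_const mulr_natl; congr (_ *+ _); apply: card_Sn.
move=> s _; apply/eqP/ffunP=> c; apply/val_inj; rewrite /= cntfE cnt_perm; exact: e0.
Qed.
End Colorings.

Lemma hsub_hcoefE (K : comNzRingType) N B (y : 'I_N -> K) a c :
  hsub (hcoef B y) a c =
  \sum_(v : {ffun 'I_N -> 'I_B} | (\sum_j v j + c)%N == a) \prod_j y j ^+ v j.
Proof.
have e m : hcoef B y m = \sum_(v : {ffun 'I_N -> 'I_B} | (\sum_j v j)%N == m) \prod_j y j ^+ v j.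
  rewrite /hcoef /hpoly /geom bigA_distr_bigA /= coef_sum [RHS]big_mkcond /=.
  apply: eq_bigr => v _.
  rewrite (eq_bigr (fun j => (y j ^+ v j)%:P * 'X^(v j))); last first.
    by move=> j _; rewrite exprZn -mul_polyC.
  rewrite big_split /= -rmorph_prod /= coefCM.
  rewrite -(big_morph (fun k => 'X^k) (fun u v => exprD _ u v) (expr0 _)) coefXn eq_sym.
  by case: eqP; rewrite ?mulr1 ?mulr0.
rewrite /hsub; case: leqP => ca.
  by rewrite e; apply: eq_bigl => v; lia.
by rewrite big_pred0 // => v; lia.
Qed.

Section Star.
Variables (n N : nat).
Implicit Types (s : {perm 'I_n}) (g k : 'I_N -> nat).

(* s-invariant colorings of content g - k, stated without subtraction *)
Definition ncol g k s : nat :=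
  #|[set F : {ffun 'I_n -> 'I_N} | inv_col s F && [forall i, cnt F i + k i == g i]%N]|.

(* For g = lam + delta and k = mu + delta, delta = (N - 1, ..., 0), this is the
   Jacobi-Trudi formula for the character of V_(lam/mu). *)
Definition jt g k s : algC := \sum_(w : 'S_N) (-1) ^+ w * (ncol g (k \o w) s)%:R.

Section Sums.
Variables (K : comNzRingType) (y : 'I_N -> K) (b : nat).
Hypothesis nb : (n <= b)%N.

(** An invariant colouring is constant on cycles, so this is the product of power sums for the cycle
    type of [s]. *)
Definition powsum s : K := \sum_(F : {ffun 'I_n -> 'I_N} | inv_col s F) \prod_i y i ^+ cnt F i.

(** The Frobenius characteristic of a permutation character is a product of complete functions. A
    pair of invariant colourings is one invariant colouring by pairs, whose content is a matrix: its
    row sums are prescribed by g - k, and its column sums give the monomial. *)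
Lemma sum_ncol_powsum g k : (\sum_i g i = n + \sum_i k i)%N ->
  \sum_(s : {perm 'I_n}) (ncol g k s)%:R * powsum s =
  n`!%:R * \prod_i hsub (hcoef b.+1 y) (g i) (k i).
Proof.
move=> egk.
pose okX (X : {ffun 'I_N * 'I_N -> 'I_b.+1}) := [forall i, (\sum_j X (i, j) + k i)%N == g i].
pose w X := (okX X)%:R * \prod_j y j ^+ (\sum_i X (i, j))%N.
transitivity (\sum_(s : {perm 'I_n}) \sum_(F : {ffun 'I_n -> 'I_N * 'I_N} | inv_col s F) w (cntf b F)).
  apply: eq_bigr => s _; rewrite /ncol cardsE -sum1_card natr_sum big_distrl /=.
  under eq_bigr do rewrite mul1r /powsum.
  rewrite pair_big /=.
  pose mk (p : {ffun 'I_n -> 'I_N} * {ffun 'I_n -> 'I_N}) : {ffun 'I_n -> 'I_N * 'I_N} :=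
    [ffun x => (p.1 x, p.2 x)].
  pose un (F : {ffun 'I_n -> 'I_N * 'I_N}) : {ffun 'I_n -> 'I_N} * {ffun 'I_n -> 'I_N} :=
    ([ffun x => (F x).1], [ffun x => (F x).2]).
  have unK F : mk (un F) = F by apply/ffunP=> x; rewrite !ffunE; case: (F x).
  have mkK p : un (mk p) = p by case: p => p1 p2; congr (_, _); apply/ffunP=> x; rewrite !ffunE.
  rewrite [RHS](reindex_onto mk un) /=; last by move=> F _; exact: unK.
  rewrite [RHS](eq_bigl (fun p => inv_col s p.1 && inv_col s p.2)); last first.
    move=> p; rewrite mkK eqxx andbT; apply/forallP/andP => [i|[/forallP i1 /forallP i2] x].
      by split; apply/forallP => x; have := i x; rewrite !ffunE => /eqP[e1 e2]; rewrite ?e1 ?e2.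
    by rewrite !ffunE (eqP (i1 x)) (eqP (i2 x)).
  have c1 p i : (\sum_j cntf b (mk p) (i, j))%N = cnt p.1 i.
    under eq_bigr do rewrite cntfE //.
    rewrite /cnt -sum1_card (partition_big p.2 xpredT) //=.
    apply: eq_bigr => j _; rewrite sum1_card; apply: eq_card => x; rewrite !inE ffunE xpair_eqE.
    by rewrite -[RHS]topredE /= inE.
  have c2 p j : (\sum_i cntf b (mk p) (i, j))%N = cnt p.2 j.
    under eq_bigr do rewrite cntfE //.
    rewrite /cnt -sum1_card (partition_big p.1 xpredT) //=.
    apply: eq_bigr => i _; rewrite sum1_card; apply: eq_card => x; rewrite !inE ffunE xpair_eqE.
    by rewrite -[RHS]topredE /= inE andbC.
  rewrite [RHS](eq_bigr (fun p => ([forall i, cnt p.1 i + k i == g i]%N)%:R * \prod_i y i ^+ cnt p.2 i)); last first.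
    move=> p _; rewrite /w /okX; congr ((nat_of_bool _)%:R * _).
      by apply: eq_forallb => i; rewrite c1.
    by apply: eq_bigr => j _; rewrite c2.
  rewrite big_mkcond [RHS]big_mkcond /=; apply: eq_bigr => p _.
  rewrite -[_ \in _]topredE /=; case: (inv_col s p.1); case: (inv_col s p.2); rewrite ?andbF //= andbT.
  by case: ifP; rewrite ?mul1r ?mul0r.
rewrite (burnside_col nb w); congr (_ * _).
under [RHS]eq_bigr do rewrite hsub_hcoefE.
rewrite [RHS](bigA_distr_big_dep _ (fun i (v : {ffun 'I_N -> 'I_b.+1}) => \prod_j y j ^+ v j)) /=.
pose cu (X : {ffun 'I_N * 'I_N -> 'I_b.+1}) : {ffun 'I_N -> {ffun 'I_N -> 'I_b.+1}} :=
  [ffun i => [ffun j => X (i, j)]].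
pose uc (V : {ffun 'I_N -> {ffun 'I_N -> 'I_b.+1}}) : {ffun 'I_N * 'I_N -> 'I_b.+1} :=
  [ffun p => V p.1 p.2].
rewrite [RHS](reindex_onto cu uc) /=; last first.
  by move=> V _; apply/ffunP=> i; apply/ffunP=> j; rewrite !ffunE.
rewrite [RHS](eq_bigl okX); last first.
  move=> X; rewrite (_ : uc (cu X) = X) ?eqxx ?andbT; last first.
    by apply/ffunP=> -[i j]; rewrite !ffunE.
  have e i : (cu X i \in [pred v : {ffun 'I_N -> 'I_b.+1} | (\sum_j v j + k i)%N == g i])
      = ((\sum_j X (i, j) + k i)%N == g i).
    by rewrite inE ffunE; under eq_bigr do rewrite ffunE.
  by apply/familyP/forallP => f i; have := f i; rewrite -e.
rewrite big_mkcond [RHS]big_mkcond /=; apply: eq_bigr => X _.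
rewrite /w; case: (boolP (okX X)) => oX; last by rewrite mul0r if_same.
rewrite mul1r ifT; last first.
  rewrite -(eqn_add2r (\sum_i k i)) -egk; apply/eqP.
  rewrite -(eq_bigr _ (fun i _ => eqP (forallP oX i))) big_split /=; congr (_ + _)%N.
  by rewrite pair_bigA /=; apply: eq_bigr => -[i j].
rewrite exchange_big /=; apply: eq_bigr => j _; rewrite -prodrXr.
by apply: eq_bigr => i _; rewrite !ffunE.
Qed.
End Sums.

Lemma sum_stair_perm (w : 'S_N) : (\sum_i stair (w i) = \sum_(i < N) stair i)%N.
Proof. by rewrite [RHS](reindex_inj (@perm_inj _ w)). Qed.

Lemma det_hmxE (K : comNzRingType) (y : 'I_N -> K) b g :
  (n <= b)%N -> (\sum_i g i = n + \sum_(i < N) stair i)%N ->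
  n`!%:R * \det (hmx b.+1 y g) =
  \sum_(s : {perm 'I_n}) (\sum_(w : 'S_N) (-1) ^+ w * (ncol g (@stair N \o w) s)%:R) * powsum y s.
Proof.
move=> nb eg; rewrite /determinant big_distrr /=.
under [RHS]eq_bigr do rewrite big_distrl /=.
rewrite exchange_big; apply: eq_bigr => w _ /=.
under [RHS]eq_bigr do rewrite -mulrA.
rewrite -big_distrr /= (sum_ncol_powsum y nb) /=; last by rewrite sum_stair_perm.
rewrite mulrCA; congr (_ * (_ * _)); apply: eq_bigr => i _; by rewrite mxE.
Qed.

(** Compare the coefficients of y^k in n! times the bialternant identity for [g]. The alternant of
    [g] yields the signed sum, and in the product of [powsum y s] with the Vandermonde the
    coefficient is [jt k] at [s], by Frobenius's formula. *)
Lemma jt_orthogonality g k : (\sum_i g i = n + \sum_(i < N) stair i)%N ->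
  \sum_(s : {perm 'I_n}) jt g (@stair N) s * jt k (@stair N) s =
  n`!%:R * \sum_(w : 'S_N) (-1) ^+ w * [forall i, k i == g (w i)]%:R.
Proof.
move=> eg; pose b := (n + N + \sum_i g i)%N.
have nb : (n <= b)%N by rewrite /b; lia.
have Nb : (N <= b.+1)%N by rewrite /b; lia.
have gb i : (g i < b.+1)%N.
  by rewrite ltnS /b; apply: leq_trans (leq_addl _ _); rewrite (bigD1 i) //= leq_addr.
pose y (i : 'I_N) : {mpoly algC[N]} := 'X_i.
pose mk (f : 'I_N -> nat) : 'X_{1..N} := [multinom f i | i < N].
have yE f : \prod_i y i ^+ f i = 'X_[mk f].
  by rewrite mpolyXE_id; apply: eq_bigr => i _; rewrite mnmE.
have altE f : \det (altmx y f) = \sum_(w : 'S_N) (-1) ^+ w *: 'X_[mk (f \o w)].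
  rewrite /determinant (reindex_inj invg_inj) /=; apply: eq_bigr => w _.
  rewrite odd_permV -yE scaler_sign -signr_odd mulr_sign.
  rewrite (_ : \prod_i altmx y f i (w^-1%g i) = \prod_i y i ^+ (f \o w) i) ?oddb //.
  rewrite [LHS](reindex_inj (@perm_inj _ w)) /=; apply: eq_bigr => i _.
  by rewrite mxE permK.
have := bialternant y Nb gb.
move/(congr1 (fun p => (n`!%:R * p)@_(mk k))).
rewrite mulrA det_hmxE //.
have -> : (n`!%:R * \det (altmx y g))@_(mk k) =
   n`!%:R * \sum_(w : 'S_N) (-1) ^+ w * [forall i, k i == g (w i)]%:R.
  rewrite -[n`!%:R in LHS]mpolyC_nat mcoeffCM altE raddf_sum /=; congr (_ * _).
  apply: eq_bigr => w _; rewrite mcoeffZ mcoeffX; congr (_ * (nat_of_bool _)%:R).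
  apply/eqP/forallP => [e i|e]; first by have := congr1 (fun m : 'X_{1..N} => m i) e; rewrite !mnmE => /= ->.
  by apply/mnmP => i; rewrite !mnmE /= (eqP (e i)).
move=> ->; rewrite big_distrl raddf_sum /=; apply: eq_bigr => s _.
rewrite -mulrA.
have -> : \sum_(w : 'S_N) (-1) ^+ w * (ncol g (@stair N \o w) s)%:R = (jt g (@stair N) s)%:MP :> {mpoly algC[N]}.
  rewrite /jt [in RHS]rmorph_sum /=; apply: eq_bigr => w _.
  by rewrite rmorphM rmorph_sign rmorph_nat.
rewrite mcoeffCM; congr (_ * _).
rewrite altE /powsum big_distrlr /= exchange_big raddf_sum /=; apply: eq_bigr => w _.
rewrite raddf_sum /= /ncol cardsE -sum1_card natr_sum big_distrr /=.
rewrite [LHS]big_mkcondr /=; apply: eq_bigr => F _.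
rewrite yE -scalerAr mcoeffZ -mpolyXD mcoeffX.
rewrite (_ : (_ == mk k) = [forall i, (cnt F i + (@stair N \o w) i)%N == k i]).
  by case: ifP; rewrite ?mulr1 ?mulr0.
apply/eqP/forallP => [e i|e]; first by have := congr1 (fun m : 'X_{1..N} => m i) e; rewrite mnmDE !mnmE => /= ->.
by apply/mnmP => i; rewrite mnmDE !mnmE -(eqP (e i)).
Qed.
End Star.

Lemma mkCFE (aT : finGroupType) (G : {group aT}) (f : aT -> algC) x :
  {in G &, forall x y, f (x ^ y)%g = f x} -> x \in G -> mkCF G f x = f x.
Proof.
move=> fG xG; rewrite /mkCF sum_cfunE (bigD1 (x ^: G)%g) ?mem_classes //=.
rewrite cfunE cfun_classE xG class_refl mulr1 big1 ?addr0.
  by have [y yG ->] := repr_class G x; apply: fG.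
move=> C /andP[/imsetP[z zG ->] ne]; rewrite cfunE cfun_classE zG /=.
case: (boolP (x \in _)) => [xz|_]; last by rewrite mulr0.
by case/negP: ne; rewrite (class_eqP xz).
Qed.

(** * Permutation characters of Young subgroups *)

Section PermChar.
Variables (n N : nat).

Lemma inv_col_conj (C : finType) (F : {ffun 'I_n -> C}) (s t : {perm 'I_n}) :
  inv_col (s ^ t)%g F = inv_col s [ffun x => F (t x)].
Proof.
apply/forallP/forallP => i x.
  by have := i (t x); rewrite !ffunE conjgE !permM permK.
by have := i (t^-1 x)%g; rewrite !ffunE conjgE !permM permKV.
Qed.

Lemma ncol_conj (g k : 'I_N -> nat) (s t : {perm 'I_n}) : ncol g k (s ^ t)%g = ncol g k s.
Proof.
pose ac (F : {ffun 'I_n -> 'I_N}) := [ffun x => F (t x)].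
have injac : injective ac.
  move=> F F' /ffunP e; apply/ffunP=> x; by have := e (t^-1 x)%g; rewrite !ffunE permKV.
rewrite /ncol -(card_imset _ injac); congr #|pred_of_set _|; apply/setP=> F.
apply/imsetP/idP => [[F']|].
  rewrite !inE inv_col_conj => /andP[i /forallP c] ->; rewrite i; apply/forallP=> j.
  by rewrite cnt_perm.
rewrite inE => /andP[i c]; have e : F = ac [ffun x => F (t^-1 x)%g].
  by apply/ffunP=> x; rewrite !ffunE permK.
exists [ffun x => F (t^-1 x)%g] => //; rewrite inE inv_col_conj -/(ac _) -e i.
by apply/forallP=> j; rewrite cnt_perm; apply: (forallP c).
Qed.

Lemma jt_conj (g k : 'I_N -> nat) (s t : {perm 'I_n}) : jt g k (s ^ t)%g = jt g k s.
Proof. by apply: eq_bigr => w _; rewrite ncol_conj. Qed.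

Lemma blk_cons m mu x : blk (m :: mu) x = if (x < m)%N then 0%N else (blk mu (x - m)).+1.
Proof.
rewrite /blk /= (iotaDl 1 0) count_map.
case: ltnP => mx.
  rewrite take0 big_seq1 leqNgt mx /= add0n; apply/eqP; rewrite -leqn0 leqNgt -has_count.
  apply/hasPn => j _ /=; rewrite add1n /= big_cons /=; lia.
rewrite take0 big_seq1 mx add1n; congr _.+1; apply: eq_count => j /=; by rewrite big_cons add1n -leq_subRL.
Qed.

Lemma blk_lt mu x : (x < sumn mu)%N -> (blk mu x < size mu)%N.
Proof.
elim: mu x => [|m mu IH] x //= xm; rewrite blk_cons; case: (ltnP x m) => //= mx.
by apply: IH; lia.
Qed.

Lemma count_blk mu j : count (fun x => blk mu x == j) (iota 0 (sumn mu)) = nth 0%N mu j.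
Proof.
elim: mu j => [|m mu IH] j /=; first by rewrite nth_nil.
rewrite iotaD count_cat add0n.
rewrite (eq_in_count (a2 := fun=> j == 0%N)); last first.
  by move=> x; rewrite mem_iota blk_cons => /andP[_ ->]; rewrite eq_sym.
rewrite -[X in iota X (sumn mu)]addn0 iotaDl count_map.
rewrite (eq_count (a2 := fun x => (blk mu x).+1 == j)); last first.
  by move=> x /=; rewrite blk_cons ltnNge leq_addr /= addKn.
case: j => [|j] /=.
  by rewrite count_predT size_iota count_pred0 addn0.
by rewrite count_pred0 add0n -IH; apply: eq_count => x.
Qed.

Lemma mem_Young mu (s : {perm 'I_n}) :
  (s \in Young n mu) = [forall i, blk mu (s i) == blk mu i].
Proof.
have gY : group_set (YoungSet n mu).
  apply/group_setP; split; first by rewrite inE; apply/forallP=> i; rewrite perm1.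
  move=> x y; rewrite !inE => /forallP a /forallP b; apply/forallP=> i.
  by rewrite permM (eqP (b _)) a.
by rewrite /Young /= -[YoungSet n mu]/(gval (Group gY)) genGid /= inE.
Qed.

(** Colouring each position by its block gives a colouring whose stabilizer is the Young subgroup.
    Its cosets are then the colourings of content [mu], and the induced character counts the
    invariant ones. *)
Lemma cfInd_Young mu (s : {perm 'I_n}) : sumn mu = n -> (size mu <= N)%N ->
  'Ind[Sym n] (1 : 'CF(Young n mu)) s =
  (ncol (fun i : 'I_N => nth 0%N mu i) (fun=> 0%N) s)%:R.
Proof.
move=> smu szmu.
have lt (x : 'I_n) : (blk mu x < N)%N by apply: leq_trans szmu; apply: blk_lt; rewrite smu.
pose F0 : {ffun 'I_n -> 'I_N} := [ffun x => Ordinal (lt x)].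
have c0 i : cnt F0 i = nth 0%N mu i.
  rewrite -count_blk /cnt smu -val_enum_ord count_map cardE size_filter -enumT.
  by apply: eq_in_count => x _; rewrite !inE ffunE -val_eqE.
have memY t : (t \in Young n mu) = inv_col t F0.
  by rewrite mem_Young; apply: eq_forallb => x; rewrite !ffunE -val_eqE.
rewrite cfIndE ?subsetT //.
rewrite (eq_bigr (fun t : {perm 'I_n} => (inv_col s [ffun x => F0 (t x)])%:R)); last first.
  by move=> t _; rewrite cfun1E memY inv_col_conj.
rewrite (eq_bigl xpredT); last by move=> t; rewrite inE.
rewrite (partition_big (fun t : {perm 'I_n} => [ffun x => F0 (t x)])
   (fun F => [forall i, cnt F i == nth 0%N mu i])) /=; last first.
  by move=> t _; apply/forallP=> i; rewrite cnt_perm c0.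
rewrite (eq_bigr (fun F => (inv_col s F)%:R * #|Young n mu|%:R)); last first.
  move=> F /forallP cF; rewrite (eq_bigr (fun=> (inv_col s F)%:R)); last by move=> t /eqP->.
  rewrite sumr_const [RHS]mulr_natr; congr (_ *+ _).
  have -> : #|Young n mu| = #|[set t | inv_col t F0]| by apply: eq_card => t; rewrite memY inE.
  rewrite (@card_inv_col _ _ F0 F) //; last by move=> c; rewrite c0 (eqP (cF c)).
  rewrite -[RHS](card_imset _ invg_inj); apply: eq_card => t.
  rewrite [LHS]unfold_in; change ([ffun x => F0 (t x)] == F = (t \in [set x^-1%g | x in [set s0 : {perm 'I_n} | [ffun x => F (s0 x)] == F0]])).
  apply/eqP/imsetP => [/ffunP e|[t']].
    exists (t^-1)%g; last by rewrite invgK.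
    by rewrite inE; apply/eqP/ffunP=> x; rewrite ffunE -e ffunE permKV.
  by rewrite inE => /eqP/ffunP e ->; apply/ffunP=> x; rewrite ffunE -e ffunE permKV.
rewrite -big_distrl mulrC mulfK; last by rewrite pnatr_eq0 -lt0n cardG_gt0.
rewrite /ncol cardsE -sum1_card natr_sum big_mkcond [RHS]big_mkcond /=; apply: eq_bigr => F _.
rewrite -[_ \in _]topredE /= andbC; under [X in if X && _ then _ else _]eq_forallb do rewrite addn0.
by do 2 case: ifP => //=; case: (inv_col s F).
Qed.
End PermChar.

(** If two points share a colour, multiplication by their transposition pairs permutations of
    opposite sign; if all colours differ, only the identity preserves the colouring. *)
Lemma sum_sign_inv_col (n : nat) (C : finType) (F : {ffun 'I_n -> C}) :
  \sum_(s : {perm 'I_n} | inv_col s F) (-1) ^+ s = (injectiveb F)%:R :> algC.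
Proof.
case: (boolP (injectiveb F)) => [/injectiveP injF|/injectivePn[x [y xy Fxy]]].
  rewrite (big_pred1 1%g) ?odd_perm1 // => s; rewrite /=.
  apply/forallP/eqP => [i|-> x]; last by rewrite perm1.
  by apply/permP=> x; rewrite perm1; apply/injF/eqP.
set S := LHS; suff : S = - S.
  move/eqP; by rewrite -addr_eq0 -mulr2n mulrn_eq0 /= => /eqP.
rewrite {1}/S (reindex_inj (mulgI (tperm x y))) /= -sumrN; apply: eq_big => s.
  apply/forallP/forallP => i z.
    by have := i (tperm x y z); rewrite permM tpermK; case: tpermP => // ->; rewrite ?Fxy.
  by rewrite permM; have := i (tperm x y z); case: tpermP => // ->; rewrite ?Fxy.
by move=> _; rewrite odd_permM odd_tperm xy signr_addb mulN1r.
Qed.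

(** [stair] decreases strictly, so trading an element outside the initial segment for a missing one
    inside gains at least 1. The extra cardinal records this gain and settles the case of equality
    in [marg_le]. *)
Lemma sum_stair_le N (S : {set 'I_N}) :
  (\sum_(i in S) stair i + #|S :\: [set i : 'I_N | i < #|S|]%N| <=
   \sum_(i : 'I_N | (i < #|S|)%N) stair i)%N.
Proof.
set I := [set i : 'I_N | (i < #|S|)%N].
have -> : (\sum_(i : 'I_N | (i < #|S|)%N) stair i = \sum_(i in I) stair i)%N.
  by apply: eq_bigl => i; rewrite inE.
have SN : (#|S| <= N)%N by rewrite -[X in (_ <= X)%N]card_ord max_card.
have cI : #|I| = #|S|.
  rewrite -sum1_card (eq_bigl (fun i : 'I_N => (i < #|S|)%N)); last by move=> i; rewrite inE.
  by rewrite -(big_ord_widen _ (fun=> 1%N) SN) sum1_card card_ord.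
rewrite (big_setID I) /= [X in (_ <= X)%N](big_setID S) /= setIC.
have c : #|S :\: I| = #|I :\: S|.
  by apply/eqP; rewrite -(eqn_add2l #|S :&: I|) cardsID setIC cardsID cI.
suff [l1 l2] : (\sum_(i in S :\: I) stair i <= #|S :\: I| * (N - #|S|.+1))%N /\
   (#|I :\: S| * (N - #|S|) <= \sum_(i in I :\: S) stair i)%N.
  rewrite -c in l2; rewrite -addnA leq_add2l; apply: leq_trans l2.
  apply: leq_trans (leq_add l1 (leqnn _)) _; rewrite addnC -mulnS.
  have [->|] := posnP #|S :\: I|; first by rewrite !mul0n.
  move=> /card_gt0P[z]; rewrite !inE => /andP[z1 _]; rewrite leq_mul2l; apply/orP; right.
  by have := ltn_ord z; lia.
rewrite -!sum_nat_const; split; apply: leq_sum => i; rewrite !inE /stair => /andP[]; lia.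
Qed.

(** * Pairing with the sign-twisted permutation character of the conjugate partition *)

Section SignPairing.
Variables (n N : nat) (lam : seq nat).
Hypotheses (lam_sorted : sorted geq lam) (lam_sum : sumn lam = n) (lam_size : (size lam <= N)%N).
Let mu := conjp lam.
Let M := size mu.
Implicit Types (g k : 'I_N -> nat).

(** Both sides say that the cell (i, j) lies in the diagram of [lam]; indices beyond either sequence
    are covered by the default value 0. *)
Lemma conjp_lt i j : (i < nth 0 mu j)%N = (j < nth 0 lam i)%N.
Proof.
have hi p : p \in lam -> (p <= \max_(p <- lam) p)%N.
  by move=> pl; rewrite (big_rem p pl) /= leq_maxl.
case: (ltnP j M) => [jM|Mj]; last first.
  rewrite nth_default //; symmetry; apply/negbTE; rewrite -leqNgt.
  case: (ltnP i (size lam)) => il; last by rewrite nth_default.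
  by move: Mj; rewrite /M size_mkseq; apply: leq_trans; apply/hi/mem_nth.
move: jM; rewrite /M /mu /conjp size_mkseq => jM; rewrite nth_mkseq // {hi jM}.
elim: lam lam_sorted i => [|p l IH] /= sl i; first by rewrite nth_nil.
have all_le : all (fun q => (q <= p)%N) l.
  by move: sl; rewrite path_sortedE; [case/andP | move=> a b c /=; lia].
case: i => [|i] /=.
  case: (ltnP j p) => //= pj; rewrite ?add0n; apply/negbTE; rewrite -has_count.
  apply/hasPn => q /(allP all_le) /=; lia.
rewrite -(IH (path_sorted sl)); case: (ltnP j p) => pj /=; first by rewrite add1n ltnS.
rewrite ?add0n (_ : count _ l = 0%N) //; apply/eqP; rewrite -leqn0 leqNgt -has_count.
by apply/hasPn => q /(allP all_le) /=; lia.
Qed.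

Lemma sum_nth_lam : (\sum_(i < N) nth 0 lam i = n)%N.
Proof.
rewrite -lam_sum sumnE (big_nth 0%N) big_mkord.
rewrite (big_ord_widen _ (fun i => nth 0%N lam i) lam_size) [RHS]big_mkcond /=.
by apply: eq_bigr => i _; case: ltnP => // h; rewrite nth_default.
Qed.

Lemma nth_lam_M i : (nth 0 lam i <= M)%N.
Proof.
rewrite leqNgt -conjp_lt; apply/negP; by rewrite nth_default.
Qed.

Lemma nth_mu_N j : (nth 0 mu j <= N)%N.
Proof.
rewrite leqNgt conjp_lt nth_default //.
Qed.

Lemma card_lt_ord m p : (p <= m)%N -> #|[set i : 'I_m | (i < p)%N]| = p.
Proof.
move=> pm; rewrite -sum1_card (eq_bigl (fun i : 'I_m => (i < p)%N)); last by move=> i; rewrite inE.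
by rewrite -(big_ord_widen _ (fun=> 1%N) pm) sum1_card card_ord.
Qed.

Lemma sumn_conjp : sumn mu = n.
Proof.
rewrite sumnE (big_nth 0%N) big_mkord -/M.
transitivity (\sum_(j < M) \sum_(i < N | (i < nth 0 mu j)%N) 1)%N.
  by apply: eq_bigr => j _; rewrite sum1dep_card card_lt_ord ?nth_mu_N.
under eq_bigr do rewrite big_mkcond; rewrite exchange_big /= -[RHS]sum_nth_lam.
apply: eq_bigr => i _; rewrite -big_mkcond /=.
by under eq_bigl do rewrite conjp_lt; rewrite sum1dep_card card_lt_ord ?nth_lam_M.
Qed.

Let diag : {set 'I_N * 'I_M} := [set p : 'I_N * 'I_M | (p.1 < nth 0 mu p.2)%N].

Definition marg1 (F : {ffun 'I_n -> 'I_N * 'I_M}) i := #|[set x | (F x).1 == i]|.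
Definition marg2 (F : {ffun 'I_n -> 'I_N * 'I_M}) j := #|[set x | (F x).2 == j]|.

Lemma sum_stair_lam : (\sum_(i < N) stair i * nth 0 lam i =
  \sum_(j < M) \sum_(i < N | (i < nth 0 mu j)%N) stair i)%N.
Proof.
under [RHS]eq_bigr do rewrite big_mkcond; rewrite exchange_big /=.
apply: eq_bigr => i _; rewrite -big_mkcond /=; under [RHS]eq_bigl do rewrite conjp_lt.
by rewrite sum_nat_cond_const mulnC -[LHS]/(_ * _)%N; congr (_ * _)%N; rewrite -[LHS](card_lt_ord (nth_lam_M i)) cardsE.
Qed.

(* Among the 0-1 matrices with column sums mu = lam', the weighted row sum
   \sum_i stair i * (row sum i) is maximal exactly for the diagram of lam. *)
Lemma marg_le (F : {ffun 'I_n -> 'I_N * 'I_M}) : injective F ->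
  (forall j, marg2 F j = nth 0 mu j) ->
  (\sum_i stair i * marg1 F i <= \sum_(i < N) stair i * nth 0 lam i)%N /\
  ((\sum_i stair i * marg1 F i = \sum_(i < N) stair i * nth 0 lam i)%N ->
     forall c, cnt F c = (c \in diag)).
Proof.
move=> injF m2.
pose S j := [set i | (i, j) \in F @: [set: 'I_n]].
have cS j : #|S j| = nth 0%N mu j.
  rewrite -m2 /marg2 -(card_in_imset (f := fun x => (F x).1)); last first.
    move=> x y; rewrite !inE => /eqP e1 /eqP e2 e; apply: injF.
    by rewrite [F x]surjective_pairing [F y]surjective_pairing e e1 e2.
  congr #|pred_of_set _|; apply/setP=> i; rewrite inE; apply/imsetP/imsetP => -[x].
    by move=> _ e; exists x; rewrite ?inE -e.
  by rewrite inE => /eqP e ->; exists x; rewrite ?inE // -e -surjective_pairing.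
have eS : (\sum_i stair i * marg1 F i = \sum_j \sum_(i in S j) stair i)%N.
  transitivity (\sum_x stair (F x).1)%N.
    rewrite [RHS](partition_big (fun x => (F x).1) xpredT) //=; apply: eq_bigr => i _.
    rewrite (eq_bigr (fun=> stair i)); last by move=> x /eqP->.
    by rewrite sum_nat_cond_const mulnC /marg1 cardsE.
  rewrite (partition_big (fun x => (F x).2) xpredT) //=; apply: eq_bigr => j _.
  have -> : S j = [set (F x).1 | x in [set x | (F x).2 == j]].
    apply/setP=> i; rewrite inE; apply/imsetP/imsetP => -[x].
      by move=> _ e; exists x; rewrite ?inE -e.
    by rewrite inE => /eqP e ->; exists x; rewrite ?inE // -e -surjective_pairing.
  rewrite big_imset /=; last first.
    move=> x y; rewrite !inE => /eqP e1 /eqP e2 e; apply: injF.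
    by rewrite [F x]surjective_pairing [F y]surjective_pairing e e1 e2.
  by apply: eq_bigl => x; rewrite inE.
rewrite eS sum_stair_lam.
have le j : (\sum_(i in S j) stair i + #|S j :\: [set i : 'I_N | i < nth 0 mu j]%N| <=
   \sum_(i : 'I_N | (i < nth 0 mu j)%N) stair i)%N.
  by have := sum_stair_le (S j); rewrite cS.
split; first by apply: leq_sum => j _; apply: leq_trans (le j); rewrite leq_addr.
move=> eq.
have z : (\sum_j #|S j :\: [set i : 'I_N | i < nth 0 mu j]%N| = 0)%N.
  have : (\sum_j (\sum_(i in S j) stair i + #|S j :\: [set i : 'I_N | i < nth 0 mu j]%N|) <=
   \sum_(j < M) \sum_(i : 'I_N | (i < nth 0 mu j)%N) stair i)%N by apply: leq_sum.
  by rewrite big_split /= eq -[X in (_ <= X)%N]addn0 leq_add2l leqn0 => /eqP.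
have SE j : S j = [set i : 'I_N | (i < nth 0 mu j)%N].
  apply/eqP; rewrite eqEcard cS card_lt_ord ?nth_mu_N // leqnn andbT -setD_eq0 -cards_eq0.
  by move/eqP: z; rewrite sum_nat_eq0 => /forallP/(_ j).
case=> i j; rewrite inE /=.
have := SE j => /setP/(_ i); rewrite !inE => <-.
rewrite /cnt; case: (boolP (_ \in _)) => [/imsetP[x _ ex]|ni].
  by rewrite (_ : [set y | _] = [set x]) ?cards1 //; apply/setP=> y; rewrite !inE ex (inj_eq injF).
rewrite (_ : [set y | _] = set0) ?cards0 //; apply/setP=> y; rewrite !inE.
by apply/negbTE; apply: contra ni => /eqP <-; rewrite imset_f.
Qed.

(** This is n! times the inner product of a permutation character with the sign-twisted one of the
    conjugate partition. *)
Definition sgnpair g k : algC :=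
  \sum_(s : {perm 'I_n}) (ncol g k s)%:R * ((-1) ^+ s *
     (ncol (fun j : 'I_M => nth 0%N mu j) (fun=> 0%N) s)%:R).

(** A pair of invariant colourings is an invariant colouring by cells. Summing signs over its
    stabilizer leaves the injective ones, which are the 0-1 matrices with these margins, each
    counted with its n! labellings. *)
Lemma sgnpairE g k : sgnpair g k =
  #|[set F : {ffun 'I_n -> 'I_N * 'I_M} | [&& injectiveb F,
     [forall i, marg1 F i + k i == g i]%N & [forall j, marg2 F j == nth 0%N mu j]]]|%:R.
Proof.
pose Q (F : {ffun 'I_n -> 'I_N * 'I_M}) :=
  [forall i, marg1 F i + k i == g i]%N && [forall j, marg2 F j == nth 0%N mu j].
transitivity (\sum_(F | Q F) (injectiveb F)%:R : algC); last first.
  rewrite cardsE -sum1_card natr_sum [LHS]big_mkcond [RHS]big_mkcond /=.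
  apply: eq_bigr => F _; rewrite [F \in _]unfold_in /= -/(Q F).
  by case: (Q F); rewrite ?andbT ?andbF //; case: injectiveb.
under [RHS]eq_bigr do rewrite -sum_sign_inv_col.
rewrite (exchange_big_dep xpredT) //=; apply: eq_bigr => s _.
rewrite sumr_const mulrCA -natrM mulr_natr; congr (_ *+ _).
pose mk (p : {ffun 'I_n -> 'I_N} * {ffun 'I_n -> 'I_M}) : {ffun 'I_n -> 'I_N * 'I_M} :=
  [ffun x => (p.1 x, p.2 x)].
have mkinj : injective mk.
  move=> [p1 p2] [q1 q2] /ffunP e; congr (_, _); apply/ffunP=> x; by have := e x; rewrite !ffunE => -[].
rewrite /ncol -cardsX -(card_imset _ mkinj); apply: eq_card => F.
have m1 p i : marg1 (mk p) i = cnt p.1 i by apply: eq_card => x; rewrite !inE ffunE.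
have m2 p j : marg2 (mk p) j = cnt p.2 j by apply: eq_card => x; rewrite !inE ffunE.
have iv p : inv_col s (mk p) = inv_col s p.1 && inv_col s p.2.
  apply/forallP/andP => [i|[/forallP i1 /forallP i2] x].
    by split; apply/forallP => x; have := i x; rewrite !ffunE => /eqP[e1 e2]; rewrite ?e1 ?e2.
  by rewrite !ffunE (eqP (i1 x)) (eqP (i2 x)).
rewrite [RHS]unfold_in; apply/imsetP/idP => [[p]|].
  rewrite !inE => /andP[/andP[i1 /forallP c1] /andP[i2 /forallP c2]] ->.
  rewrite iv i1 i2 !andbT /Q; apply/andP; split.
    by apply/'forall_eqP => i; rewrite m1; apply/eqP/c1.
  by apply/'forall_eqP => i; rewrite m2 -(eqP (c2 i)) addn0.
have eF : F = mk ([ffun x => (F x).1], [ffun x => (F x).2]).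
  by apply/ffunP=> x; rewrite !ffunE -surjective_pairing.
rewrite eF iv => /andP[/andP[/forallP c1 /forallP c2] /andP[i1 i2]].
eexists; last reflexivity; rewrite !inE i1 i2 /=; apply/andP; split; apply/forallP => i.
  by have := c1 i; rewrite m1.
by have := c2 i; rewrite m2 addn0.
Qed.

Lemma sgnpair_neq0 g k : sgnpair g k != 0 ->
  (\sum_i stair i * g i <= \sum_i stair i * (nth 0 lam i + k i))%N.
Proof.
rewrite sgnpairE pnatr_eq0 -lt0n => /card_gt0P[F]; rewrite inE.
move=> /and3P[/injectiveP injF /forallP c1 /forallP c2].
have [le _] := marg_le injF (fun j => eqP (c2 j)).
under eq_bigr do rewrite -(eqP (c1 _)) mulnDr.
under [X in (_ <= X)%N]eq_bigr do rewrite mulnDr.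
by rewrite !big_split /= leq_add2r.
Qed.

(** By the equality case of [marg_le] the only 0-1 matrix with these margins is the diagram of
    [lam], and the symmetric group acts simply transitively on its labellings. *)
Lemma sgnpair_lam k : sgnpair (fun i => nth 0%N lam i + k i)%N k = n`!%:R.
Proof.
rewrite sgnpairE; congr _%:R.
have sD : (\sum_c (c \in diag : nat))%N = n.
  rewrite -sumn_conjp sumnE (big_nth 0%N) big_mkord -/M.
  rewrite (eq_bigr (fun p : 'I_N * 'I_M => ((p.1, p.2) \in diag : nat))); last by case.
  rewrite -(pair_bigA _ (fun i j => ((i, j) \in diag : nat))) exchange_big /=; apply: eq_bigr => j _.
  rewrite -[RHS](card_lt_ord (nth_mu_N j)) -sum1_card [RHS]big_mkcond /=; apply: eq_bigr => i _.
  by rewrite !inE /=; case: ltnP.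
have [F0 c0] := ex_cnt sD.
have injc (F : {ffun 'I_n -> 'I_N * 'I_M}) : (forall c, cnt F c = (c \in diag)) -> injective F.
  move=> c x y e; apply/eqP; apply/negPn/negP => xy.
  have : (#|[set x; y]| <= cnt F (F x))%N.
    by apply: subset_leq_card; apply/subsetP=> z; rewrite !inE => /orP[] /eqP ->; rewrite ?e.
  by rewrite c cards2 xy; case: (_ \in _).
pose ac (s : {perm 'I_n}) := [ffun x => F0 (s x)].
have injac : injective ac.
  move=> s t /ffunP e; apply/permP=> x; apply: (injc F0 c0); by have := e x; rewrite !ffunE.
rewrite -card_Sn -(card_imset _ injac); apply: eq_card => F.
rewrite inE; apply/and3P/imsetP => [[/injectiveP injF /forallP m1 /forallP m2]|[s _ ->]].
  have [_ c] := marg_le injF (fun j => eqP (m2 j)).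
  have [|s es] := @cnt_eq_perm _ _ F F0.
    move=> d; rewrite c0 c //; apply: eq_bigr => i _; congr (_ * _)%N.
    by have := eqP (m1 i); lia.
  by exists s => //; apply/ffunP=> x; rewrite ffunE es.
have cF d : cnt (ac s) d = (d \in diag) by rewrite /ac cnt_perm c0.
have iF := injc _ cF; split; first exact/injectiveP.
- apply/forallP=> i; rewrite eqn_add2r; apply/eqP.
  transitivity (\sum_(j < M) cnt (ac s) (i, j))%N.
    rewrite /marg1 -sum1_card (partition_big (fun x => (ac s x).2) xpredT) //=.
    apply: eq_bigr => j _; rewrite sum1_card; apply: eq_card => x; rewrite [LHS]unfold_in !inE.
    by case: (ac s x) => a b; rewrite xpair_eqE.
  rewrite -[RHS](card_lt_ord (nth_lam_M i)) -sum1_card [RHS]big_mkcond /=; apply: eq_bigr => j _.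
  by rewrite cF !inE /= conjp_lt; case: ltnP.
- apply/forallP=> j; apply/eqP.
  transitivity (\sum_(i < N) cnt (ac s) (i, j))%N.
    rewrite /marg2 -sum1_card (partition_big (fun x => (ac s x).1) xpredT) //=.
    apply: eq_bigr => i _; rewrite sum1_card; apply: eq_card => x; rewrite [LHS]unfold_in !inE.
    by case: (ac s x) => a b; rewrite xpair_eqE andbC.
  rewrite -[RHS](card_lt_ord (nth_mu_N j)) -sum1_card [RHS]big_mkcond /=; apply: eq_bigr => i _.
  by rewrite cF !inE /=; case: ltnP.
Qed.
End SignPairing.

(** Strict rearrangement inequality: the hypothesis forces the squared distance between [stair] and
    its rearrangement to vanish. *)
Lemma stair_perm_le N (w : 'S_N) :
  (\sum_(i < N) stair i * stair i <= \sum_(i < N) stair i * stair (w i))%N -> w = 1%g.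
Proof.
move=> le.
have e : (\sum_(i < N) stair (w i) * stair (w i) = \sum_(i < N) stair i * stair i)%N.
  by rewrite [RHS](reindex_inj (@perm_inj _ w)).
(* One of the two truncated differences is always 0, so each summand is the square of the true
   difference. *)
have : (\sum_(i < N) ((stair i - stair (w i)) ^ 2 + (stair (w i) - stair i) ^ 2) +
  (\sum_(i < N) stair i * stair (w i)).*2 = (\sum_(i < N) stair i * stair i).*2)%N.
  rewrite -[in RHS]addnn -{2}e -!big_split /= -muln2 big_distrl -big_split /=.
  by apply: eq_bigr => i _; nia.
move=> s; have : (\sum_(i < N) ((stair i - stair (w i)) ^ 2 + (stair (w i) - stair i) ^ 2) = 0)%N by lia.
move/eqP; rewrite sum_nat_eq0 => /forallP z; apply/permP => i; rewrite perm1; apply/val_inj.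
have := z i; rewrite /= addn_eq0 !expn_eq0 /= !andbT /stair.
have := ltn_ord i; have := ltn_ord (w i); set a := nat_of_ord (w i); set b := nat_of_ord i; lia.
Qed.

Lemma cfInd_Res_mul (aT : finGroupType) (G K : {group aT}) (psi : 'CF(G)) x : K \subset G -> x \in G ->
  'Ind[G] ('Res[K] psi) x = psi x * 'Ind[G] (1 : 'CF(K)) x.
Proof.
move=> sKG xG; rewrite !cfIndE // mulrCA; congr (_ * _); rewrite big_distrr /=.
apply: eq_bigr => y yG; rewrite cfun1E; case: (boolP ((x ^ y)%g \in K)) => xyK.
  by rewrite cfResE // cfunJ // mulr1.
by rewrite cfun0 // mulr0.
Qed.

Lemma sum_ge_nat (I : finType) (F : I -> algC) i :
  (forall j, 0 <= F j) -> F i <= \sum_j F j.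
Proof. by move=> F0; rewrite (bigD1 i) //= ler_wpDr // sumr_ge0. Qed.

Section JTChar.
Variables (n N : nat).
Implicit Types (g k : 'I_N -> nat) (s : {perm 'I_n}).

Definition Mcf g k : 'CF(Sym n) := mkCF (Sym n) (fun s => (ncol g k s)%:R).
Definition Vcf g k : 'CF(Sym n) := mkCF (Sym n) (jt g k).

Lemma McfE g k s : Mcf g k s = (ncol g k s)%:R.
Proof. by apply: mkCFE; rewrite ?inE // => x y _ _; rewrite ncol_conj. Qed.

Lemma VcfE g k s : Vcf g k s = jt g k s.
Proof. by apply: mkCFE; rewrite ?inE // => x y _ _; rewrite jt_conj. Qed.

Lemma Vcf_sum g k : Vcf g k = \sum_(w : 'S_N) (-1) ^+ w *: Mcf g (k \o w).
Proof.
apply/cfunP => s; rewrite VcfE sum_cfunE /jt; apply: eq_bigr => w _.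
by rewrite !cfunE McfE.
Qed.

(** If the differences g - k are nonnegative with sum n, this is the permutation character of a
    Young subgroup; otherwise no colouring has the required content. *)
Lemma Mcf_char g k : Mcf g k \is a character.
Proof.
pose mu := [seq (g i - k i)%N | i <- enum 'I_N].
have nmu (i : 'I_N) : nth 0%N mu i = (g i - k i)%N.
  by rewrite (nth_map i) ?size_enum_ord // nth_ord_enum.
have smu : sumn mu = (\sum_i (g i - k i))%N by rewrite sumnE big_map big_enum.
case: (boolP ([forall i, (k i <= g i)%N] && (sumn mu == n))) => [/andP[/forallP kg /eqP e]|ne].
  suff -> : Mcf g k = 'Ind[Sym n] (1 : 'CF(Young n mu)) by rewrite cfInd_char ?rpred1 ?subsetT.
  apply/cfunP=> s; rewrite McfE (@cfInd_Young _ N) //; last by rewrite size_map size_enum_ord.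
  congr _%:R; apply: eq_card => F; rewrite !inE; congr (_ && _).
  apply: eq_forallb => i; rewrite addn0 nmu; have := kg i; lia.
suff -> : Mcf g k = 0 by rewrite rpred0.
apply/cfunP=> s; rewrite McfE cfunE /ncol; apply/eqP; rewrite pnatr_eq0 cards_eq0 -subset0.
apply/subsetP=> F; rewrite !inE => /andP[_ /forallP c]; case/negP: ne; apply/andP; split.
  by apply/forallP=> i; have := eqP (c i); lia.
rewrite smu -(sum_cnt F); apply/eqP/eq_bigr => i _; by have := eqP (c i); lia.
Qed.

Lemma Vcf_vchar g k : Vcf g k \in 'Z[irr (Sym n)]%g.
Proof.
rewrite Vcf_sum rpred_sum // => w _; rewrite scaler_sign.
by case: (odd_perm w); rewrite ?rpredN char_vchar // Mcf_char.
Qed.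

Lemma jt_conjC g k s : (jt g k s)^* = jt g k s.
Proof. by rewrite rmorph_sum /=; apply: eq_bigr => w _; rewrite rmorphM rmorph_sign rmorph_nat. Qed.

Lemma card_Sym : #|Sym n| = n`!.
Proof. by rewrite cardsT card_Sn. Qed.

Lemma cfdot_Sym (phi psi : 'CF(Sym n)) :
  '[phi, psi] = n`!%:R^-1 * \sum_(s : {perm 'I_n}) phi s * (psi s)^*.
Proof.
rewrite cfdotE card_Sym; congr (_ * _); by apply: eq_bigl => s; rewrite inE.
Qed.

Lemma fact_neq0 : n`!%:R != 0 :> algC.
Proof. by rewrite pnatr_eq0 -lt0n fact_gt0. Qed.

Lemma cfdot_Vcf g k : (\sum_i g i = n + \sum_(i < N) stair i)%N ->
  '[Vcf g (@stair N), Vcf k (@stair N)] =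
  \sum_(w : 'S_N) (-1) ^+ w * [forall i, k i == g (w i)]%:R.
Proof.
move=> eg; rewrite cfdot_Sym -[RHS](mulKf fact_neq0) -(jt_orthogonality k eg); congr (_ * _).
by apply: eq_bigr => s _; rewrite !VcfE jt_conjC.
Qed.
End JTChar.

Section SpechtJT.
Variables (n N : nat) (lam : seq nat).
Hypotheses (lam_sorted : sorted geq lam) (lam_sum : sumn lam = n) (lam_size : (size lam <= N)%N).

Definition lamdelta (i : 'I_N) : nat := (nth 0 lam i + stair i)%N.

Lemma nth_geq i j : (i <= j)%N -> (nth 0 lam j <= nth 0 lam i)%N.
Proof.
move=> ij; case: (ltnP j (size lam)) => jl; last by rewrite nth_default.
have := @sorted_leq_nth _ geq _ _ 0%N lam lam_sorted; apply; rewrite ?inE //=; try lia.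
  by move=> a b c /=; lia.
by move=> a /=.
Qed.

Lemma lamdelta_lt (i j : 'I_N) : (i < j)%N -> (lamdelta j < lamdelta i)%N.
Proof.
move=> ij; have := nth_geq (ltnW ij); rewrite /lamdelta /stair.
by have := ltn_ord j; lia.
Qed.

Lemma lamdelta_inj : injective lamdelta.
Proof.
move=> i j e; apply/val_inj => /=.
by case: (ltngtP i j) => // /lamdelta_lt; rewrite e ltnn.
Qed.

Lemma sum_lamdelta : (\sum_i lamdelta i = n + \sum_(i < N) stair i)%N.
Proof. by rewrite big_split /= (sum_nth_lam lam_sum lam_size). Qed.

Let V := Vcf n lamdelta (@stair N).
Let Xi := 'Ind[Sym n] ('Res[Young n (conjp lam)] (sgnCF n)).
Let M w := Mcf n lamdelta (@stair N \o (w : 'S_N)).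

Lemma sgnCFE s : sgnCF n s = (-1) ^+ odd_perm s.
Proof.
apply: mkCFE; rewrite ?inE // => x y _ _.
by rewrite conjgE !odd_permM odd_permV addbC addbK.
Qed.

Lemma XiE s : Xi s = (-1) ^+ odd_perm s *
  (ncol (fun j : 'I_(size (conjp lam)) => nth 0%N (conjp lam) j) (fun=> 0%N) s)%:R.
Proof.
rewrite /Xi cfInd_Res_mul ?subsetT ?inE // sgnCFE; congr (_ * _).
by rewrite (@cfInd_Young _ (size (conjp lam))) // (sumn_conjp lam_sorted lam_sum lam_size).
Qed.

Lemma sgn_repr_subproof :
  mx_repr (Sym n) (fun s => ((-1) ^+ odd_perm s)%:M : 'M[algC]_1).
Proof.
split; first by rewrite odd_perm1.
by move=> x y _ _; rewrite odd_permM signr_addb scalar_mxM.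
Qed.

Lemma sgn_char : sgnCF n \is a character.
Proof.
suff -> : sgnCF n = cfRepr (MxRepresentation sgn_repr_subproof) by apply: cfRepr_char.
by apply/cfunP => s; rewrite sgnCFE cfunE inE /= mxtrace_scalar !mulr1n.
Qed.

Lemma Xi_char : Xi \is a character.
Proof. by rewrite cfInd_char // cfRes_char // sgn_char. Qed.

(** Triangularity: a nonzero pairing bounds the weight of [stair] against itself by its weight
    against the [w]-rearrangement, and the rearrangement inequality leaves only the identity. *)
Lemma cfdot_M_Xi w : '[M w, Xi] = (w == 1%g)%:R.
Proof.
have e : '[M w, Xi] = n`!%:R^-1 * sgnpair n lam lamdelta (@stair N \o w).
  rewrite cfdot_Sym; congr (_ * _); apply: eq_bigr => s _; rewrite McfE XiE.
  by rewrite rmorphM rmorph_sign rmorph_nat.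
case: eqP => [->|nw] in e *.
  rewrite e -[X in _ * X](_ : n`!%:R = _) ?mulVf ?fact_neq0 //.
  rewrite -(sgnpair_lam lam_sorted lam_sum lam_size (@stair N)) /sgnpair.
  apply: eq_bigr => s _; congr (_%:R * _); apply: eq_card => F; rewrite !inE; congr (_ && _).
  by apply: eq_forallb => i; rewrite /= perm1.
rewrite e; apply/eqP; rewrite mulf_eq0; apply/orP; right; apply/negPn/negP => /(sgnpair_neq0 lam_sorted lam_sum lam_size).
under eq_bigr do rewrite mulnDr; under [X in (_ <= X)%N]eq_bigr do rewrite mulnDr.
by rewrite !big_split /= leq_add2l => /stair_perm_le.
Qed.

Lemma cfdot_V_Xi : '[V, Xi] = 1.
Proof.
rewrite /V Vcf_sum cfdot_suml (bigD1 1%g) //= cfdotZl cfdot_M_Xi eqxx odd_perm1 mul1r.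
by rewrite big1 ?addr0 // => w nw; rewrite cfdotZl cfdot_M_Xi (negPf nw) mulr0.
Qed.

Lemma cfdot_V_V : '[V, V] = 1.
Proof.
rewrite cfdot_Vcf ?sum_lamdelta // (bigD1 1%g) //= odd_perm1 mul1r big1 ?addr0.
  by case: forallP => // -[] i; rewrite perm1.
move=> w nw; case: (boolP [forall _, _]) => [/forallP e|]; last by rewrite mulr0.
by case/negP: nw; apply/eqP/permP => i; rewrite perm1; apply/lamdelta_inj/esym/eqP.
Qed.

Lemma Vcf_irr : exists i, V = 'chi_i.
Proof.
have [b [i e]] := vchar_norm1P (Vcf_vchar n lamdelta (@stair N)) cfdot_V_V.
exists i; move: e; rewrite -/V; case: b => //= e; last by rewrite e scale1r.
(* With the opposite sign, the character [Xi] would contain an irreducible with multiplicity -1. *)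
have := cfdot_V_Xi; rewrite e expr1 scaleN1r cfdotNl => /eqP.
rewrite eqr_oppLR => /eqP f.
have := Cnat_cfdot_char (irr_char i) Xi_char; rewrite f.
by rewrite natrEint oppr_ge0 ler10 andbF.
Qed.

Lemma M1E : M 1%g = 'Ind[Sym n] (1 : 'CF(Young n lam)).
Proof.
apply/cfunP=> s; rewrite McfE (@cfInd_Young _ N) //; congr _%:R; apply: eq_card => F.
rewrite !inE; congr (_ && _); apply: eq_forallb => i; rewrite /= perm1 addn0 /lamdelta.
by rewrite eqn_add2r.
Qed.

(** The pairing of [M 1%g] with [Xi] equals 1 and is a sum over the irreducibles of nonnegative
    products of multiplicities. The irreducible [V] accounts for all of it, so nothing else is a
    constituent of both. *)
Lemma Specht_Vcf : Specht n lam = V.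
Proof.
have [i e] := Vcf_irr.
have nn (phi psi : 'CF(Sym n)) : phi \is a character -> psi \is a character -> 0 <= '[phi, psi].
  by move=> a b; apply/natr_ge0/Cnat_cfdot_char.
have Xi0 := Xi_char.
have prod w : '[M w, Xi] = \sum_j '[M w, 'chi_j] * '['chi_j, Xi].
  rewrite cfdot_sum_irr; apply: eq_bigr => j _; congr (_ * _).
  by rewrite conj_natr ?Cnat_cfdot_char_irr // cfdotC_char ?irr_char.
have term_ge0 w j : 0 <= '[M w, 'chi_j] * '['chi_j, Xi].
  by rewrite mulr_ge0 ?nn ?irr_char ?Mcf_char.
have iXi : '['chi_i, Xi] = 1 by rewrite -e cfdot_V_Xi.
(* [Xi] contains the irreducible [V] and is orthogonal to [M w], so [V] does not occur in [M w].
   Hence only the identity contributes to the norm of [V]. *)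
have iM w : w != 1%g -> '[M w, 'chi_i] = 0.
  move=> nw; have := sum_ge_nat i (term_ge0 w); rewrite -prod cfdot_M_Xi (negPf nw) iXi mulr1.
  by move=> le; apply/eqP; rewrite eq_le le nn ?irr_char ?Mcf_char.
have iM1 : '['chi_i, M 1%g] = 1.
  have := cfdot_V_V; rewrite {1}/V Vcf_sum cfdot_suml (bigD1 1%g) //= big1 ?addr0.
    by rewrite cfdotZl odd_perm1 mul1r e cfdotC_char ?irr_char ?Mcf_char.
  by move=> w nw; rewrite cfdotZl e iM // mulr0.
rewrite /Specht -/Xi -M1E e (bigD1 i) /=; last by rewrite iM1 iXi oner_eq0.
rewrite big_pred0 ?addr0 // => j; apply/negbTE; rewrite negb_and negbK.
case: (boolP (j == i)) => ji; first by rewrite orbT.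
rewrite orbF; apply/negP => /andP[a b].
have := prod 1%g; rewrite cfdot_M_Xi eqxx (bigD1 i) //= cfdotC_char ?irr_char ?Mcf_char // iM1 iXi mulr1.
rewrite (bigD1 j) //= => /eqP; rewrite -subr_eq0 opprD addrA subrr sub0r oppr_eq0.
rewrite paddr_eq0 ?term_ge0 ?sumr_ge0 // => /andP[/eqP z _].
by move/eqP: z; rewrite mulf_eq0 cfdotC_char ?irr_char ?Mcf_char // (negPf a) (negPf b).
Qed.
End SpechtJT.

Lemma mkpermE (T : finType) (f : T -> T) x : injective f -> mkperm f x = f x.
Proof. by move=> injf; rewrite /mkperm; case: injectiveP => [i|//]; rewrite permE. Qed.

(** * Restriction to a product of two symmetric groups *)

Section JoinPerm.
Variables (m h : nat).
Implicit Types (x : {perm 'I_m}) (t : {perm 'I_h}).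

Definition jfun x t (i : 'I_(m + h)) : 'I_(m + h) :=
  match split i with inl a => lshift h (x a) | inr b => rshift m (t b) end.

Lemma jfun_inj x t : injective (jfun x t).
Proof.
move=> i j; rewrite /jfun -{2}(splitK i) -{2}(splitK j).
case: (split i) => a; case: (split j) => b /=.
- by move=> /lshift_inj/perm_inj->.
- by move=> /eqP; rewrite eq_lrshift.
- by move=> /eqP; rewrite eq_rlshift.
- by move=> /rshift_inj/perm_inj->.
Qed.

Definition jperm x t := perm (@jfun_inj x t).

Lemma jpermL x t a : jperm x t (lshift h a) = lshift h (x a).
Proof. by rewrite permE /jfun (unsplitK (inl a)). Qed.
Lemma jpermR x t b : jperm x t (rshift m b) = rshift m (t b).
Proof. by rewrite permE /jfun (unsplitK (inr b)). Qed.

Lemma sig1_jperm x t : sig1 (jperm x t) = x.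
Proof.
have e a : insubd a (val (jperm x t (lshift h a))) = x a.
  by rewrite jpermL; apply: val_inj; rewrite val_insubd /= ltn_ord.
apply/permP=> a; rewrite /sig1 mkpermE ?e // => b c; rewrite !e; exact: perm_inj.
Qed.

Lemma sig2_jperm x t : sig2 (jperm x t) = t.
Proof.
have e a : insubd a (val (jperm x t (rshift m a)) - m)%N = t a.
  by rewrite jpermR; apply: val_inj; rewrite val_insubd /= addKn ltn_ord.
apply/permP=> a; rewrite /sig2 mkpermE ?e // => b c; rewrite !e; exact: perm_inj.
Qed.

Lemma mem_Young2 (g : {perm 'I_(m + h)}) :
  (g \in Young (m + h) [:: m; h]) = [forall i, (g i < m)%N == (i < m)%N].
Proof.
rewrite mem_Young; apply: eq_forallb => i.
have b (j : 'I_(m + h)) : blk [:: m; h] j = if (j < m)%N then 0%N else 1%N.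
  rewrite !blk_cons; case: ltnP => // mj; rewrite ifT //.
  by have := ltn_ord j; lia.
by rewrite !b; case: (g i < m)%N; case: (i < m)%N.
Qed.

Lemma jperm_Young x t : jperm x t \in Young (m + h) [:: m; h].
Proof.
rewrite mem_Young2; apply/forallP=> i; rewrite -(splitK i); case: (split i) => a /=.
  by rewrite jpermL /= !ltn_ord.
by rewrite jpermR /= !ltnNge !leq_addr.
Qed.

Lemma Young_jperm g : g \in Young (m + h) [:: m; h] -> exists x t, g = jperm x t.
Proof.
rewrite mem_Young2 => /forallP gY.
have e1 a : insubd a (val (g (lshift h a))) = val (g (lshift h a)) :> nat.
  by rewrite val_insubd (eqP (gY _)) /= ltn_ord.
have e2 b : (m + insubd b (val (g (rshift m b)) - m)%N = val (g (rshift m b)))%N.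
  have := gY (rshift m b); rewrite /= [X in _ == X]ltnNge leq_addr /= eqbF_neg -leqNgt => le.
  rewrite val_insubd ifT ?subnKC //; have := ltn_ord (g (rshift m b)); rewrite /= ; lia.
have i1 : injective (fun a : 'I_m => insubd a (val (g (lshift h a)))).
  by move=> a b /(congr1 val); rewrite /= !e1 => /val_inj/perm_inj/lshift_inj.
have i2 : injective (fun b : 'I_h => insubd b (val (g (rshift m b)) - m)%N).
  move=> a b /(congr1 (fun z : 'I_h => (m + z)%N)); rewrite /= !e2 => /val_inj/perm_inj/rshift_inj //.
exists (perm i1), (perm i2); apply/permP => i; rewrite -(splitK i); case: (split i) => a /=; apply/val_inj.
  by rewrite jpermL permE /= e1.
by rewrite jpermR permE /= e2.
Qed.

Lemma sum_Young2 (K : zmodType) (F : {perm 'I_(m + h)} -> K) :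
  \sum_(g in Young (m + h) [:: m; h]) F g = \sum_x \sum_t F (jperm x t).
Proof.
rewrite pair_bigA /=.
have injj : injective (fun p : {perm 'I_m} * {perm 'I_h} => jperm p.1 p.2).
  move=> [x t] [x' t'] /= e; have := congr1 (@sig1 m h) e; have := congr1 (@sig2 m h) e.
  by rewrite !sig1_jperm !sig2_jperm => -> ->.
rewrite [RHS](eq_bigl (mem [set: {perm 'I_m} * {perm 'I_h}])); last by move=> p; rewrite /= inE.
rewrite -(big_imset (h := fun p => jperm p.1 p.2) F (A := setT)) /=; last by move=> p q _ _; apply: injj.
apply: eq_bigl => g; apply/idP/imsetP => [/Young_jperm[x [t ->]]|[p _ ->]]; last exact: jperm_Young.
by exists (x, t).
Qed.

Lemma card_Young2 : #|Young (m + h) [:: m; h]| = (m`! * h`!)%N.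
Proof.
apply/eqP; rewrite -(eqr_nat algC) -sumr_const sum_Young2 /=.
rewrite (eq_bigr (fun=> h`!%:R)); last by move=> x _; rewrite sumr_const card_Sn.
by rewrite sumr_const card_Sn natrM mulr_natl.
Qed.

Lemma jpermM x t x' t' : (jperm x t * jperm x' t' = jperm (x * x') (t * t'))%g.
Proof.
apply/permP=> i; rewrite permM -(splitK i); case: (split i) => a /=.
  by rewrite !jpermL permM.
by rewrite !jpermR permM.
Qed.

Lemma jpermV x t : ((jperm x t)^-1 = jperm x^-1 t^-1)%g.
Proof.
apply/eqP; rewrite eq_invg_mul jpermM !mulgV; apply/eqP/permP => i; rewrite perm1 -(splitK i).
by case: (split i) => a; rewrite /= ?jpermL ?jpermR perm1.
Qed.

Lemma boxCFE (a : 'CF(Sym m)) (b : 'CF(Sym h)) x t : boxCF a b (jperm x t) = a x * b t.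
Proof.
rewrite mkCFE ?jperm_Young ?sig1_jperm ?sig2_jperm //.
move=> g g' /Young_jperm[y [u ->]] /Young_jperm[y' [u' ->]].
by rewrite conjgE jpermV !jpermM !sig1_jperm !sig2_jperm -!conjgE !cfunJ ?inE.
Qed.

(** An invariant colouring restricts to both blocks. Here [u] is [k] plus the content of the first
    block; it never exceeds [g], whence the bound [B]. *)
Lemma ncol_jperm N B (g k : 'I_N -> nat) x t : (forall i, g i < B)%N ->
  ncol g k (jperm x t) = (\sum_(u : {ffun 'I_N -> 'I_B}) ncol (fun i => nat_of_ord (u i)) k x * ncol g (fun i => nat_of_ord (u i)) t)%N.
Proof.
move=> gB.
pose j1 (F : {ffun 'I_(m + h) -> 'I_N}) : {ffun 'I_m -> 'I_N} := [ffun a => F (lshift h a)].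
pose j2 (F : {ffun 'I_(m + h) -> 'I_N}) : {ffun 'I_h -> 'I_N} := [ffun a => F (rshift m a)].
pose jn (p : {ffun 'I_m -> 'I_N} * {ffun 'I_h -> 'I_N}) : {ffun 'I_(m + h) -> 'I_N} :=
  [ffun i => match split i with inl a => p.1 a | inr b => p.2 b end].
have jn1 p a : jn p (lshift h a) = p.1 a by rewrite ffunE (unsplitK (inl a)).
have jn2 p a : jn p (rshift m a) = p.2 a by rewrite ffunE (unsplitK (inr a)).
have jnK p : (j1 (jn p), j2 (jn p)) = p.
  by case: p => p1 p2; congr (_, _); apply/ffunP => a; rewrite ffunE ?jn1 ?jn2.
have Kjn F : jn (j1 F, j2 F) = F.
  by apply/ffunP=> i; rewrite -(splitK i); case: (split i) => a /=; rewrite ?jn1 ?jn2 /= ffunE.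
have jninj : injective jn by apply: (can_inj (g := fun F => (j1 F, j2 F))).
have ivn p : inv_col (jperm x t) (jn p) = inv_col x p.1 && inv_col t p.2.
  apply/forallP/andP => [i|[/forallP i1 /forallP i2] i].
    split; apply/forallP => a; first by have := i (lshift h a); rewrite jpermL !jn1.
    by have := i (rshift m a); rewrite jpermR !jn2.
  rewrite -(splitK i); case: (split i) => a /=; first by rewrite jpermL !jn1.
  by rewrite jpermR !jn2.
have cn p i : cnt (jn p) i = (cnt p.1 i + cnt p.2 i)%N.
  rewrite /cnt -!sum1_card !(big_mkcond (fun z => z \in _)) /= big_split_ord /=.
  by congr (_ + _)%N; apply: eq_bigr => a _; rewrite !inE ?jn1 ?jn2.
pose Q (u : {ffun 'I_N -> 'I_B}) (p : {ffun 'I_m -> 'I_N} * {ffun 'I_h -> 'I_N}) :=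
  (p.1 \in [set F : {ffun 'I_m -> 'I_N} | inv_col x F && [forall i, cnt F i + k i == u i]%N]) &&
  (p.2 \in [set F : {ffun 'I_h -> 'I_N} | inv_col t F && [forall i, cnt F i + u i == g i]%N]).
transitivity (\sum_(u : {ffun 'I_N -> 'I_B}) \sum_(p | Q u p) 1)%N; last first.
  apply: eq_bigr => u _; rewrite /ncol -cardsX sum1_card; apply: eq_card => p.
  by rewrite [LHS]unfold_in [RHS]inE.
rewrite (exchange_big_dep xpredT) //= /ncol -sum1_card.
rewrite (reindex_onto jn (fun F => (j1 F, j2 F))) /=; last by move=> F _; apply: Kjn.
rewrite big_mkcond /=; apply: eq_bigr => p _; rewrite jnK eqxx andbT inE ivn.
have QE u : Q u p = [&& inv_col x p.1 && inv_col t p.2, [forall i, cnt p.1 i + k i == u i]%N &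
   [forall i, cnt p.2 i + u i == g i]%N].
  by rewrite /Q !inE andbACA.
under eq_bigl do rewrite QE.
case: (inv_col x p.1 && inv_col t p.2) => /=; last by rewrite big_pred0.
case: (boolP [forall i, _]) => [/forallP ok|nok].
  have lt i : (cnt p.1 i + k i < B)%N.
    by apply: leq_ltn_trans (gB i); rewrite -(eqP (ok i)) cn; lia.
  rewrite (big_pred1 [ffun i => Ordinal (lt i)]) // => u.
  apply/andP/eqP => [[/forallP e _]|->].
    by apply/ffunP => i; apply/val_inj; rewrite ffunE /= (eqP (e i)).
  split; apply/forallP => i; rewrite ffunE //=.
  by rewrite -(eqP (ok i)) cn; lia.
rewrite big_pred0 // => u; apply/negbTE; apply: contra nok => /andP[/forallP a /forallP b].
by apply/forallP => i; rewrite cn -(eqP (b i)) -(eqP (a i)); lia.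
Qed.

Lemma jt_jperm N B (g k : 'I_N -> nat) x t : (forall i, g i < B)%N ->
  jt g k (jperm x t) = \sum_(u : {ffun 'I_N -> 'I_B}) jt (fun i => nat_of_ord (u i)) k x * (ncol g (fun i => nat_of_ord (u i)) t)%:R.
Proof.
move=> gB; rewrite /jt; under [RHS]eq_bigr do rewrite big_distrl /=.
rewrite exchange_big /=; apply: eq_bigr => w _; rewrite (ncol_jperm _ _ _ gB) natr_sum big_distrr /=.
by apply: eq_bigr => u _; rewrite natrM mulrA.
Qed.

(** After splitting by [jt_jperm], orthogonality over the first factor retains only the intermediate
    contents that are rearrangements of [k], and their signs rebuild the alternating sum
    [jt g k]. *)
Lemma sum_jt_jperm N (g k : 'I_N -> nat) t : (\sum_i k i = m + \sum_(i < N) stair i)%N ->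
  m`!%:R^-1 * \sum_x jt k (@stair N) x * jt g (@stair N) (jperm x t) = jt g k t.
Proof.
move=> ek; pose B := (\sum_i g i + \sum_i k i).+1.
have gB i : (g i < B)%N by rewrite /B (bigD1 i) //=; lia.
have kB i : (k i < B)%N by rewrite /B (bigD1 i (P := xpredT) (F := k)) //=; lia.
transitivity (m`!%:R^-1 * \sum_(u : {ffun 'I_N -> 'I_B}) (\sum_(x : {perm 'I_m}) jt k (@stair N) x * jt (fun i => nat_of_ord (u i)) (@stair N) x) * (ncol g (fun i => nat_of_ord (u i)) t)%:R).
  congr (_ * _); under eq_bigr do rewrite (jt_jperm _ _ _ gB) big_distrr /=.
  rewrite exchange_big /=; apply: eq_bigr => u _; rewrite big_distrl /=.
  by apply: eq_bigr => x _; rewrite mulrA.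
under eq_bigr do rewrite jt_orthogonality // -mulrA.
rewrite -big_distrr /= mulKf ?fact_neq0 //.
under eq_bigr do rewrite big_distrl /=.
rewrite exchange_big /=; apply: eq_bigr => w _.
under eq_bigr do rewrite -mulrA; rewrite -big_distrr /=; congr (_ * _).
rewrite (bigD1 [ffun i => Ordinal (kB (w i))]) //= big1 ?addr0.
  rewrite (_ : [forall i, _] = true) ?mul1r.
    congr _%:R; apply: eq_card => F; rewrite !inE; congr (_ && _); apply: eq_forallb => i.
    by rewrite ffunE.
  by apply/forallP => i; rewrite ffunE.
move=> u nu; case: (boolP [forall i, _]) => [/forallP e|]; last by rewrite mul0r.
by case/eqP: nu; apply/ffunP => i; apply/val_inj; rewrite ffunE /= (eqP (e i)).
Qed.
End JoinPerm.

Definition is_part (n b : nat) (p : seq nat) : bool :=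
  [&& sorted geq p, all (leq 1) p, sumn p == n & all (geq b) p].

Lemma is_part_cons n b k p :
  is_part n b (k :: p) = [&& (0 < k)%N, (k <= b)%N, (k <= n)%N & is_part (n - k) k p].
Proof.
have tr : transitive geq by move=> x y z /=; lia.
rewrite /is_part /= path_sortedE //.
apply/idP/idP => [/and4P[/andP[a1 a2] /andP[b1 b2] /eqP e /andP[c1 c2]]|].
  by rewrite b1 c1 a2 b2 a1 /= -e; apply/andP; split; lia.
move=> /and4P[k0 kb kn /and4P[a1 b1 /eqP e c]].
rewrite c a1 k0 b1 kb /=; apply/andP; split; first by lia.
by apply/allP => x /(allP c) /=; lia.
Qed.

Lemma is_part0 n b : is_part n b [::] = (n == 0)%N.
Proof. by rewrite /is_part /= andbT eq_sym. Qed.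

Lemma is_part_n0 b p : is_part 0 b p = (p == [::]).
Proof.
case: p => [|k p]; first by rewrite is_part0.
by rewrite is_part_cons; case: k => [|k] //; rewrite ltn0 !andbF.
Qed.

Lemma mem_parts_aux f n b p : (n <= f)%N -> (p \in parts_aux f n b) = is_part n b p.
Proof.
elim: f n b p => [|f IH] n b p nf.
  by move: nf; rewrite leqn0 => /eqP ->; rewrite is_part_n0 /= inE.
rewrite /=; case: eqP => [->|n0]; first by rewrite is_part_n0 inE.
case: p => [|k p].
  rewrite is_part0 (introF eqP n0); apply/negbTE/negP => /flatten_mapP[k _ /mapP[q _ //]].
rewrite is_part_cons; apply/flatten_mapP/and4P => [[k' k'i /mapP[q qp [-> ->]]]|[k0 kb kn pp]].
  move: k'i; rewrite mem_iota => /andP[a b']; rewrite IH in qp; last by lia.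
  by split=> //; lia.
exists k; first by rewrite mem_iota; lia.
by apply/mapP; exists p; rewrite // IH //; lia.
Qed.

Lemma uniq_parts_aux f n b : uniq (parts_aux f n b).
Proof.
elim: f n b => [|f IH] n b /=; first by case: eqP.
case: eqP => // _.
apply: (@allpairs_uniq_dep _ (fun=> seq nat) _ (fun k p => k :: p)); first exact: iota_uniq.
  by move=> k _; apply: IH.
by move=> [k p] [k' p'] _ _ /= [-> ->].
Qed.

Lemma mem_partitions n p : (p \in partitions n) = is_part n n p.
Proof. exact: mem_parts_aux. Qed.

Lemma is_part_size n b p : is_part n b p -> (size p <= n)%N.
Proof.
move=> /and4P[_ a /eqP <- _]; elim: p a => //= k p IH /andP[k0 /IH]; lia.
Qed.

(** * The partitions exhaust the irreducible characters *)

Section Alternating.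
Variables (n N : nat).
Implicit Types (g k : 'I_N -> nat) (s : {perm 'I_n}).

Lemma ncol_perm g k (v w : 'S_N) s :
  ncol (g \o v) (k \o w) s = ncol g (k \o (v^-1 * w)%g) s.
Proof.
pose ac (F : {ffun 'I_n -> 'I_N}) := [ffun x => v (F x)].
have acinj : injective ac by move=> F F' /ffunP e; apply/ffunP => x; have := e x; rewrite !ffunE => /perm_inj.
have cac F i : cnt (ac F) i = cnt F (v^-1 i)%g.
  by apply: eq_card => x; rewrite !inE ffunE (canF_eq (permK v)).
have iac F : inv_col s (ac F) = inv_col s F.
  by apply: eq_forallb => x; rewrite !ffunE (inj_eq perm_inj).
rewrite /ncol -(card_imset _ acinj); apply: eq_card => F; rewrite inE; apply/imsetP/andP => [[F']|[i /forallP c]].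
  rewrite inE => /andP[i /forallP c] ->; rewrite iac; split=> //; apply/forallP => j.
  by have := c (v^-1 j)%g; rewrite cac /= permKV permM.
exists [ffun x => v^-1 (F x)]%g; last by apply/ffunP=> x; rewrite !ffunE permKV.
have eF : F = ac [ffun x => v^-1 (F x)]%g by apply/ffunP=> x; rewrite !ffunE permKV.
rewrite inE -iac -eF i; apply/forallP => j; have := c (v j); rewrite {1}eF cac permK /=.
by rewrite permM permK.
Qed.

Lemma jt_perm g k (v : 'S_N) s : jt (g \o v) k s = (-1) ^+ v * jt g k s.
Proof.
rewrite /jt (reindex_inj (mulgI v)) /= big_distrr /=; apply: eq_bigr => w _.
by rewrite ncol_perm mulKg odd_permM signr_addb mulrA.
Qed.

Lemma jt_ninj g k (i j : 'I_N) s : i != j -> g i = g j -> jt g k s = 0.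
Proof.
move=> ij gij; have := jt_perm g k (tperm i j) s.
have -> : jt (g \o tperm i j) k s = jt g k s.
  apply: eq_bigr => w _; congr (_ * _%:R); apply: eq_card => F; rewrite !inE; congr (_ && _).
  by apply: eq_forallb => l /=; case: tpermP => [->|->|//]; rewrite gij.
rewrite odd_tperm ij expr1 mulN1r => /eqP.
by rewrite -addr_eq0 -mulr2n mulrn_eq0 /= => /eqP.
Qed.

Lemma ex_sort_perm g : injective g ->
  exists v : 'S_N, forall i j : 'I_N, (i < j)%N -> (g (v j) < g (v i))%N.
Proof.
move=> injg; pose s := sort geq (codom g).
have ss : size (codom g) == N by rewrite size_codom card_ord.
have : perm_eq s (Tuple ss) by rewrite perm_sort.
case/tuple_permP => v ev; exists v => i j ij.
have tr : transitive geq by move=> x y z /=; lia.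
have nG z : tnth (Tuple ss) z = g z.
  by rewrite (tnth_nth (g z)) /= codomE (nth_map z) ?size_enum_ord // nth_ord_enum.
have nS (z : 'I_N) : nth 0%N s z = g (v z).
  by rewrite ev -tnth_nth tnth_mktuple nG.
rewrite ltn_neqAle; apply/andP; split.
  by rewrite (inj_eq injg) (inj_eq perm_inj) -val_eqE /=; lia.
rewrite -!nS; have : sorted geq s by apply: sort_sorted => x y /=; lia.
move/(@sorted_leq_nth _ geq tr _ 0%N); apply; rewrite ?inE ?size_sort ?(eqP ss) ?ltn_ord //; last exact: ltnW.
by move=> x /=.
Qed.

Lemma rank_lt g (i : 'I_N) : (forall i j : 'I_N, (i < j)%N -> (g j < g i)%N) ->
  #|[set j | (g i < g j)%N]| = i.
Proof.
move=> gd; rewrite -[RHS](card_lt_ord (ltnW (ltn_ord i))); apply: eq_card => j; rewrite !inE.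
case: (ltngtP i j) => [/gd|/gd ->//|/val_inj->]; last by rewrite ltnn.
by move=> h; apply/negbTE; rewrite -leqNgt ltnW.
Qed.

Lemma decr_perm g g' (w : 'S_N) :
  (forall i j : 'I_N, (i < j)%N -> (g j < g i)%N) ->
  (forall i j : 'I_N, (i < j)%N -> (g' j < g' i)%N) ->
  (forall i, g' i = g (w i)) -> w = 1%g.
Proof.
move=> gd gd' e; apply/permP => i; rewrite perm1; apply/val_inj; rewrite /= -[RHS](rank_lt i gd').
rewrite -[LHS](rank_lt (w i) gd) -[RHS](card_imset _ (@perm_inj _ w)); apply: eq_card => j; rewrite inE.
apply/idP/imsetP => [h|[l]]; last by rewrite inE !e => ? ->.
by exists (w^-1 j)%g; rewrite ?inE ?e permKV.
Qed.

(** The alternating character of a + delta is the permutation character of [a] plus signed terms for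
    w other than 1. So either it pairs with [phi], or one of those terms does; the content of that
    term has larger weight against [stair]. As this weight is at most n N, the process stops. *)
Lemma Mcf_Vcf (phi : 'CF(Sym n)) d (a : 'I_N -> nat) :
  (\sum_i a i = n)%N -> (n * N - \sum_i stair i * a i < d)%N ->
  '[Mcf n a (fun=> 0%N), phi] != 0 ->
  exists2 g : 'I_N -> nat, (\sum_i g i = n + \sum_(i < N) stair i)%N & '[Vcf n g (@stair N), phi] != 0.
Proof.
elim: d a => // d IH a sa da na; pose g i := (a i + stair i)%N.
have sg : (\sum_i g i = n + \sum_(i < N) stair i)%N by rewrite big_split /= sa.
case: (boolP ('[Vcf n g (@stair N), phi] == 0)) => [|nz]; last by exists g.
rewrite Vcf_sum cfdot_suml (bigD1 1%g) //= cfdotZl odd_perm1 mul1r.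
have -> : Mcf n g (@stair N \o (1%g : 'S_N)) = Mcf n a (fun=> 0%N).
  apply/cfunP => s; rewrite !McfE; congr _%:R; apply: eq_card => F; rewrite !inE; congr (_ && _).
  by apply: eq_forallb => i; rewrite /= perm1 addn0 eqn_add2r.
move=> z; have [w nw nz] : exists2 w : 'S_N, w != 1%g & '[Mcf n g (@stair N \o w), phi] != 0.
  apply/exists_inP; apply: contraR na => /exists_inPn allz.
  move: z; rewrite big1 ?addr0 // => w nw; rewrite cfdotZl (eqP (negbNE (allz w nw))) mulr0.
  by [].
have [s [F Fs]] : exists s, exists F : {ffun 'I_n -> 'I_N},
    F \in [set F | inv_col s F && [forall i, cnt F i + (@stair N \o w) i == g i]%N].
  have [s ns|z0] := pickP (fun s => Mcf n g (@stair N \o w) s != 0).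
    exists s; move: ns; rewrite McfE pnatr_eq0 -lt0n => /card_gt0P[F FP]; by exists F.
  case/eqP: nz; rewrite (_ : Mcf _ _ _ = 0) ?cfdot0l //; apply/cfunP => s.
  by rewrite [RHS]cfunE; apply/eqP; have := z0 s => /negbFE.
move: Fs; rewrite inE => /andP[_ /forallP cF].
apply: (IH (cnt F)).
- exact: sum_cnt.
- have lt : (\sum_i stair i * a i < \sum_i stair i * cnt F i)%N.
    rewrite ltnNge; apply: contra nw => le; apply/eqP/stair_perm_le.
    rewrite -(leq_add2l (\sum_i stair i * cnt F i)%N) -[X in (_ <= X)%N]big_split /=.
    under [X in (_ <= X)%N]eq_bigr do rewrite -mulnDr (eqP (cF _)) /g mulnDr.
    by rewrite big_split /= leq_add2r.
  have : (\sum_i stair i * cnt F i <= n * N)%N.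
    rewrite -{2}(sum_cnt F) big_distrl /=; apply: leq_sum => i _.
    by rewrite mulnC leq_mul2l /stair leq_subr orbT.
  lia.
- rewrite (_ : Mcf n (cnt F) _ = Mcf n g (@stair N \o w)) //.
  apply/cfunP => t; rewrite !McfE; congr _%:R; apply: eq_card => F'; rewrite !inE; congr (_ && _).
  by apply: eq_forallb => i; rewrite addn0 -(eqP (cF i)) eqn_add2r.
Qed.
End Alternating.

Lemma nth_filter_pos l i : sorted geq l -> nth 0%N (filter (leq 1) l) i = nth 0%N l i.
Proof.
have tr : transitive geq by move=> x y z /=; lia.
elim: l i => //= x l IH i sl; have sl' := path_sorted sl.
case: ltnP => [_|x0]; first by case: i => //= i; apply: IH.
have all0 : all (pred1 0%N) (x :: l).
  apply/allP => y; rewrite inE => /orP[/eqP->|yl]; first by rewrite /= -leqn0.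
  by move: sl; rewrite path_sortedE // => /andP[/allP/(_ y yl) /=]; lia.
have -> : nth 0%N (x :: l) i = 0%N.
  case: (ltnP i (size (x :: l))) => il; last by rewrite nth_default.
  by apply/eqP; apply: (allP all0); apply: mem_nth.
rewrite (_ : filter _ l = [::]) ?nth_nil //; apply/eqP; rewrite -[_ == _]negbK -has_filter.
apply/hasPn => y yl; have := allP all0 y; rewrite inE yl orbT => /(_ isT) /eqP -> //.
Qed.

Lemma sumn_filter_pos l : sumn (filter (leq 1) l) = sumn l.
Proof. by elim: l => //= x l <-; case: x. Qed.

Section Complete.
Variable n : nat.

(** The content with all parts 1 gives the regular character, which contains every irreducible.
    [Mcf_Vcf] then finds an alternating character that pairs with the given one, and sorting its
    index turns it, up to sign, into a Specht character. Two irreducibles with nonzero pairing are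
    equal. *)
Lemma irr_Specht (i : Iirr (Sym n)) : exists2 nu, nu \in partitions n & 'chi_i = Specht n nu.
Proof.
pose one := (fun=> 1%N) : 'I_n -> nat.
have [||g sg ng] := @Mcf_Vcf n n 'chi_i (n * n - \sum_(i < n) stair i * one i).+1 one _ (leqnn _).
- by rewrite sum1_card card_ord.
- suff -> : '[Mcf n one (fun=> 0%N), 'chi_i] = ('chi_i 1%g)^* by rewrite conjC_eq0 irr1_neq0.
  rewrite cfdot_Sym (bigD1 1%g) //= big1 ?addr0.
    rewrite McfE (_ : ncol _ _ _ = n`!) ?mulKf ?fact_neq0 //.
    pose ac (s : {perm 'I_n}) := [ffun x => s x].
    have acinj : injective ac.
      by move=> s s' /ffunP e; apply/permP => x; have := e x; rewrite !ffunE.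
    rewrite -card_Sn /ncol -[RHS](card_imset _ acinj).
    apply: eq_card => F; rewrite !inE; apply/andP/imsetP => [[_ /forallP c]|[s _ ->]].
      have iF : injective F.
        move=> x y e; apply/eqP; apply/negPn/negP => xy.
        have : (#|[set x; y]| <= cnt F (F x))%N.
          by apply: subset_leq_card; apply/subsetP=> z; rewrite !inE => /orP[] /eqP ->; rewrite ?e.
        by rewrite -[cnt F _]addn0 (eqP (c (F x))) cards2 xy.
      by exists (perm iF) => //; apply/ffunP => x; rewrite ffunE permE.
    split; first by apply/forallP => x; rewrite perm1.
    apply/forallP => x; rewrite addn0 /cnt (_ : [set _ | _] = [set s^-1%g x]) ?cards1 //.
    by apply/setP => y; rewrite !inE ffunE -(inj_eq (@perm_inj _ s)) permKV.
  move=> s ns; rewrite McfE (_ : ncol _ _ _ = 0%N) ?mul0r //; apply/eqP; rewrite cards_eq0 -subset0.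
  apply/subsetP => F; rewrite inE => /andP[/forallP iv /forallP c]; case/negP: ns; apply/eqP/permP => x.
  rewrite perm1; apply/eqP; apply/negPn/negP => xy.
  have : (#|[set s x; x]| <= cnt F (F x))%N.
    by apply: subset_leq_card; apply/subsetP=> z; rewrite !inE => /orP[] /eqP ->; rewrite ?(eqP (iv _)).
  by rewrite -[cnt F _]addn0 (eqP (c (F x))) cards2 xy.
have injg : injective g.
  move=> a b gab; apply/eqP; apply/negPn/negP => ab; case/eqP: ng.
  rewrite (_ : Vcf _ _ _ = 0) ?cfdot0l //; apply/cfunP => s.
  by rewrite VcfE [RHS]cfunE (jt_ninj _ _ ab gab).
have [v vd] := ex_sort_perm injg.
pose gv (j : 'I_n) := g (v j).
have gvge (j : 'I_n) : (stair j <= gv j)%N.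
  rewrite /stair; have [m] := ubnP (n - j.+1); elim: m j => // m IH j jm.
  have [j1|j1] := ltnP j.+1 n; last by rewrite (_ : n - j.+1 = 0)%N //; lia.
  have := IH (Ordinal j1); have := vd j (Ordinal j1) (leqnn _); rewrite /gv /=; lia.
(* A strictly decreasing sequence is at least [stair] termwise, and the difference is a partition
   with possible zero parts, which [lam] drops. *)
pose lam0 := mkseq (fun j => if insub j is Some j' then (gv j' - stair j')%N else 0%N) n.
have nlam0 (j : 'I_n) : nth 0%N lam0 j = (gv j - stair j)%N.
  by rewrite nth_mkseq // valK.
have slam0 : sorted geq lam0.
  apply/(sortedP 0%N) => j; rewrite size_mkseq => j1.
  have := nlam0 (Ordinal (ltnW j1)); have := nlam0 (Ordinal j1) => /= -> ->.
  have := vd (Ordinal (ltnW j1)) (Ordinal j1) (leqnn _); rewrite /gv /stair /=; lia.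
pose lam := filter (leq 1) lam0.
have slam : sorted geq lam by apply: sorted_filter => // x y z /=; lia.
have sumlam : sumn lam = n.
  rewrite /lam sumn_filter_pos sumnE (big_nth 0%N) size_mkseq big_mkord.
  under eq_bigr do rewrite nlam0.
  apply/eqP; rewrite -(eqn_add2r (\sum_(i < n) stair i)) -sg -big_split /=; apply/eqP.
  rewrite [RHS](reindex_inj (@perm_inj _ v)) /=; apply: eq_bigr => j _; rewrite subnK //; exact: gvge.
have sz : (size lam <= n)%N by rewrite /lam size_filter; apply: leq_trans (count_size _ _) _; rewrite size_mkseq.
have pl : is_part n n lam.
  rewrite /is_part slam sumlam eqxx filter_all /=; apply/allP => x xl /=; rewrite -{1}sumlam.
  by rewrite sumnE (big_rem x xl) /= leq_addr.
exists lam; first by rewrite mem_partitions.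
have eV : Specht n lam = Vcf n gv (@stair n).
  rewrite (Specht_Vcf slam sumlam sz); apply/cfunP => s; rewrite !VcfE; apply: eq_bigr => w _; congr (_ * _%:R).
  apply: eq_card => F; rewrite !inE; congr (_ && _); apply: eq_forallb => j.
  by rewrite /lamdelta nth_filter_pos // nlam0 subnK.
have [j ej] := Vcf_irr slam sumlam sz; rewrite -(Specht_Vcf slam sumlam sz) in ej.
rewrite ej; apply/eqP; apply: contraNT ng => ij.
have : '[Specht n lam, 'chi_i] = 0.
  by rewrite ej cfdot_irr; case: eqP => // e; case/eqP: ij; rewrite e.
rewrite eV (_ : Vcf n gv _ = (-1) ^+ v *: Vcf n g (@stair n)).
  by rewrite cfdotZl => /eqP; rewrite mulf_eq0 signr_eq0.
by apply/cfunP => s; rewrite !cfunE !VcfE -jt_perm.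
Qed.

Lemma Specht_inj : {in partitions n &, injective (Specht n)}.
Proof.
move=> l1 l2; rewrite !mem_partitions => p1 p2 e.
have z1 := is_part_size p1; have z2 := is_part_size p2.
case/and4P: (p1) => s1 a1 /eqP e1 _; case/and4P: (p2) => s2 a2 /eqP e2 _.
have : '[Specht n l1, Specht n l2] = 1.
  by rewrite -e (Specht_Vcf s1 e1 z1) (cfdot_V_V s1 e1 z1).
rewrite (Specht_Vcf s1 e1 z1) (Specht_Vcf s2 e2 z2) cfdot_Vcf ?(sum_lamdelta e1 z1) // => /eqP h.
have [w /forallP we] : exists w : 'S_n, [forall i, lamdelta l2 i == lamdelta l1 (w i)].
  apply/existsP; apply: contraLR h => /existsPn nw; rewrite big1 ?(eq_sym 0) ?oner_neq0 // => w _.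
  by rewrite (negPf (nw w)) mulr0.
have w1 := decr_perm (lamdelta_lt s1 e1 z1) (lamdelta_lt s2 e2 z2) (fun i => eqP (we i)).
have en i : (i < n)%N -> nth 0%N l1 i = nth 0%N l2 i.
  by move=> li; have := eqP (we (Ordinal li)); rewrite w1 perm1 /lamdelta /= => /eqP; rewrite eqn_add2r => /eqP.
have en' i : nth 0%N l1 i = nth 0%N l2 i.
  by case: (ltnP i n) => [/en//|ni]; rewrite !nth_default // (leq_trans _ ni).
have le (u v : seq nat) : all (leq 1) v -> (forall i, nth 0%N u i = nth 0%N v i) -> (size v <= size u)%N.
  move=> av ev; rewrite leqNgt; apply/negP => uv; have := allP av _ (mem_nth 0%N uv).
  by rewrite -ev nth_default.
apply: (@eq_from_nth _ 0%N) => [|i _]; last exact: en'.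
by apply/eqP; rewrite eqn_leq !le // => i; rewrite en'.
Qed.

Lemma Specht_irr nu : nu \in partitions n -> Specht n nu \in irr (Sym n).
Proof.
rewrite mem_partitions => p1; have z1 := is_part_size p1; case/and4P: (p1) => s1 a1 /eqP e1 _.
by have [i e] := Vcf_irr s1 e1 z1; rewrite (Specht_Vcf s1 e1 z1) e mem_irr.
Qed.

Lemma sum_partitions (V : nmodType) (f : 'CF(Sym n) -> V) :
  \sum_(nu <- partitions n) f (Specht n nu) = \sum_i f 'chi_i.
Proof.
transitivity (\sum_(i <- [seq cfIirr (Specht n nu) | nu <- partitions n]) f 'chi_i).
  rewrite big_map big_seq [RHS]big_seq; apply: eq_bigr => nu /Specht_irr h; by rewrite cfIirrE.
apply: perm_big; apply: uniq_perm.
- rewrite map_inj_in_uniq ?uniq_parts_aux // => a b pa pb e; apply: Specht_inj => //.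
  by rewrite -(cfIirrE (Specht_irr pa)) -(cfIirrE (Specht_irr pb)) e.
- exact: index_enum_uniq.
move=> i; rewrite mem_index_enum; apply/mapP; have [nu p e] := irr_Specht i.
by exists nu => //; rewrite -e irrK.
Qed.
End Complete.

(** Frobenius reciprocity and [sum_jt_jperm] turn each multiplicity into the pairing with the
    Jacobi-Trudi character of lam/mu. Since the Specht characters are all the irreducibles, the sum
    is the expansion of that character. *)
Lemma skewSpecht_jt (h N : nat) (lam mu : seq nat) (t : {perm 'I_h}) :
  sorted geq lam -> sorted geq mu -> sumn lam = (sumn mu + h)%N ->
  (size lam <= N)%N -> (size mu <= N)%N ->
  skewSpecht h lam mu t = jt (lamdelta (N := N) lam) (lamdelta (N := N) mu) t.
Proof.
move=> sl sm el zl zm; set m := sumn mu in el *.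
pose Psi := Vcf h (lamdelta (N := N) lam) (lamdelta (N := N) mu).
rewrite -VcfE -/Psi; congr (fun_of_cfun _ t).
have dotE (phi : 'CF(Sym h)) :
   '['Ind[Sym (m + h)] (boxCF (Specht m mu) phi), Specht (m + h) lam] = '[phi, Psi].
  rewrite -Frobenius_reciprocity // cfdotE card_Young2 sum_Young2 natrM invfM cfdot_Sym.
  rewrite exchange_big /= [_^-1 * _^-1]mulrC -mulrA; congr (_ * _).
  rewrite [LHS]big_distrr /=; apply: eq_bigr => u _.
  rewrite VcfE jt_conjC -(sum_jt_jperm (m := m)); last exact: (sum_lamdelta erefl zm).
  rewrite mulrCA; congr (_ * _); rewrite big_distrr /=; apply: eq_bigr => x _.
  rewrite boxCFE cfResE ?subsetT ?jperm_Young // (Specht_Vcf sl el zl) (Specht_Vcf sm erefl zm) !VcfE jt_conjC.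
  by rewrite [_ * phi u]mulrC mulrA.
rewrite /skewSpecht -/m; under eq_bigr do rewrite dotE.
rewrite (sum_partitions (fun phi => '[phi, Psi] *: phi)).
rewrite [RHS](cfun_sum_cfdot Psi); apply: eq_bigr => i _; congr (_ *: _).
(* The pairing with a virtual character is an integer, so the conjugation disappears. *)
rewrite cfdotC; apply/conj_intr; exact: Cint_cfdot_vchar_irr (Vcf_vchar _ _ _).
Qed.

(** * Jacobi-Trudi determinants of the relevant shapes *)

Lemma bump_lt a x : (x < a)%N -> bump a x = x.
Proof. by move=> xa; rewrite /bump [(a <= x)%N]leqNgt xa. Qed.
Lemma bump_ge a x : (a <= x)%N -> bump a x = x.+1.
Proof. by rewrite /bump => ->. Qed.

Section UnitRows.
Variable R : comNzRingType.

Lemma det_unit_rows n (u : 'I_n.+1 -> R) (a : 'I_n.+1) :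
  \det (\matrix_(r, s) (if unlift ord0 r is Some k then (s == lift a k)%:R else u s)) = (-1) ^+ a * u a.
Proof.
rewrite (expand_det_row _ ord0) (bigD1 a) //= big1 ?addr0.
  rewrite !mxE unlift_none /cofactor add0n mulrC (_ : row' _ _ = 1%:M) ?det1 ?mulr1 //.
  by apply/matrixP => k s; rewrite !mxE liftK (inj_eq (@lift_inj _ a)) eq_sym.
move=> s sa; rewrite /cofactor (_ : \det _ = 0) ?mulr0 ?mulr0 //.
case: (unliftP a s) => [k0 es|es]; last by rewrite es eqxx in sa.
rewrite (expand_det_row _ k0) big1 // => s' _; rewrite !mxE liftK es.
by rewrite eq_sym (negPf (neq_lift _ _)) mul0r.
Qed.

(* The unit rows miss exactly the columns [a] and [n.+1]. *)
Lemma det_unit_rows2 n (u v : nat -> R) (a : nat) : (a <= n)%N ->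
  \det (\matrix_(r < n.+2, s < n.+2)
     (if r == 0 :> nat then u s else if r == 1 :> nat then v s else ((s : nat) == bump a (r - 2))%:R)) =
  (-1) ^+ (n.+1 + a) * (u n.+1 * v a - v n.+1 * u a).
Proof.
move=> an; set M := \matrix_(r, s) _.
have minor (w : nat -> R) r : (r <= 1)%N -> (if r == 0%N then v else u) =1 w ->
    \det (row' (inord r) (col' ord_max M)) = (-1) ^+ a * w a.
  move=> r1 ew; rewrite -(det_unit_rows (fun s : 'I_n.+1 => w s) (Ordinal (an : a < n.+1)%N)).
  congr (\det _); apply/matrixP => k s; rewrite !mxE.
  have -> : lift ord_max s = s :> nat by rewrite /= /bump leqNgt ltn_ord add0n.
  have -> : lift (inord r : 'I_n.+2) k = bump r k :> nat by rewrite /= inordK //; lia.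
  case: unliftP => [k' ->|->] /=.
    rewrite /bump leq0n add1n.
    have -> : (r <= k'.+1)%N by lia.
    by rewrite -val_eqE /= add1n /bump subSS subn1.
  by case: r r1 ew => [|[|r]] //= _ <-; rewrite /bump.
rewrite (expand_det_col _ ord_max) big_ord_recl big_ord_recl /= big1 ?addr0; last first.
  move=> k _; rewrite !mxE /= /bump leq0n !add1n /=.
  have -> : (n.+1 == ((a <= k.+2 - 2)%N + (k.+2 - 2))%N) = false.
    by apply/negbTE; have := ltn_ord k; lia.
  by rewrite mul0r.
have -> : lift ord0 ord0 = inord 1 :> 'I_n.+2 by apply/val_inj; rewrite /= inordK.
have e0 : ord0 = inord 0 :> 'I_n.+2 by apply/val_inj; rewrite /= inordK.
rewrite /cofactor {2 3}e0 (@minor v 0%N) // (@minor u 1%N) // !mxE /= !inordK //= add0n add1n.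
rewrite exprD !exprS; ring.
Qed.
End UnitRows.

Section HookDet.
Variables (R : comNzRingType) (h : nat -> R).
Hypothesis h0 : h 0 = 1.
Local Notation hook := (hook h).
Local Notation elem := (elem h).

(** The first column has only two nonzero entries, and expansion along it is the recurrence of
    [hook]. *)
Lemma det_hook n c :
  \det (\matrix_(r < n.+1, s < n.+1) (if r == 0 :> nat then h (c + s) else hsub h s.+1 r)) = hook c n.
Proof.
elim: n c => [|n IH] c.
  by rewrite det_mx11 !mxE /= addn0.
rewrite (expand_det_col _ ord0) big_ord_recl big_ord_recl /= big1 ?addr0; last first.
  by move=> k _; rewrite !mxE /hsub /= mul0r.
rewrite !mxE /= addn0 /hsub /= subnn h0 mul1r.
have -> : cofactor (\matrix_(r < n.+2, s < n.+2) (if r == 0 :> nat then h (c + s) else hsub h s.+1 r)) ord0 ord0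
   = hook 1 n.
  rewrite /cofactor add0n expr0 mul1r -IH; congr (\det _); apply/matrixP => r s; rewrite !mxE /= /bump leq0n !add1n.
  by case: (r : nat) => [|r'] //=.
have -> : cofactor (\matrix_(r < n.+2, s < n.+2) (if r == 0 :> nat then h (c + s) else hsub h s.+1 r)) (lift ord0 ord0) ord0
   = - hook c.+1 n.
  rewrite /cofactor /= addn0 expr1 mulN1r -IH; congr (- \det _); apply/matrixP => r s; rewrite !mxE /= /bump leq0n !add1n.
  by case: (r : nat) => [|r'] //=; rewrite addnS addSn.
by [].
Qed.

(** Here the last row has only two nonzero entries, and expansion along it is again the recurrence
    of [hook]. *)
Lemma det_hook_col n c :
  \det (\matrix_(r < n.+1, s < n.+1) (if s == n :> nat then h (c + (n - r)) else hsub h s.+1 r)) = hook c n.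
Proof.
elim: n c => [|n IH] c.
  by rewrite det_mx11 !mxE /= addn0.
have h1 : \det (\matrix_(r < n.+1, s < n.+1) hsub h s.+1 r) = hook 1 n.
  rewrite -(det_hook n 1); congr (\det _); apply/matrixP => r s; rewrite !mxE.
  by case: eqP => // ->; rewrite /hsub subn0.
rewrite (expand_det_row _ ord_max) big_ord_recr big_ord_recr /= big1 ?add0r; last first.
  move=> k _; rewrite !mxE /= ifF; last by apply/negbTE; have := ltn_ord k; lia.
  by rewrite /hsub ifF ?mul0r //; apply/negbTE; have := ltn_ord k; lia.
rewrite !mxE /= eqxx subnn addn0 ifF; last by apply/negbTE; lia.
rewrite /hsub leqnn subnn h0 mul1r addrC; congr (_ + _).
  congr (_ * _); rewrite /cofactor /= -signr_odd addnn odd_double expr0 mul1r -h1.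
  congr (\det _); apply/matrixP => r s; rewrite !mxE /= !bump_lt ?ltn_ord // ifF //.
  by apply/negbTE; have := ltn_ord s; lia.
rewrite /cofactor /= addSn addnn -[in LHS]signr_odd /= odd_double /= expr1 mulN1r -IH; congr (- \det _).
apply/matrixP => r s; rewrite !mxE /= (@bump_lt n.+1 r) ?ltn_ord //.
have := ltn_ord s; have := ltn_ord r; case: (ltngtP s n) => sn; last 1 first.
- by rewrite sn bump_ge // eqxx => rn _; congr h; lia.
- by rewrite bump_lt // ifF //; lia.
- by lia.
Qed.

Let eps c j := (-1) ^+ j * hook c j.

(** Reads [sum_h_hook] as a factorization: the row of h's with offset [c] is a combination of the
    rows of the unitriangular shift matrix. *)
Lemma h_eps c n s : (s < n)%N -> h (c + s) = \sum_(j < n) eps c j * hsub h s j.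
Proof.
move=> sn; rewrite -(sum_h_hook h0 c s).
rewrite (big_ord_widen n (fun w => h (s - w) * ((-1) ^+ w * hook c w)) sn) big_mkcond /=.
by apply: eq_bigr => j _; rewrite /hsub ltnS; case: ifP; rewrite ?mulr0 // mulrC.
Qed.

Lemma det_shift_mx n : \det (\matrix_(j < n, s < n) hsub h s j) = 1.
Proof.
rewrite -det_tr det_trig.
  by apply: big1 => i _; rewrite !mxE /hsub leqnn subnn.
apply/is_trig_mxP => i j ij; rewrite !mxE /hsub ifF //; apply/negbTE; lia.
Qed.

(** Modulo the unitriangular shift matrix, the first two rows become rows of signed hooks ([h_eps]
    with offsets c and 1) and the others become unit rows that miss the columns i and i + m + 1, so
    [det_unit_rows2] applies. *)
Lemma det_two_columns (c i m : nat) :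
  \det (\matrix_(r < (i + m).+2, s < (i + m).+2)
    (if r == 0 :> nat then h (c + s)
     else if (r <= i.+1)%N then hsub h (s + 2) r else hsub h s.+1 r)) =
  elem i.+1 * hook c (m + i.+1) - elem (m + i.+1).+1 * hook c i.
Proof.
set n := (i + m)%N.
transitivity (\det ((\matrix_(r < n.+2, s < n.+2)
     (if r == 0 :> nat then eps c s else if r == 1 :> nat then eps 1 s else ((s : nat) == bump i (r - 2))%:R)) *m
     (\matrix_(j < n.+2, s < n.+2) hsub h s j))).
  congr (\det _); apply/matrixP => r s; rewrite !mxE.
  case: (r =P 0%N :> nat) => [r0|r0].
    by rewrite (@h_eps c n.+2) ?ltn_ord //; apply: eq_bigr => j _; rewrite !mxE r0.
  case: (r =P 1%N :> nat) => [r1|r1].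
    rewrite ifT; last by rewrite r1.
    have -> : hsub h (s + 2) r = h (1 + s) by rewrite /hsub r1 ifT; [congr h|]; lia.
    by rewrite (@h_eps 1 n.+2) ?ltn_ord //; apply: eq_bigr => j _; rewrite !mxE r1.
  have lt : (bump i (r - 2) < n.+2)%N by rewrite /bump; have := ltn_ord r; lia.
  rewrite (bigD1 (Ordinal lt)) //= !mxE (introF eqP r0) (introF eqP r1) /= eqxx mul1r big1 ?addr0.
    rewrite /hsub /bump; case: (leqP r i.+1) => ri.
      have -> : (i <= r - 2)%N = false by lia.
      by rewrite add0n (_ : (r - 2 <= s) = (r <= s + 2))%N; [case: ifP => // _; congr h|]; lia.
    have -> : (i <= r - 2)%N by lia.
    by rewrite (_ : (true + (r - 2) <= s) = (r <= s.+1))%N; [case: ifP => // _; congr h|]; lia.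
  move=> j nj; rewrite !mxE (introF eqP r0) (introF eqP r1); case: eqP => [e|]; last by rewrite mul0r.
  by case/eqP: nj; apply/val_inj.
rewrite det_mulmx det_shift_mx mulr1 det_unit_rows2 ?leq_addr //.
have -> : (m + i.+1 = n.+1)%N by rewrite /n; lia.
have e1 k : eps 1 k = (-1) ^+ k * elem k.+1 by [].
rewrite !e1 /eps exprD.
have sq k : (-1) ^+ k * (-1) ^+ k = 1 :> R by rewrite -exprD addnn -signr_odd odd_double.
transitivity (((-1) ^+ n.+1 * (-1) ^+ n.+1) * ((-1) ^+ i * (-1) ^+ i) *
   (hook c n.+1 * elem i.+1 - elem n.+2 * hook c i)); first by ring.
by rewrite !sq; ring.
Qed.

(** Coefficient of t^i in the contribution of one relaxed hyperplane to P in rank [k], for c = |H| +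
    1 - k. The shift by one in the second sequence places its h-convolution in degree 1. *)
Definition pcoef c k i := lower h (fun j => (-1) ^+ j * hook c j)
  (fun j => if j is j'.+1 then (-1) ^+ j' * elem j' else 0) k i.

Lemma sum_h_y n :
  \sum_(i < n.+1) h (n - i) * (if nat_of_ord i is j'.+1 then (-1) ^+ j' * elem j' else 0) = (n == 1)%:R.
Proof.
rewrite big_ord_recl mulr0 add0r; case: n => [|n]; first by rewrite big_ord0.
by rewrite eqSS -(sum_h_elem h0 n); apply: eq_bigr => j _; rewrite /= /bump leq0n add1n subSS.
Qed.

(** Eliminating the tail of the second sequence brings the contribution to the form in which
    [det_skew] evaluates the determinant of the skew shape. *)
Lemma pcoefE c b i : (0 < i)%N -> (i < b)%N ->
  pcoef c (b + i) i =
  (-1) ^+ i * (elem i.-1 * \sum_(j < b.+1 | (i <= j)%N) h (b - j) * eps c j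
     - eps c i * (if i is i'.+2 then hook (b - i.-1) i' else 0)) :> R.
Proof.
move=> i0 ib; pose y j := if j is j'.+1 then (-1) ^+ j' * elem j' else 0 : R.
have yi : (-1) ^+ i * elem i.-1 = - y i.
  by case: i i0 ib => // i _ _ /=; rewrite exprS mulN1r mulNr.
have split (F : nat -> R) : \sum_(j < b.+1 | (i <= j)%N) h (b - j) * F j =
    h (b - i) * F i + \sum_(j < b.+1 | (i < j)%N) h (b - j) * F j.
  rewrite (bigD1 (Ordinal (ltnW ib : i < b.+1)%N)) //=; congr (_ + _); apply: eq_bigl => j.
  by rewrite -val_eqE /=; lia.
(* Since b > 1 the full convolution vanishes, so the tail is minus the head; the head is an
   alternating sum of products of elementary and complete functions, hence a hook. *)
have ytail : \sum_(j < b.+1 | (i <= j)%N) h (b - j) * y j =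
    - ((-1) ^+ i * (if i is i'.+2 then hook (b - i.-1) i' else 0)).
  have : \sum_(j < b.+1) h (b - j) * y j = 0 by rewrite sum_h_y; case: eqP => //; lia.
  rewrite (bigID (fun j : 'I_b.+1 => (i <= j)%N)) /= => /eqP; rewrite addr_eq0 => /eqP ->; congr (- _).
  case: i i0 ib yi {split} => [//|[|i]] _ ib _.
    rewrite mulr0 big1 // => j; rewrite -ltnNge ltnS leqn0 => /eqP -> /=; exact: mulr0.
  rewrite (eq_bigl (fun j : 'I_b.+1 => (j < i.+2)%N)); last by move=> j; rewrite -ltnNge.
  rewrite -(big_ord_widen b.+1 (fun j => h (b - j) * y j)) //; last by lia.
  rewrite big_ord_recl mulr0 add0r /= -(sum_elem_h h (b - i.+1) i) big_distrr /=; apply: eq_bigr => j _.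
  rewrite /bump leq0n add1n /= mulrC !mulrA -exprD; congr (_ * _ * h _); last by have := ltn_ord j; lia.
  rewrite (_ : (i.+2 + (i - j) = j + 2 * (i.+1 - j))%N); last by have := ltn_ord j; lia.
  by rewrite [in RHS]exprD exprM sqrrN !expr1n mulr1.
rewrite /pcoef lowerE.
transitivity (eps c i * \sum_(j < b.+1 | (i < j)%N) h (b - j) * y j
   - y i * \sum_(j < b.+1 | (i < j)%N) h (b - j) * eps c j).
  rewrite !big_distrr -sumrB /=; apply: eq_bigr => j _; rewrite /asym -/(y i) -/(y j) /eps; ring.
rewrite mulrBr !mulrA yi split; move: (split y); rewrite ytail => /eqP; rewrite [X in _ == X]addrC -subr_eq => /eqP <-.
by rewrite /eps; ring.
Qed.

(* column offsets of the Jacobi-Trudi determinant of p_lam / p_mu, with b = k - i *)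
Definition skewcol (i b s : nat) : nat := if s == 0%N then 0%N else if s == i then b else s.+1.

Lemma det_col0 n (M : 'M[R]_n.+1) : (forall r, M r ord0 = (r == ord0)%:R) ->
  \det M = \det (row' ord0 (col' ord0 M)).
Proof.
move=> M0; rewrite (expand_det_col _ ord0) big_ord_recl M0 eqxx mul1r big1 ?addr0.
  by rewrite /cofactor addn0 expr0 mul1r.
by move=> r _; rewrite M0 mul0r.
Qed.

(** Subtracting from the first row the multiples [eps c j], j < i, of the lower rows leaves the
    tails of [sum_h_hook]. These vanish except in at most the last two columns, whose minors are
    determinants of hooks. *)
Lemma det_skew c i b : (0 < i)%N -> (i < b)%N ->
  \det (\matrix_(r < i.+1, s < i.+1)
    (if r == 0 :> nat then h (c + skewcol i b s) else hsub h (skewcol i b s) r.-1)) =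
  (-1) ^+ i * (elem i.-1 * \sum_(j < b.+1 | (i <= j)%N) h (b - j) * eps c j
     - eps c i * (if i is i'.+2 then hook (b - i.-1) i' else 0)) :> R.
Proof.
move=> i0 ib; pose tau n := \sum_(j < n.+1 | (i <= j)%N) h (n - j) * eps c j.
pose X' := \matrix_(r < i.+1, s < i.+1)
    (if r == 0 :> nat then tau (skewcol i b s) else hsub h (skewcol i b s) r.-1) : 'M[R]_i.+1.
have tau_lt n : (n < i)%N -> tau n = 0.
  by move=> ni; rewrite /tau big1 // => j; have := ltn_ord j; lia.
have taui : tau i = eps c i.
  rewrite /tau (bigD1 ord_max) //= subnn h0 mul1r big1 ?addr0 // => j /andP[ij /eqP nj].
  by case: nj; apply/val_inj => /=; have := ltn_ord j; lia.
pose L := \matrix_(r < i.+1, t < i.+1)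
    (if r == 0 :> nat then if t == 0 :> nat then 1 else eps c t.-1 else (r == t)%:R) : 'M[R]_i.+1.
transitivity (\det (L *m X')).
  congr (\det _); apply/matrixP => r s; rewrite !mxE.
  case: (r =P 0%N :> nat) => [r0|r0]; last first.
    rewrite (bigD1 r) //= !mxE (introF eqP r0) eqxx mul1r big1 ?addr0 // => t tr.
    by rewrite !mxE (introF eqP r0) eq_sym (negPf tr) mul0r.
  rewrite big_ord_recl !mxE r0 /= mul1r; set n := skewcol i b s.
  rewrite -(sum_h_hook h0 c n) (bigID (fun j : 'I_n.+1 => (i <= j)%N)) /=; congr (_ + _).
  rewrite (eq_bigr (fun r : 'I_i => eps c r * hsub h n r)); last first.
    by move=> t _; rewrite !mxE r0 /= ?/bump ?leq0n ?add1n /= -?/n.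
  rewrite (eq_bigr (fun j : 'I_n.+1 => eps c j * hsub h n j)); last first.
    by move=> j _; rewrite /hsub -ltnS ltn_ord mulrC.
  rewrite (eq_bigl (fun j : 'I_n.+1 => (j < i)%N)); last by move=> j; rewrite -ltnNge.
  pose F j := eps c j * hsub h n j; pose m := maxn n.+1 i.
  rewrite (big_ord_widen_cond m (fun j => (j < i)%N) F (leq_maxl _ _)).
  rewrite (big_ord_widen m F (leq_maxr _ _)) [LHS]big_mkcond [RHS]big_mkcond /=.
  apply: eq_bigr => j _; rewrite /F; case: (j < i)%N => //=; case: ltnP => // jn.
  by rewrite /hsub ifF ?mulr0 //; apply/negbTE; lia.
rewrite det_mulmx (_ : \det L = 1) ?mul1r; last first.
  rewrite -det_tr det_trig; first by apply: big1 => r _; rewrite !mxE eqxx; case: (nat_of_ord r == 0%N).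
  apply/is_trig_mxP => r t rt; rewrite !mxE ifF; last by apply/negbTE; lia.
  by rewrite -val_eqE /=; case: eqP => //; lia.
rewrite -/(tau b).
(* For i = 1 no column has offset i, so the second term of the formula is absent. *)
case: i i0 ib @tau @X' {L} tau_lt taui => [//|[|i]] _ ib tau X' tau_lt taui.
  rewrite (expand_det_row _ ord0) !big_ord_recr big_ord0 /= add0r !mxE /= tau_lt // mul0r add0r.
  rewrite /cofactor det_mx11 !mxE /= /hsub subnn h0 leq0n. rewrite /= -/(tau b); ring.
rewrite (expand_det_row _ ord0) big_ord_recr big_ord_recr /= big1 ?add0r; last first.
  move=> s _; rewrite !mxE /= /skewcol; case: eqP => [_|s0]; rewrite ?tau_lt ?mul0r //.
  by rewrite ifF ?tau_lt ?mul0r //; have := ltn_ord s; lia.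
rewrite !mxE /= /skewcol /= eqxx ifF; last by lia.
rewrite taui.
have unit0 s : hsub h 0 s = (s == 0)%:R by rewrite /hsub leqn0; case: eqP.
have -> : cofactor X' ord0 ord_max = (-1) ^+ i.+2 * elem i.+1.
  rewrite /cofactor add0n det_col0; last first.
    by move=> r; rewrite !mxE /= bump_lt // /skewcol /= unit0 /bump leq0n add1n.
  congr (_ * _); rewrite -[RHS](det_hook i 1); congr (\det _); apply/matrixP => r s; rewrite !mxE /=.
  have ls := ltn_ord s.
  rewrite !/bump !leq0n !add1n /= /skewcol /= (_ : (i.+1 < s.+1)%N = false); last by lia.
  rewrite add0n (_ : (s.+1 == i.+2) = false); last by lia.
  by case: (r : nat) => [|r'].
have -> : cofactor X' ord0 (widen_ord (leqnSn i.+2) ord_max) = (-1) ^+ i.+1 * hook (b - i.+1) i.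
  rewrite /cofactor add0n det_col0; last first.
    by move=> r; rewrite !mxE /= bump_lt // /skewcol /= unit0 /bump leq0n add1n.
  congr (_ * _); rewrite -[RHS](det_hook_col i (b - i.+1)); congr (\det _); apply/matrixP => r s; rewrite !mxE /=.
  have ls := ltn_ord s; have lr := ltn_ord r.
  rewrite [bump 0 s]/bump ?[bump 0 r]/bump !leq0n !add1n add0n /=.
  case: (s =P i :> nat) => [->|si].
    rewrite bump_ge // /skewcol /= eqxx /hsub (_ : (r.+1 <= b)%N = true); last by lia.
    by congr h; move: ib lr; set r0 := nat_of_ord r => ib lr; lia.
  have {}ls : (nat_of_ord s <= i)%N := ls.
  move: (nat_of_ord s) (nat_of_ord r) ls si => s0 r0 ls si.
  rewrite bump_lt; last by lia.
  by rewrite /skewcol /= (_ : (s0.+1 == i.+2) = false) //; lia.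
rewrite [(-1) ^+ i.+2]exprS /=; ring.
Qed.
End HookDet.

Lemma hsub_eq (R : nzRingType) (h : nat -> R) a b a' b' :
  (a + b' = a' + b)%N -> hsub h a b = hsub h a' b'.
Proof.
move=> e; rewrite /hsub (_ : (b <= a)%N = (b' <= a')%N); last by lia.
by case: ifP => // ?; congr h; lia.
Qed.

Lemma hsub_h (R : nzRingType) (h : nat -> R) a b c : (a = c + b)%N -> hsub h a b = h c.
Proof. by move=> ->; rewrite /hsub leq_addl addnK. Qed.

Lemma eq_det (R : pzRingType) n (A B : 'M[R]_n) :
  (forall r t, A r t = B r t) -> \det A = \det B.
Proof. by move=> /matrixP->. Qed.

(** * Jacobi-Trudi characters as determinants in the convolution algebra *)

Section ZSet.
Variables (T : finType) (K : comNzRingType).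

Definition zset (S : {set T}) : setalg T K := [ffun A : {set T} => (A == S)%:R].

Lemma hsub_hset (st : pred {set T}) a b :
  hsub (hset K st) a b = \sum_(S : {set T} | st S && (#|S| + b == a)%N) zset S.
Proof.
apply/ffunP => A; rewrite sa_sumE.
transitivity ((st A && (#|A| + b == a)%N)%:R : K).
  rewrite /hsub; case: leqP => ba; rewrite ffunE.
    by congr ((nat_of_bool (_ && _))%:R); lia.
  by rewrite (_ : (_ == a)%N = false) ?andbF //; lia.
rewrite big_mkcond (bigD1 A) //= big1 ?addr0.
  by case: ifP => _; rewrite ?ffunE ?eqxx.
by move=> S nS; case: ifP => // _; rewrite ffunE eq_sym (negPf nS).
Qed.

(** Counting memberships expresses at once that the sets are disjoint and that their union is
    [A]. *)
Lemma zset_prod (I : eqType) (r : seq I) (X : I -> {set T}) (A : {set T}) :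
  (\prod_(i <- r) zset (X i)) A = [forall x, count (fun i => x \in X i) r == (x \in A)]%:R.
Proof.
elim: r A => [|i r IH] A.
  rewrite big_nil sa_oneE; congr ((nat_of_bool _)%:R); apply/eqP/forallP => [-> x|a]; first by rewrite inE.
  by apply/setP => x; have := a x; rewrite /= inE; case: (x \in A).
rewrite big_cons sa_mulE big_mkcond (bigD1 (X i)) //= [X in _ + X]big1 ?addr0; last first.
  by move=> S nS /=; case: (S \subset A) => //; rewrite ffunE (negPf nS) mul0r.
rewrite ffunE eqxx mul1r IH; case: (boolP (X i \subset A)) => s.
  congr ((nat_of_bool _)%:R); apply: eq_forallb => x; rewrite inE /=.
  by case: (boolP (x \in X i)) => [xi|_] /=; rewrite ?(subsetP s x xi) ?add0n.
symmetry; rewrite (_ : [forall x, _] = false) //; apply/negbTE/forallPn.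
have /subsetPn[x xi xA] := s; exists x; by rewrite /= xi (negPf xA) add1n.
Qed.
End ZSet.

Definition stabp (T : finType) (s : {perm T}) : pred {set T} := fun A => s @: A == A.

Section JTDet.
Variables (n N : nat).
Implicit Types (g k : 'I_N -> nat) (s : {perm 'I_n}).

(** Expanded into point masses, the product at the full set counts ordered partitions into
    [s]-stable classes of sizes g - k, which are the colour classes of the invariant colourings. *)
Lemma ncol_prod g k s :
  (\prod_i hsub (hset algC (stabp s)) (g i) (k i)) [set: 'I_n] = (ncol g k s)%:R.
Proof.
under eq_bigr do rewrite hsub_hset.
rewrite (bigA_distr_big_dep _ (fun i (S : {set 'I_n}) => zset algC S)) /= sa_sumE.
under eq_bigr do rewrite zset_prod.
rewrite /ncol -sum1_card natr_sum.
pose fib (F : {ffun 'I_n -> 'I_N}) : {ffun 'I_N -> {set 'I_n}} := [ffun i => [set x | F x == i]].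
have fib_inj : injective fib.
  move=> F F' /ffunP e; apply/ffunP => x; have := e (F x); rewrite !ffunE => /setP/(_ x).
  by rewrite !inE eqxx => /esym/eqP.
rewrite -(big_imset (h := fib) (fun=> 1)) /=; last by move=> F F' _ _; exact: fib_inj.
rewrite big_mkcond [RHS]big_mkcond /=; apply: eq_bigr => X _.
case: (boolP (X \in fib @: _)) => [/imsetP[F]|nX].
  rewrite inE => /andP[/forallP iv /forallP c] eX; rewrite ifT; last first.
    apply/familyP => i; rewrite unfold_in eX ffunE; apply/andP; split; last exact: c.
    rewrite /stabp eqEcard card_imset ?leqnn ?andbT; last exact: perm_inj.
    by apply/subsetP => y /imsetP[x]; rewrite !inE => /eqP <- ->; apply: iv.
  rewrite (_ : [forall x, _] = true) //; apply/forallP => x; rewrite inE.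
  rewrite (eq_count (a2 := pred1 (F x))); last by move=> i; rewrite eX ffunE inE eq_sym.
  by rewrite count_uniq_mem ?index_enum_uniq // mem_index_enum.
case: ifP => // /familyP Q; rewrite (_ : [forall x, _] = false) //; apply/negbTE; apply: contra nX => /forallP c.
have cx x : exists i, x \in X i.
  by have := c x; rewrite inE => /eqP e; have /hasP[i _ ?] : has (fun i => x \in X i) (index_enum 'I_N) by [rewrite has_count e]; exists i.
have cu x i j : x \in X i -> x \in X j -> i = j.
  move=> xi xj; apply/eqP; apply/negPn/negP => ij; have := c x; rewrite inE => /eqP.
  have -> : count (fun i => x \in X i) (index_enum 'I_N) = #|[set i | x \in X i]|.
    by rewrite -sum1_count sum1dep_card.
  move=> e; have : (#|[set i; j]| <= #|[set i | x \in X i]|)%N.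
    by apply: subset_leq_card; apply/subsetP=> z; rewrite !inE => /orP[] /eqP ->.
  by rewrite cards2 ij e.
pose F : {ffun 'I_n -> 'I_N} := [ffun x => xchoose (cx x)].
have FX x i : (F x == i) = (x \in X i).
  rewrite ffunE; have xF := xchooseP (cx x); apply/eqP/idP => [<- //|xi]; exact: cu xF xi.
have eX : X = fib F by apply/ffunP => i; apply/setP => x; rewrite ffunE inE FX.
apply/imsetP; exists F => //; rewrite inE; apply/andP; split.
  apply/forallP => x; rewrite FX; have := Q (F x); rewrite unfold_in => /andP[/eqP <- _].
  by rewrite imset_f // -FX.
apply/forallP => i; have := Q i; rewrite unfold_in => /andP[_].
by rewrite /cnt {1}eX ffunE.
Qed.

Lemma jt_det g k s :
  jt g k s = (\det (\matrix_(i, j) hsub (hset algC (stabp s)) (g i) (k j))) [set: 'I_n].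
Proof.
rewrite /jt /determinant sa_sumE; apply: eq_bigr => w _; rewrite sa_signE; congr (_ * _).
by rewrite -ncol_prod; congr (fun_of_fin _ _); apply: eq_bigr => i _; rewrite mxE.
Qed.
End JTDet.

Section Shapes.
Variables (n : nat) (s : {perm 'I_n}).
Let hs := hset algC (stabp s).

Lemma hs0 : hs 0 = 1.
Proof. by apply: hset0; rewrite /stabp imset0. Qed.

Definition twocol c i m := (c :: nseq i 2 ++ nseq m 1)%N.

Lemma nth_twocol c i m r : nth 0%N (twocol c i m) r =
  if r == 0%N then c else if (r <= i)%N then 2%N else if (r <= i + m)%N then 1%N else 0%N.
Proof.
case: r => [|r] //=; rewrite nth_cat size_nseq !nth_nseq.
by case: ltnP => // ir; rewrite ltn_subLR.
Qed.

Lemma Specht_twocol c i m : sumn (twocol c i m) = n -> ((0 < i) ==> (1 < c))%N -> (0 < c)%N ->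
  Specht n (twocol c i m) s =
  (if i is i'.+1 then elem hs i'.+1 * hook hs c (m + i'.+1) - elem hs (m + i'.+1).+1 * hook hs c i'
   else hook hs c m) [set: 'I_n].
Proof.
move=> e ic c0.
have so : sorted geq (twocol c i m).
  apply/(sortedP 0%N) => r _; rewrite !nth_twocol /=.
  by move: ic c0; case: r => [|r] /=; do ?case: ifP => /=; lia.
have sz : size (twocol c i m) = (i + m).+1 by rewrite /= size_cat !size_nseq.
rewrite (Specht_Vcf so e (N := (i + m).+1)) ?sz // VcfE jt_det; apply: (congr1 (fun f : setalg 'I_n algC => f [set: 'I_n])).
case: i {so sz} ic e => [|i] ic e.
  rewrite -(det_hook hs0); apply: (@eq_det _ m.+1) => r t; rewrite !mxE /lamdelta nth_twocol /stair.
  have lr : (r < m.+1)%N := ltn_ord r; have lt : (t < m.+1)%N := ltn_ord t.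
  move: (nat_of_ord r) (nat_of_ord t) lr lt => {r t} r t lr lt; rewrite ?add0n.
  case: eqP => [->|r0]; first by apply: hsub_h; lia.
  by rewrite ifF ?ifT; [apply: hsub_eq|..]; lia.
rewrite -(det_two_columns hs0); apply: (@eq_det _ (i + m).+2) => r t; rewrite !mxE /lamdelta nth_twocol /stair.
have lr : (r < (i + m).+2)%N := ltn_ord r; have lt : (t < (i + m).+2)%N := ltn_ord t.
move: (nat_of_ord r) (nat_of_ord t) lr lt => {r t} r t lr lt; rewrite ?addSn.
case: eqP => [->|r0]; first by apply: hsub_h; lia.
case: ifP => ri; first by apply: hsub_eq; lia.
by rewrite ifT; [apply: hsub_eq|..]; lia.
Qed.

(** Coefficient of t^i in the contribution of one relaxed hyperplane to Q in rank [k]; it arises in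
    [sum_Urelax]. *)
Definition qcoef (R : comNzRingType) (h : nat -> R) c k i :=
  elem h i * hook h c (k - i.+1) - (if i is i'.+1 then elem h i' * hook h c (k - i) else 0).

(** Each shape yields a difference of two products. Once the hook recurrence brings both to
    comparable arms, everything outside [qcoef] cancels. *)
Lemma Specht_qcoef k i : (k <= n)%N -> (i.*2 < k)%N ->
  ((if i == 0%N then 0 else Specht n (q_lam1 k n i)) +
   (if (0 < i)%N && (k == n) then 0 else Specht n (q_lam2 k n i))) s =
  qcoef hs (n - k + 1) k i [set: 'I_n].
Proof.
move=> kn ik; set c := (n - k + 1)%N.
have sums a j m : sumn (twocol a j m) = (a + (j.*2 + m))%N.
  by rewrite /= sumn_cat !sumn_nseq mul1n mul2n.
have E2 : (if (0 < i)%N && (k == n) then 0 else Specht n (q_lam2 k n i)) s =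
   (elem hs i * hook hs c (k - i.+1) - (if i is i'.+1 then elem hs (k - i) * hook hs c i' else 0)) [set: 'I_n].
  case: i ik => [|i] ik /=.
    rewrite -[q_lam2 _ _ _]/(twocol (n - k + 1) 0 (k - 0 - 1)) Specht_twocol ?sums //; try lia.
    by rewrite mul1r subr0 subn0.
  (* In the excluded case k = n one has c = 1; [hook hs 1] is elementary, so the two products agree
     and the formula gives 0, in line with the convention. *)
  case: eqP => [e|ne].
    rewrite cfunE (_ : (k - i.+1 = (k - i.+2).+1)%N); last by lia.
    rewrite (_ : c = 1%N) /=; last by rewrite /c e subnn.
    by rewrite [X in X - _]mulrC subrr sa_zeroE.
  rewrite -[q_lam2 _ _ _]/(twocol (n - k + 1) i.+1 (k - i.+1.*2 - 1)) Specht_twocol ?sums; try lia.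
  apply: (congr1 (fun f : setalg 'I_n algC => f [set: 'I_n])).
  by congr (_ * hook _ _ _ - elem _ _ * _); lia.
rewrite cfunE E2; case: i ik {E2} => [|i] ik.
  by rewrite cfunE add0r.
rewrite /= -[q_lam1 _ _ _]/(twocol (n - k + 2) i (k - i.+1.*2)) Specht_twocol ?sums; try lia.
rewrite -sa_addE; apply: (congr1 (fun f : setalg 'I_n algC => f [set: 'I_n])).
have -> : (n - k + 2 = c.+1)%N by rewrite /c; lia.
have -> : (k - i.+1 = (k - i.+2).+1)%N by lia.
rewrite /qcoef (_ : (k - i.+1 = (k - i.+2).+1)%N); last by lia.
case: i ik => [|i] ik.
  by rewrite hookS /=; have -> : (k - 2 = k - 1.*2)%N by []; ring.
rewrite [hook hs c (k - i.+3).+1]hookS [hook hs c i.+1]hookS.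
have -> : (k - i.+2.*2 + i.+1 = k - i.+3)%N by lia.
by rewrite -[hook hs 1 i.+1]/(elem hs i.+2); ring.
Qed.

Lemma skewSpecht_pcoef k i : (k <= n)%N -> (0 < i)%N -> (i.*2 < k)%N ->
  skewSpecht n (p_lam k n i) (p_mu k n i) s = pcoef hs (n - k + 1) k i [set: 'I_n].
Proof.
move=> kn i0 ik; set c := (n - k + 1)%N.
have nl r : nth 0%N (p_lam k n i) r = if r == 0%N then (n - i.*2 + 1)%N else if (r <= i)%N then (k - i.*2 + 1)%N else 0%N.
  by case: r => [|r] //=; rewrite nth_nseq.
have nm r : nth 0%N (p_mu k n i) r = if r == 0%N then (k - i.*2)%N else if (r < i)%N then (k - i.*2 - 1)%N else 0%N.
  by case: r => [|r] //=; rewrite nth_nseq; case: (i) i0.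
rewrite (@skewSpecht_jt n i.+1); last 1 first.
- by rewrite /= size_nseq; lia.
- rewrite jt_det [X in pcoef _ _ X _](_ : k = (k - i) + i)%N; last by lia.
  rewrite (pcoefE hs0) -?(det_skew hs0); try lia.
  apply: (congr1 (fun f : setalg 'I_n algC => f [set: 'I_n])); apply: eq_det => r t; rewrite !mxE /lamdelta nl nm /skewcol /stair.
  have lr : (r < i.+1)%N := ltn_ord r; have lt : (t < i.+1)%N := ltn_ord t.
  move: (nat_of_ord r) (nat_of_ord t) lr lt => {r t} r t lr lt.
  case: eqP => [->|r0]; case: eqP => [->|t0]; rewrite /c.
  + by apply: hsub_h; lia.
  + case: eqP => [ti|ti]; first by rewrite ti ltnn; apply: hsub_h; lia.
    by rewrite ifT; [apply: hsub_h|]; lia.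
  + by rewrite ifT; [apply: hsub_eq|]; lia.
  + rewrite (_ : (r <= i)%N = true); last by lia.
    case: eqP => [ti|ti]; first by rewrite ti ltnn; apply: hsub_eq; lia.
    by rewrite ifT; [apply: hsub_eq|]; lia.
- apply/(sortedP 0%N) => r _; rewrite !nl /=; case: r => [|r] /=; do ?case: ifP => /=; lia.
- apply/(sortedP 0%N) => r _; rewrite !nm /=; case: r => [|r] /=; do ?case: ifP => /=; lia.
- by rewrite /= !sumn_nseq; nia.
- by rewrite /= size_nseq.
Qed.
End Shapes.

(** * Group actions and induced characters *)

Section Images.
Variables (E : finType) (f : E -> E).
Hypothesis injf : injective f.
Implicit Types (A S X : {set E}) (Bs : {set {set E}}).
Local Notation img := (fun A : {set E} => f @: A).

Lemma imset_injD A S : f @: (A :\: S) = f @: A :\: f @: S.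
Proof.
apply/setP => x; rewrite inE; apply/imsetP/andP => [[y]|[nx /imsetP[y yA e]]].
  rewrite inE => /andP[yS yA] ->; split; last exact: imset_f.
  by apply: contra yS => /imsetP[z zS /injf ->].
by exists y => //; rewrite inE yA andbT; apply: contra nx; rewrite e; apply: imset_f.
Qed.

Lemma rk_img Bs X : rk (img @: Bs) (f @: X) = rk Bs X.
Proof.
have e (B : {set E}) : #|f @: X :&: f @: B| = #|X :&: B| by rewrite -imsetI ?card_imset // => x y _ _; apply: injf.
apply/eqP; rewrite eqn_leq; apply/andP; split; apply: rk_le.
  by move=> _ /imsetP[B b ->]; rewrite e rk_ge.
by move=> B b; rewrite -e rk_ge // imset_f.
Qed.

Lemma contr_img Bs S : contrB (img @: Bs) (f @: S) = img @: contrB Bs S.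
Proof.
have e (B : {set E}) : #|f @: S :&: f @: B| = #|S :&: B| by rewrite -imsetI ?card_imset // => x y _ _; apply: injf.
apply/setP => X; apply/mem_contr/imsetP; rewrite rk_img.
  move=> [_ [/imsetP[B b ->]]]; rewrite e => c ->; exists (B :\: S); last by rewrite imset_injD.
  by apply/mem_contr; exists B.
by move=> [Y /mem_contr[B [b c ->]] ->]; exists (f @: B); rewrite e imset_injD; split=> //; apply: imset_f.
Qed.

Lemma restr_img Bs S : restrB (img @: Bs) (f @: S) = img @: restrB Bs S.
Proof.
have i (B : {set E}) : f @: S :&: f @: B = f @: (S :&: B) by rewrite imsetI // => x y _ _; apply: injf.
have e (B : {set E}) : #|f @: S :&: f @: B| = #|S :&: B| by rewrite i card_imset.
apply/setP => X; apply/mem_restr/imsetP; rewrite rk_img.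
  move=> [_ [/imsetP[B b ->]]]; rewrite e => c ->; exists (S :&: B); last by rewrite i.
  by apply/mem_restr; exists B.
by move=> [Y /mem_restr[B [b c ->]] ->]; exists (f @: B); rewrite e i; split=> //; apply: imset_f.
Qed.
End Images.

Lemma contr_set0 (E : finType) (Bs : {set {set E}}) : contrB Bs set0 = Bs.
Proof.
have r0 : rk Bs set0 = 0%N.
  by apply/eqP; rewrite -leqn0; apply: rk_le => B _; rewrite set0I cards0.
apply/setP => X; apply/mem_contr/idP => [[B [b _ ->]]|x]; first by rewrite setD0.
by exists X; rewrite set0I cards0 setD0.
Qed.

Lemma rk_set0 (E : finType) (Bs : {set {set E}}) : rk Bs set0 = 0%N.
Proof. by apply/eqP; rewrite -leqn0; apply: rk_le => B _; rewrite set0I cards0. Qed.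

Lemma restr_full (E : finType) (A : {set E}) (Bs : {set {set E}}) : is_matroid A Bs -> restrB Bs A = Bs.
Proof.
move=> m; have e B : B \in Bs -> A :&: B = B by move=> b; apply/setIidPr/(mat_sub m).
apply/setP => X; apply/mem_restr/idP => [[B [b _ ->]]|x]; first by rewrite e.
by exists X; rewrite e // (rk_full m x).
Qed.

Section Act.
Variables (E : finType) (gT : finGroupType) (to : {action gT &-> E}).
Implicit Types (A S X : {set E}) (Bs : {set {set E}}) (G K : {group gT}) (g w : gT).

Definition actF Bs w : {set {set E}} := (fun A : {set E} => setact to A w) @: Bs.

Lemma memN G S g : (g \in 'N_G(S | to)%g) = (g \in G) && (setact to S g == S).
Proof. by rewrite inE -astab1_set; congr (_ && _); apply/astab1P/eqP. Qed.

Lemma sact1 S : setact to S 1%g = S. Proof. exact: (act1 (set_action to)). Qed.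
Lemma sactM S g w : setact to S (g * w)%g = setact to (setact to S g) w.
Proof. exact: (actM (set_action to)). Qed.
Lemma sactK g : cancel (setact to ^~ g) (setact to ^~ g^-1%g).
Proof. exact: (actK (set_action to)). Qed.
Lemma sactKV g : cancel (setact to ^~ g^-1%g) (setact to ^~ g).
Proof. exact: (actKV (set_action to)). Qed.
Lemma sact_conj S g w : setact to (setact to S w) (g ^ w)%g = setact to (setact to S g) w.
Proof. by rewrite -!sactM conjgE mulKVg. Qed.

Lemma fix_conj S g w : (setact to (setact to S w) (g ^ w)%g == setact to S w) = (setact to S g == S).
Proof. by rewrite sact_conj (inj_eq (can_inj (sactK w))). Qed.

Lemma actF_inv G Bs w : preserves to G Bs -> w \in G -> actF Bs w = Bs.
Proof.
move=> /forall_inP p wG; have /forallP pw := p _ wG; apply/setP => X; apply/imsetP/idP => [[B b ->]|x].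
  by rewrite (eqP (pw B)).
exists (setact to X w^-1%g); last by rewrite sactKV.
by rewrite -(eqP (pw _)) sactKV.
Qed.

Lemma preservesI G Bs : (forall w, w \in G -> actF Bs w = Bs) -> preserves to G Bs.
Proof.
move=> p; apply/forall_inP => w wG; apply/forallP => B; apply/eqP; apply/idP/idP => [h|b].
  by have := p _ wG => /setP/(_ (setact to B w)); rewrite h => /imsetP[B' b' /(can_inj (sactK w)) ->].
by rewrite -(p _ wG); apply: (imset_f (fun A : {set E} => setact to A w) b).
Qed.

Lemma actsI G A : (forall w, w \in G -> setact to A w = A) -> [acts G, on A | to].
Proof.
by move=> h; apply/subsetP => w wG; rewrite -astab1_set; apply/astab1P/h.
Qed.

Lemma acts_fix G A w : [acts G, on A | to] -> w \in G -> setact to A w = A.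
Proof. by move=> /subsetP h /h; apply: astabs_setact. Qed.

Lemma injw w : injective (to ^~ w). Proof. exact: act_inj. Qed.

Lemma sactD A S w : setact to (A :\: S) w = setact to A w :\: setact to S w.
Proof. exact: (imset_injD (@injw w)). Qed.
Lemma rk_act Bs S w : rk (actF Bs w) (setact to S w) = rk Bs S.
Proof. exact: (rk_img (@injw w)). Qed.
Lemma contr_act Bs S w : contrB (actF Bs w) (setact to S w) = actF (contrB Bs S) w.
Proof. exact: (contr_img (@injw w)). Qed.
Lemma restr_act Bs S w : restrB (actF Bs w) (setact to S w) = actF (restrB Bs S) w.
Proof. exact: (restr_img (@injw w)). Qed.

Lemma adm_mat A Bs G : admissible to A Bs G -> is_matroid A Bs. Proof. by case/and3P. Qed.
Lemma adm_act A Bs G w : admissible to A Bs G -> w \in G -> setact to A w = A.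
Proof. by case/and3P => _ a _; apply: acts_fix. Qed.
Lemma adm_actF A Bs G w : admissible to A Bs G -> w \in G -> actF Bs w = Bs.
Proof. by case/and3P => _ _ p; apply: actF_inv. Qed.

Lemma admI A Bs G : is_matroid A Bs -> (forall w, w \in G -> setact to A w = A) ->
  (forall w, w \in G -> actF Bs w = Bs) -> admissible to A Bs G.
Proof. by move=> m a p; apply/and3P; split; [|apply: actsI|apply: preservesI]. Qed.

Lemma adm_contr A Bs G S : admissible to A Bs G -> admissible to (A :\: S) (contrB Bs S) 'N_G(S | to)%G.
Proof.
move=> a; apply: admI; first exact/contr_matroid/(adm_mat a).
  by move=> w; rewrite memN => /andP[wG /eqP e]; rewrite sactD e (adm_act a).
by move=> w; rewrite memN => /andP[wG /eqP e]; rewrite -contr_act e (adm_actF a).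
Qed.

Lemma adm_restr A Bs G S : admissible to A Bs G -> admissible to S (restrB Bs S) 'N_G(S | to)%G.
Proof.
move=> a; apply: admI; first exact/restr_matroid/(adm_mat a).
  by move=> w; rewrite memN => /andP[wG /eqP e].
by move=> w; rewrite memN => /andP[wG /eqP e]; rewrite -restr_act e (adm_actF a).
Qed.

Lemma adm_sub A Bs G K : K \subset G -> admissible to A Bs G -> admissible to A Bs K.
Proof.
move=> /subsetP s a; apply: admI; first exact: (adm_mat a).
  by move=> w /s; apply: adm_act a.
by move=> w /s; apply: adm_actF a.
Qed.

(** [psi] extends the character of the stabilizer to pairs of a set and an element, invariantly
    under conjugation. Each set of the orbit is reached by as many group elements as the stabilizer
    has, which cancels the normalization of induction, and only sets fixed by [g] contribute. *)
Lemma cfInd_stab G S0 (phi : 'CF('N_G(S0 | to))) (psi : {set E} -> gT -> algC) g :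
  (forall x, x \in 'N_G(S0 | to)%g -> phi x = psi S0 x) ->
  (forall x w, x \in 'N_G(S0 | to)%g -> w \in G -> psi (setact to S0 w) (x ^ w)%g = psi S0 x) ->
  g \in G ->
  'Ind[G] phi g = \sum_(S in orbit (set_action to) G S0 | setact to S g == S) psi S g.
Proof.
move=> ephi eq gG; rewrite cfIndE ?subsetIl //.
have -> : \sum_(y in G) phi (g ^ y)%g =
   \sum_(y in G) (if setact to (setact to S0 y) g == setact to S0 y then psi (setact to S0 y) g else 0).
  rewrite (reindex_inj invg_inj) /=; apply: eq_big => [y|y yG]; first by rewrite groupV.
  rewrite groupV in yG.
  have fe : (setact to S0 (g ^ y^-1)%g == S0) = (setact to (setact to S0 y) g == setact to S0 y).
    by rewrite -(fix_conj S0 (g ^ y^-1)%g y) conjgKV.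
  case: ifP => f.
    have N : (g ^ y^-1)%g \in 'N_G(S0 | to)%g by rewrite memN fe f groupJ ?groupV.
    by rewrite ephi // -(eq _ y N yG) conjgKV.
  by rewrite cfun0 // memN fe f andbF.
rewrite (partition_big (fun y => setact to S0 y) (mem (orbit (set_action to) G S0))) /=; last first.
  by move=> y yG; apply: (mem_orbit (set_action to)).
rewrite big_distrr /= [RHS]big_mkcondr /=; apply: eq_bigr => S /orbitP[a aG eS].
rewrite (eq_bigr (fun=> if setact to S g == S then psi S g else 0)); last by move=> y /andP[_ /eqP ->].
rewrite sumr_const (_ : #|_| = #|'N_G(S0 | to)%g|).
  by rewrite -[_ *+ #|_|]mulr_natl mulKf // pnatr_eq0 -lt0n cardG_gt0.
have <- : #|amove (set_action to) G S0 S| = #|'N_G(S0 | to)%g|.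
  by rewrite -eS amove_act ?subsetT //; rewrite -astab1_set; apply: card_rcoset.
by apply: eq_card => y; rewrite !inE.
Qed.

(** The orbits of the chosen representatives together make up all subsets of [A], so the choice of
    transversal drops out. *)
Lemma sum_Ind A G (phi : forall S, 'CF('N_G(S | to))) (psi : {set E} -> gT -> algC) g :
  [acts G, on A | to] ->
  (forall S x, S \subset A -> x \in 'N_G(S | to)%g -> phi S x = psi S x) ->
  (forall S x w, S \subset A -> x \in 'N_G(S | to)%g -> w \in G -> psi (setact to S w) (x ^ w)%g = psi S x) ->
  g \in G ->
  \sum_(S in orbit_transversal (to^*)%act G (powerset A)) 'Ind[G] (phi S) g =
  \sum_(S : {set E} | (S \subset A) && (setact to S g == S)) psi S g.
Proof.
move=> aA ephi eq gG.
have acts : [acts G, on powerset A | set_action to].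
  apply/actsP => w wG S; rewrite !inE /=.
  rewrite -{1}(acts_fix aA wG); apply/idP/idP => [|s]; last exact: imsetS.
  move=> s; have := imsetS (to ^~ w^-1%g) s; rewrite -/(setact to _ _) -/(setact to (setact to A w) _).
  by rewrite !sactK.
have [tr sX inj ex] := orbit_transversalP acts.
set X := orbit_transversal _ _ _ in tr sX inj ex *.
rewrite (eq_bigr (fun S => \sum_(S' in orbit (set_action to) G S | setact to S' g == S') psi S' g)); last first.
  move=> S SX; have := subsetP sX _ SX; rewrite inE => sA.
  by apply: cfInd_stab => // [x|x w]; [apply: ephi|apply: eq].
under eq_bigr do rewrite big_mkcondr /=.
rewrite [RHS]big_mkcondr /= [RHS](eq_bigl (mem (powerset A))); last by move=> S; rewrite /= inE.
rewrite (set_partition_big _ (orbit_partition acts)) /=.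
have -> : orbit (set_action to) G @: powerset A = orbit (set_action to) G @: X.
  apply/setP => O; apply/imsetP/imsetP => [[S sS ->]|[S SX ->]]; last by exists S => //; apply: (subsetP sX).
  have [a aG aX] := ex _ sS; exists (set_action to S a) => //; apply/eqP; rewrite eq_sym.
  by apply/eqP/orbit_eqP/mem_orbit.
rewrite [RHS]big_imset //= => S S' SX S'X e; apply/eqP; rewrite -inj // e; apply: orbit_refl.
Qed.
End Act.

(** * Values of P, Z and Q at one group element *)

Section KLValues.
Variables (E : finType) (gT : finGroupType) (to : {action gT &-> E}).
Variables (P Z Q : polyfam E gT).
Hypotheses (hPZ : is_KL_system to P Z) (hQ : is_invKL to P Q).
Implicit Types (A S X : {set E}) (Bs : {set {set E}}) (G K : {group gT}) (g w : gT).

Lemma coef_map_Ind G S (p : {poly 'CF('N_G(S | to))}) i :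
  (map_poly (@cfInd gT G 'N_G(S | to)) p)`_i = 'Ind[G] p`_i.
Proof. by rewrite coef_map_id0 // linear0. Qed.

Lemma fam_group (F : polyfam E gT) A Bs G K i g : G = K :> {set gT} ->
  (F A Bs G)`_i g = (F A Bs K)`_i g.
Proof. by move=> e; have -> : G = K by apply/val_inj. Qed.

Lemma coef_sign_mul (R : nzRingType) n (p : {poly R}) i : ((-1) ^+ n * p)`_i = (-1) ^+ n * p`_i.
Proof.
rewrite -signr_odd -[X in _ = X * _]signr_odd.
by case: odd; rewrite /= ?expr0 ?expr1 ?mul1r ?mulN1r ?coefN.
Qed.

Lemma cfun_sign_mul G n (phi : 'CF(G)) g : ((-1) ^+ n * phi) g = (-1) ^+ n * phi g.
Proof.
rewrite -signr_odd -[X in _ = X * _]signr_odd.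
by case: odd; rewrite /= ?expr0 ?expr1 ?mul1r ?mulN1r ?cfunE.
Qed.

Definition shiftc (c : nat -> algC) (r i : nat) : algC := if (r <= i)%N then c (i - r)%N else 0.

(** The terms of Z with nonempty S; the term of the empty set is P itself. *)
Definition restP A Bs G g i : algC :=
  \sum_(S : {set E} | [&& S \subset A, S != set0 & setact to S g == S])
    shiftc (fun j => (P (A :\: S) (contrB Bs S) 'N_G(S | to)%G)`_j g) (rk Bs S) i.

(** The groups are related only by containing [g] and its conjugate. With w = 1 this is independence
    of the group; with [w] in the group it is the conjugation invariance that [sum_Ind] asks for.
    Both follow from a single induction on the size of the ground set. *)
Definition equivP n := forall A Bs G A' Bs' G' g w i, (#|A| < n)%N ->
  admissible to A Bs G -> admissible to A' Bs' G' -> A' = setact to A w -> Bs' = actF to Bs w ->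
  g \in G -> (g ^ w)%g \in G' -> (P A Bs G)`_i g = (P A' Bs' G')`_i (g ^ w)%g.

Lemma stab_set0 G : 'N_G(set0 | to)%G = G :> {set gT}.
Proof.
by apply/setP => g; rewrite memN /setact imset0 eqxx andbT.
Qed.

Lemma stab_full A Bs G : admissible to A Bs G -> 'N_G(A | to)%G = G :> {set gT}.
Proof.
by move=> a; apply/setP => g; rewrite memN; case: (boolP (g \in G)) => //= gG; rewrite (adm_act a) ?eqxx.
Qed.

Lemma N_conj G S g w : g \in 'N_G(S | to)%g -> w \in G -> (g ^ w)%g \in 'N_G(setact to S w | to)%g.
Proof. by rewrite !memN => /andP[gG /eqP e] wG; rewrite groupJ // fix_conj e eqxx. Qed.

Lemma ZvalE A Bs G g i : equivP #|A| -> admissible to A Bs G -> g \in G ->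
  (Z A Bs G)`_i g = (P A Bs G)`_i g + restP A Bs G g i.
Proof.
move=> IH a gG; have [_ _ _ ->] := hPZ a; rewrite coef_sum sum_cfunE.
pose psi S x := shiftc (fun j => (P (A :\: S) (contrB Bs S) 'N_G(S | to)%G)`_j x) (rk Bs S) i.
pose phi S : 'CF('N_G(S | to)) := if (rk Bs S <= i)%N
   then (P (A :\: S) (contrB Bs S) 'N_G(S | to)%G)`_(i - rk Bs S) else 0.
rewrite (eq_bigr (fun S => 'Ind[G] (phi S) g)); last first.
  move=> S _; rewrite coefXnM /phi ltnNge; case: leqP => h /=; first by rewrite coef_map_Ind.
  by rewrite linear0.
rewrite (@sum_Ind _ _ to A G phi psi) //; first last.
- move=> S x w sS xN wG; rewrite /psi /shiftc.
  have rkw : rk Bs (setact to S w) = rk Bs S by rewrite -{1}(adm_actF a wG) rk_act.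
  rewrite rkw; case: ifP => // _.
  have [->|nS] := eqVneq S set0.
    rewrite (_ : setact to set0 w = set0); last by rewrite /setact imset0.
    by rewrite cfunJ // memN wG /setact imset0 eqxx.
  symmetry; apply: IH.
  + apply: proper_card; apply/properP; split; first exact: subsetDl.
    by have /set0Pn[x0 xS] := nS; exists x0; rewrite ?inE ?xS // (subsetP sS).
  + exact: adm_contr.
  + exact: adm_contr.
  + by rewrite sactD (adm_act a wG).
  + by rewrite -contr_act (adm_actF a wG).
  + by [].
  + exact: N_conj.
- by move=> S x sS xN; rewrite /phi /psi /shiftc; case: ifP => // _; rewrite cfunE.
- by case/and3P: a.
rewrite (bigD1 set0) /=; last by rewrite sub0set /setact imset0 eqxx.
congr (_ + _); last by apply: eq_bigl => S; rewrite -andbA; congr (_ && _); rewrite andbC.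
rewrite /psi /shiftc rk_set0 leq0n subn0 setD0 contr_set0.
exact/fam_group/stab_set0.
Qed.

(** Palindromicity compares the coefficients of Z in degrees i and rk - i, and the degree bound
    kills P in the higher one. So P is determined by the contractions by nonempty sets. *)
Lemma PvalE A Bs G g i : equivP #|A| -> admissible to A Bs G -> g \in G -> A != set0 -> (i.*2 < rk Bs A)%N ->
  (P A Bs G)`_i g = restP A Bs G g (rk Bs A - i) - restP A Bs G g i.
Proof.
move=> IH a gG nA ir; have [_ /(_ nA) d z _] := hPZ a.
have := congr1 (fun phi : 'CF(G) => phi g) (z i); rewrite ifT; last by lia.
rewrite (ZvalE _ IH a gG) (ZvalE _ IH a gG) (d (rk Bs A - i)%N); last by lia.
by rewrite cfunE add0r => <-; rewrite addrK.
Qed.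

Lemma equivP_all n : equivP n.
Proof.
elim: n => // n IH A Bs G A' Bs' G' g w i lt a a' eA eBs gG gG'.
have [A0|nA] := eqVneq A set0.
  have A0' : A' = set0 by rewrite eA A0 /setact imset0.
  have [/(_ A0)[-> _] _ _ _] := hPZ a; have [/(_ A0')[-> _] _ _ _] := hPZ a'.
  by rewrite !coef1; case: eqP => _; rewrite ?cfun1E ?gG ?gG' ?cfunE.
have cA : #|A'| = #|A| by rewrite eA card_setact.
have nA' : A' != set0 by rewrite -cards_eq0 cA cards_eq0.
have er : rk Bs' A' = rk Bs A by rewrite eA eBs rk_act.
case: (leqP (rk Bs A) i.*2) => ir.
  have [_ /(_ nA) d _ _] := hPZ a; have [_ /(_ nA') d' _ _] := hPZ a'.
  by rewrite d // d' ?er // !cfunE.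
have IHA : equivP #|A|.
  by move=> ? ? ? ? ? ? ? ? ? l; apply: IH; apply: leq_trans l _; rewrite -ltnS.
have rest j : restP A Bs G g j = restP A' Bs' G' (g ^ w)%g j.
  rewrite [RHS](reindex_onto (fun S => setact to S w) (fun S => setact to S w^-1%g)) /=; last first.
    by move=> S _; rewrite sactKV.
  apply: eq_big => S.
    rewrite sactK eqxx andbT fix_conj -!cards_eq0 card_setact eA; congr (_ && _).
    apply/idP/idP => s; first exact: imsetS.
    by have := imsetS (to ^~ w^-1%g) s; rewrite -/(setact to _ _) -/(setact to (setact to A w) _) !sactK.
  move=> /and3P[sS nS fS]; rewrite /shiftc eBs rk_act; case: ifP => // _.
  apply: IHA.
  + apply: proper_card; apply/properP; split; first exact: subsetDl.
    by have /set0Pn[x0 xS] := nS; exists x0; rewrite ?inE ?xS // (subsetP sS).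
  + exact: adm_contr.
  + by rewrite -eBs; apply: adm_contr.
  + by rewrite sactD eA.
  + by rewrite contr_act.
  + by rewrite memN gG.
  + by rewrite memN gG' fix_conj.
rewrite (PvalE IHA a gG nA ir) !rest PvalE ?er //.
by rewrite cA.
Qed.

Lemma P_equiv A Bs G A' Bs' G' g w i :
  admissible to A Bs G -> admissible to A' Bs' G' -> A' = setact to A w -> Bs' = actF to Bs w ->
  g \in G -> (g ^ w)%g \in G' -> (P A Bs G)`_i g = (P A' Bs' G')`_i (g ^ w)%g.
Proof. exact: (@equivP_all #|A|.+1). Qed.

Definition qpval A Bs G S i x : algC := \sum_(j < i.+1)
  (Q S (restrB Bs S) 'N_G(S | to)%G)`_j x * (P (A :\: S) (contrB Bs S) 'N_G(S | to)%G)`_(i - j) x.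

Definition restQ A Bs G g i : algC :=
  \sum_(S : {set E} | [&& S \subset A, S != A & setact to S g == S]) (-1) ^+ rk Bs S * qpval A Bs G S i g.

Definition equivQ n := forall A Bs G A' Bs' G' g w i, (#|A| < n)%N ->
  admissible to A Bs G -> admissible to A' Bs' G' -> A' = setact to A w -> Bs' = actF to Bs w ->
  g \in G -> (g ^ w)%g \in G' -> (Q A Bs G)`_i g = (Q A' Bs' G')`_i (g ^ w)%g.

(** The contraction by S = A is empty, with P = 1, so that term isolates Q of the whole matroid. *)
Lemma QvalE A Bs G g i : equivQ #|A| -> admissible to A Bs G -> g \in G -> A != set0 ->
  (-1) ^+ rk Bs A * (Q A Bs G)`_i g + restQ A Bs G g i = 0.
Proof.
move=> IH a gG nA; have [_ /(_ nA) z] := hQ a.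
have := congr1 (fun p : {poly 'CF(G)} => p`_i g) z; rewrite coef0 cfunE => <-.
rewrite coef_sum sum_cfunE.
pose psi S x := (-1) ^+ rk Bs S * qpval A Bs G S i x.
pose phi S : 'CF('N_G(S | to)) := (-1) ^+ rk Bs S *: (Q S (restrB Bs S) 'N_G(S | to)%G *
            P (A :\: S) (contrB Bs S) 'N_G(S | to)%G)`_i.
rewrite [RHS](eq_bigr (fun S => 'Ind[G] (phi S) g)); last first.
  by move=> S _; rewrite coef_sign_mul coef_map_Ind cfun_sign_mul /phi linearZ /= [RHS]cfunE.
rewrite (@sum_Ind _ _ to A G phi psi) //; first last.
- move=> S x w sS xN wG; rewrite /psi -{1}(adm_actF a wG) rk_act; congr (_ * _).
  have [->|nS] := eqVneq S A.
    rewrite (adm_act a wG) /qpval; apply: eq_bigr => j _.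
    by rewrite !cfunJ // memN wG (adm_act a wG) eqxx.
  apply: eq_bigr => j _; congr (_ * _); symmetry.
    apply: IH.
    + by apply: proper_card; rewrite properEneq nS.
    + exact: (adm_restr _ a).
    + exact: (adm_restr _ a).
    + by [].
    + by rewrite -restr_act (adm_actF a wG).
    + by [].
    + exact: N_conj.
  apply: P_equiv.
  + exact: (adm_contr _ a).
  + exact: (adm_contr _ a).
  + by rewrite sactD (adm_act a wG).
  + by rewrite -contr_act (adm_actF a wG).
  + by [].
  + exact: N_conj.
- move=> S x sS xN; rewrite /phi /psi cfunE coefM sum_cfunE; congr (_ * _).
  by apply: eq_bigr => j _; rewrite cfunE.
- by case/and3P: a.
rewrite [RHS](bigD1 A) /=; last by rewrite subxx (adm_act a gG) eqxx.
congr (_ + _); last by apply: eq_bigl => S; rewrite -andbA; congr (_ && _); rewrite andbC.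
rewrite /psi; congr (_ * _); rewrite /qpval (restr_full (adm_mat a)).
have a0 := adm_contr A a; rewrite setDv in a0 *.
have [/(_ erefl)[-> _] _ _ _] := hPZ a0.
rewrite big_ord_recr /= subnn coef1 eqxx cfun1E (_ : g \in _); last by rewrite memN gG (adm_act a gG) eqxx.
rewrite mulr1 big1 ?add0r; last first.
  move=> j _; rewrite coef1 (_ : (i - j == 0)%N = false) ?cfunE ?mulr0 //.
  by have := ltn_ord j; lia.
by apply/fam_group; rewrite (stab_full a).
Qed.

Lemma equivQ_all n : equivQ n.
Proof.
elim: n => // n IH A Bs G A' Bs' G' g w i lt a a' eA eBs gG gG'.
have [A0|nA] := eqVneq A set0.
  have A0' : A' = set0 by rewrite eA A0 /setact imset0.
  have [/(_ A0) -> _] := hQ a; have [/(_ A0') -> _] := hQ a'.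
  by rewrite !coef1; case: eqP => _; rewrite ?cfun1E ?gG ?gG' ?cfunE.
have cA : #|A'| = #|A| by rewrite eA card_setact.
have nA' : A' != set0 by rewrite -cards_eq0 cA cards_eq0.
have er : rk Bs' A' = rk Bs A by rewrite eA eBs rk_act.
have IHA : equivQ #|A|.
  by move=> ? ? ? ? ? ? ? ? ? l; apply: IH; apply: leq_trans l _; rewrite -ltnS.
have rest : restQ A Bs G g i = restQ A' Bs' G' (g ^ w)%g i.
  rewrite [RHS](reindex_onto (fun S => setact to S w) (fun S => setact to S w^-1%g)) /=; last first.
    by move=> S _; rewrite sactKV.
  apply: eq_big => S.
    rewrite sactK eqxx andbT fix_conj eA (inj_eq (can_inj (sactK to w))); congr (_ && _).
    apply/idP/idP => s; first exact: imsetS.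
    by have := imsetS (to ^~ w^-1%g) s; rewrite -/(setact to _ _) -/(setact to (setact to A w) _) !sactK.
  move=> /and3P[sS nS fS]; rewrite eBs rk_act; congr (_ * _); apply: eq_bigr => j _; congr (_ * _).
    apply: IHA.
    + by apply: proper_card; rewrite properEneq nS.
    + exact: (adm_restr _ a).
    + by rewrite -eBs; apply: (adm_restr _ a').
    + by [].
    + by rewrite restr_act.
    + by rewrite memN gG.
    + by rewrite memN gG' fix_conj.
  apply: P_equiv.
  + exact: (adm_contr _ a).
  + by rewrite -eBs; apply: (adm_contr _ a').
  + by rewrite sactD eA.
  + by rewrite contr_act.
  + by rewrite memN gG.
  + by rewrite memN gG' fix_conj.
have e1 := QvalE i IHA a gG nA.
have e2 : (-1) ^+ rk Bs' A' * (Q A' Bs' G')`_i (g ^ w)%g + restQ A' Bs' G' (g ^ w)%g i = 0.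
  by apply: QvalE => //; rewrite cA.
apply: (mulfI (_ : (-1) ^+ rk Bs A != 0)); first by rewrite signr_eq0.
by apply: (addIr (restQ A Bs G g i)); rewrite e1 rest -er e2.
Qed.

(* P and Q commute with restriction to subgroups, so their values at g can be
   computed in the cyclic group generated by g. *)
Definition pP A Bs g i : algC := (P A Bs <[g]>%G)`_i g.
Definition pQ A Bs g i : algC := (Q A Bs <[g]>%G)`_i g.
Definition adm A Bs g := admissible to A Bs <[g]>%G.

Lemma P_val A Bs G g i : admissible to A Bs G -> g \in G -> (P A Bs G)`_i g = pP A Bs g i.
Proof.
move=> a gG; have s : <[g]>%g \subset G by rewrite cycle_subG.
have := @P_equiv A Bs G A Bs <[g]>%G g 1%g i a (adm_sub s a); rewrite conjg1; apply=> //.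
- by rewrite sact1.
- by rewrite (adm_actF a).
- exact: cycle_id.
Qed.

Lemma Q_val A Bs G g i : admissible to A Bs G -> g \in G -> (Q A Bs G)`_i g = pQ A Bs g i.
Proof.
move=> a gG; have s : <[g]>%g \subset G by rewrite cycle_subG.
have := @equivQ_all #|A|.+1 A Bs G A Bs <[g]>%G g 1%g i (leqnn _) a (adm_sub s a); rewrite conjg1; apply=> //.
- by rewrite sact1.
- by rewrite (adm_actF a).
- exact: cycle_id.
Qed.

Lemma adm_contr1 A Bs g S : adm A Bs g -> setact to S g == S -> adm (A :\: S) (contrB Bs S) g.
Proof.
move=> a fS; apply: adm_sub (adm_contr S a); rewrite cycle_subG memN cycle_id; exact: fS.
Qed.

Lemma admgI A Bs g : is_matroid A Bs -> setact to A g = A -> actF to Bs g = Bs -> adm A Bs g.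
Proof.
move=> m eA eB; apply: admI => // w /cycleP[n ->]; elim: n => [|n IH].
- by rewrite expg0 sact1.
- by rewrite expgSr sactM IH.
- by rewrite expg0 /actF (eq_imset _ (sact1 to)) imset_id.
rewrite expgSr -[RHS]eB -[in RHS]IH /actF -imset_comp; apply: eq_imset => S /=; exact: sactM.
Qed.

Lemma pP_set0 Bs g i : adm set0 Bs g -> pP set0 Bs g i = (i == 0)%:R.
Proof.
by move=> a; have [/(_ erefl)[e _] _ _ _] := hPZ a; rewrite /pP e coef1; case: eqP => _; rewrite ?cfun1E ?cycle_id ?cfunE.
Qed.

Lemma pQ_set0 Bs g i : adm set0 Bs g -> pQ set0 Bs g i = (i == 0)%:R.
Proof.
by move=> a; have [/(_ erefl) e _] := hQ a; rewrite /pQ e coef1; case: eqP => _; rewrite ?cfun1E ?cycle_id ?cfunE.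
Qed.

Lemma pP_deg A Bs g i : adm A Bs g -> A != set0 -> (rk Bs A <= i.*2)%N -> pP A Bs g i = 0.
Proof. by move=> a nA le; have [_ /(_ nA) d _ _] := hPZ a; rewrite /pP d // cfunE. Qed.

Definition zval A Bs g i : algC := \sum_(S : {set E} | (S \subset A) && (setact to S g == S))
  shiftc (pP (A :\: S) (contrB Bs S) g) (rk Bs S) i.

Lemma zval_sym A Bs g i : adm A Bs g -> (i <= rk Bs A)%N -> zval A Bs g i = zval A Bs g (rk Bs A - i).
Proof.
move=> a ir; have e j : zval A Bs g j = (Z A Bs <[g]>%G)`_j g.
  rewrite (ZvalE _ (@equivP_all _) a (cycle_id g)) /zval (bigD1 set0) /=; last by rewrite sub0set /setact imset0 eqxx.
  rewrite {1}/shiftc rk_set0 leq0n subn0 setD0 contr_set0; congr (_ + _).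
  apply: eq_big => [S|S /andP[/andP[sS fS] nS]]; first by rewrite -andbA; congr (_ && _); rewrite andbC.
  rewrite /shiftc; case: ifP => // _; rewrite (P_val _ (adm_contr S a)) //.
  by rewrite memN cycle_id fS.
by rewrite !e; have [_ _ /(_ i) + _] := hPZ a; rewrite ir => ->.
Qed.

Lemma qval_sum A Bs g i : adm A Bs g -> A != set0 ->
  \sum_(S : {set E} | (S \subset A) && (setact to S g == S)) (-1) ^+ rk Bs S *
    (\sum_(j < i.+1) pQ S (restrB Bs S) g j * pP (A :\: S) (contrB Bs S) g (i - j)) = 0.
Proof.
move=> a nA; rewrite -[RHS](QvalE i (@equivQ_all _) a (cycle_id g) nA).
rewrite (bigD1 A) /=; last by rewrite subxx (adm_act a (cycle_id g)) eqxx.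
congr (_ + _).
  congr (_ * _); rewrite (restr_full (adm_mat a)) setDv big_ord_recr /= subnn pP_set0.
    rewrite mulr1 big1 ?add0r // => j _; rewrite pP_set0.
      by rewrite (_ : (i - j == 0)%N = false) ?mulr0 //; have := ltn_ord j; lia.
    by rewrite -(setDv A); apply: adm_contr1 => //; rewrite (adm_act a (cycle_id g)).
  by rewrite -(setDv A); apply: adm_contr1 => //; rewrite (adm_act a (cycle_id g)).
apply: eq_big => [S|S /andP[/andP[sS fS] nS]]; first by rewrite -andbA; congr (_ && _); rewrite andbC.
congr (_ * _); apply: eq_bigr => j _; rewrite (P_val _ (adm_contr S a)) ?(Q_val _ (adm_restr S a)) //.
  by rewrite memN cycle_id fS.
by rewrite memN cycle_id fS.
Qed.
End KLValues.

(** * Recursions for P and Q *)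

Section LowerInv.
Variables (R : comNzRingType) (h x y : nat -> R).
Hypothesis h0 : h 0 = 1.

Lemma conv_inv (f u : nat -> R) :
  (forall k, f k = \sum_(r < k.+1) h (k - r) * u r) ->
  forall k, \sum_(j < k.+1) (-1) ^+ j * elem h j * f (k - j)%N = u k.
Proof.
move=> fE k.
transitivity (\sum_(j < k.+1) \sum_(r < k.+1 | (r + j <= k)%N) (-1) ^+ j * elem h j * h (k - r - j) * u r).
  apply: eq_bigr => j _; rewrite fE big_distrr /=.
  have jk : (k - j < k.+1)%N by lia.
  rewrite (big_ord_widen k.+1 (fun r => (-1) ^+ j * elem h j * (h (k - j - r) * u r)) jk).
  apply: eq_big => [r|r _]; first by have := ltn_ord j; lia.
  by rewrite subnAC mulrA.
under eq_bigr do rewrite big_mkcond.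
rewrite exchange_big /= (bigD1 ord_max) //= [X in X + _]big_ord_recl /=.
rewrite addn0 leqnn subn0 subnn h0 expr0 !mulr1 mul1r [X in u k + X + _]big1 ?addr0; last by move=> j _; rewrite /bump leq0n add1n ifF //; lia.
rewrite big1 ?addr0 // => r rk.
have {}rk : (r < k)%N by move: rk; rewrite -val_eqE /=; have := ltn_ord r; lia.
rewrite -big_mkcond /= -big_distrl /=.
rewrite (eq_bigl (fun j : 'I_k.+1 => (j < (k - r).+1)%N)); last by move=> j; lia.
have l : ((k - r).+1 <= k.+1)%N by lia.
rewrite -(big_ord_widen k.+1 (fun j => (-1) ^+ j * elem h j * h (k - r - j)) l) sum_elem_h0 //.
by rewrite (_ : (k - r == 0)%N = false) ?mul0r //; lia.
Qed.

(** Convolution with signed elementary functions inverts convolution with the h's, and so strips the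
    h's from [lower]. In the recursion for Q these elementary functions come from the Boolean
    restrictions. *)
Lemma lower_inv k i :
  \sum_(j < k.+1) (-1) ^+ j * elem h j * lower h x y (k - j) i =
  if (i.*2 < k)%N then asym x y i (k - i) else 0.
Proof.
apply: (@conv_inv (fun k => lower h x y k i) (fun k => if (i.*2 < k)%N then asym x y i (k - i) else 0)) => l.
by rewrite /lower big_mkcond; apply: eq_bigr => r _; case: ifP; rewrite ?mulr0.
Qed.
End LowerInv.

(** * P for matroids of rank at most one and for uniform matroids *)

Section Diff.
Variables (E : finType) (gT : finGroupType) (to : {action gT &-> E}).
Variables (P Z Q : polyfam E gT).
Hypotheses (hPZ : is_KL_system to P Z) (hQ : is_invKL to P Q).
Variable g : gT.
Implicit Types (A S X H : {set E}) (Bs HH : {set {set E}}).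

Definition fx : pred {set E} := fun S => setact to S g == S.
Local Notation pP := (pP P).
Local Notation pQ := (pQ Q).
Local Notation adm := (adm to).
Let hs := hset algC fx.

Lemma fx0 : fx set0. Proof. by rewrite /fx /setact imset0. Qed.
Lemma hsE0 : hs 0 = 1. Proof. exact: hset0 fx0. Qed.
Lemma fxD A S : fx A -> fx S -> fx (A :\: S).
Proof. by rewrite /fx sactD => /eqP-> /eqP->. Qed.
Lemma fxU A S : fx A -> fx S -> fx (A :|: S).
Proof. by rewrite /fx /setact imsetU => /eqP-> /eqP->. Qed.
Lemma adm_fx A Bs : adm A Bs g -> fx A.
Proof. by move=> a; rewrite /fx (adm_act a (cycle_id g)). Qed.

(** The support condition satisfied by the values at [g] of representations of symmetric groups of
    degree n. It allows a product to be summed over the stable sets of one size ([homog_mulE]). *)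
Definition homogeneous (f : setalg E algC) n := forall A, f A != 0 -> fx A && (#|A| == n).

Lemma homog_mul f f' n n' : homogeneous f n -> homogeneous f' n' -> homogeneous (f * f') (n + n')%N.
Proof.
move=> hf hf' A; rewrite sa_mulE => nz.
have [S /andP[sS]] : exists S, (S \subset A) && (f S * f' (A :\: S) != 0).
  apply/existsP; apply: contraNT nz => /existsPn z; apply/eqP/big1 => S sS.
  by have := z S; rewrite sS /= negbK => /eqP.
rewrite mulf_eq0 negb_or => /andP[/hf /andP[fS /eqP cS] /hf' /andP[fD /eqP cD]].
have e : A = S :|: (A :\: S).
  by apply/setP => x; rewrite !inE; have := subsetP sS x; case: (x \in S) => //= /(_ isT) ->.
by rewrite {1}e fxU //= -(cardsID S A) (setIidPr sS) cS cD.
Qed.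

Lemma homog_sub f f' n : homogeneous f n -> homogeneous f' n -> homogeneous (f - f') n.
Proof.
move=> hf hf' A; rewrite sa_addE sa_oppE.
by case: (eqVneq (f A) 0) => [->|/hf //]; rewrite sub0r oppr_eq0 => /hf'.
Qed.

Lemma homog_h n : homogeneous (hs n) n.
Proof. by move=> A; rewrite ffunE pnatr_eq0 eqb0 negbK. Qed.

Lemma homog_hook c r : homogeneous (hook hs c r) (c + r)%N.
Proof.
elim: r c => [|r IH] c; first by rewrite addn0; apply: homog_h.
rewrite /=; apply: homog_sub; first by apply: homog_mul; [exact: homog_h|exact: (IH 1%N)].
by rewrite -addSnnS; apply: IH.
Qed.

Lemma homog_elem n : homogeneous (elem hs n) n.
Proof.
case: n => [|n]; last by move=> A nz; have := @homog_hook 1%N n A nz; rewrite add1n.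
by move=> A; rewrite sa_oneE pnatr_eq0 eqb0 negbK => /eqP ->; rewrite fx0 cards0.
Qed.

Lemma homog_mulE f n f' A : homogeneous f n ->
  (f * f') A = \sum_(S : {set E} | [&& S \subset A, fx S & #|S| == n]) f S * f' (A :\: S).
Proof.
move=> hf; rewrite sa_mulE [RHS]big_mkcondr /=; apply: eq_bigr => S _.
by case: ifP => // /negbT nS; rewrite (eqP (negbNE (contra (@hf S) nS))) mul0r.
Qed.

(** Stable sets of a given size are counted by an h, so a sum over small stable subsets is an
    h-convolution of the kind handled by [lower_sym]. As [F] vanishes in rank 0, the condition |S| <
    k may be exchanged for |S| <= i. *)
Lemma sum_small (F : nat -> nat -> setalg E algC) H k i : (forall j, F 0%N j = 0) -> (i <= k)%N ->
  \sum_(S : {set E} | [&& S \subset H, fx S & (#|S| < k)%N])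
     shiftc (fun j => F (k - #|S|)%N j (H :\: S)) #|S| i =
  (\sum_(i0 < i.+1) hs (i - i0) * F (k - i + i0)%N i0) H.
Proof.
move=> F0 ik.
transitivity (\sum_(S : {set E} | [&& S \subset H, fx S & (#|S| <= i)%N]) F (k - #|S|)%N (i - #|S|)%N (H :\: S)).
  rewrite big_mkcond [RHS]big_mkcond /=; apply: eq_bigr => S _.
  case: (S \subset H) => //=; case: (fx S) => //=; rewrite /shiftc.
  case: (leqP #|S| i) => si; last by rewrite if_same.
  case: ltnP => // ks; rewrite (_ : (k - #|S| = 0)%N) ?F0 ?sa_zeroE //; lia.
rewrite sa_sumE (reindex_inj rev_ord_inj) /=.
rewrite (partition_big (fun S : {set E} => inord #|S| : 'I_i.+1) xpredT) //=; apply: eq_bigr => j _.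
have ji : (j <= i)%N by rewrite -ltnS.
rewrite hset_mulE; apply: eq_big => [S|S /andP[/and3P[sS fS cS] /eqP ej]].
  rewrite -!andbA; congr (_ && (_ && _)); rewrite -val_eqE /=.
  have -> : (i - (i.+1 - j.+1) = j)%N by lia.
  case: (leqP #|S| i) => si /=; first by rewrite inordK.
  by apply/esym/negbTE; lia.
have -> : nat_of_ord j = #|S| by rewrite -ej inordK.
by congr (F _ _ _); lia.
Qed.

Lemma sum_small_elem (F : nat -> setalg E algC) H k :
  F 0%N = 0 ->
  \sum_(S : {set E} | [&& S \subset H, fx S & (#|S| < k)%N])
     (-1) ^+ #|S| * (elem hs #|S| S * F (k - #|S|)%N (H :\: S)) =
  (\sum_(j < k.+1) (-1) ^+ j * elem hs j * F (k - j)%N) H.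
Proof.
move=> F0; rewrite big_ord_recr /= subnn F0 mulr0 addr0 sa_sumE.
case: k => [|k]; first by rewrite big_ord0 big_pred0 // => S; rewrite ltn0 !andbF.
rewrite (partition_big (fun S : {set E} => inord #|S| : 'I_k.+1) xpredT) //=; apply: eq_bigr => j _.
rewrite -mulrA sa_signE (homog_mulE _ _ (@homog_elem j)) big_distrr /=.
apply: eq_big => [S|S /andP[/and3P[sS fS cS] /eqP ej]].
  rewrite -!andbA; congr (_ && (_ && _)); rewrite -val_eqE /=.
  case: (ltnP #|S| k.+1) => si /=; first by rewrite inordK.
  by apply/esym/negbTE; have := ltn_ord j; lia.
by have -> : nat_of_ord j = #|S| by rewrite -ej inordK.
Qed.

Lemma rk0_pP A Bs i : adm A Bs g -> A != set0 -> Bs = [set set0] -> pP A Bs g i = 0.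
Proof.
move=> a nA e; apply: (pP_deg hPZ a nA); rewrite (rk_full (adm_mat a) (B := set0)) ?cards0 //.
by rewrite e inE.
Qed.

Definition single (D : {set E}) : {set {set E}} := [set [set x] | x in D].

(** The points outside [D] are loops. In degree 0 of Z, apart from P itself, only the contraction by
    the set of all loops counts; in degree 1 only S = A does. Palindromicity equates the two. *)
Lemma rk1_pP A D i : adm A (single D) g -> D \subset A -> D != set0 ->
  pP A (single D) g i = ((D == A) && (i == 0%N))%:R.
Proof.
have [n] := ubnP #|A|; elim: n A i => // n IH A i lt a sD nD.
have /set0Pn[d0 d0D] := nD.
have nA : A != set0 by apply/set0Pn; exists d0; apply: (subsetP sD).
have rkA : rk (single D) A = 1%N.
  by rewrite (rk_full (adm_mat a) (B := [set d0])) ?cards1 // imset_f.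
case: i => [|i]; last by rewrite (pP_deg hPZ a nA) ?rkA // andbF.
rewrite andbT.
have fD : fx D.
  rewrite /fx eqEcard card_setact leqnn andbT; apply/subsetP => _ /imsetP[x xD ->].
  have := imset_f (fun A => setact to A g) (imset_f (fun x => [set x]) xD).
  rewrite -/(actF to (single D) g) (adm_actF a (cycle_id g)) /setact imset_set1 => /imsetP[z zD].
  by move=> /set1_inj ->.
have fA := adm_fx a.
have rkS S : rk (single D) S = ((S :&: D) != set0).
  case: (boolP (S :&: D != set0)) => [/set0Pn[x]|/negPn/eqP e].
    rewrite inE => /andP[xS xD]; apply: (rk_eq (B := [set x])); first exact: imset_f.
      by rewrite (setIidPr _) ?cards1 // sub1set.
    by move=> B /imsetP[z zD ->]; rewrite /= -(cards1 z) subset_leq_card // subsetIr.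
  apply/eqP; rewrite -leqn0; apply: rk_le => B /imsetP[z zD ->].
  rewrite leqn0 cards_eq0; apply/eqP/setP => x; rewrite !inE; apply/negbTE/negP => /andP[xS /eqP xz].
  by move/setP/(_ x): e; rewrite !inE xS xz zD.
have c0 S : S :&: D = set0 -> contrB (single D) S = single D.
  move=> e; apply/setP => X; apply/mem_contr/imsetP.
    move=> [B [/imsetP[x xD ->] _ ->]]; exists x => //; apply/setDidPl; rewrite disjoints1.
    by apply/negP => xS; move/setP/(_ x): e; rewrite !inE xS xD.
  move=> [x xD ->]; exists [set x].
  have xS : x \notin S by apply/negP => xS; move/setP/(_ x): e; rewrite !inE xS xD.
  split; [exact: imset_f| |by apply/esym/setDidPl; rewrite disjoints1].
  by rewrite rkS e eqxx; apply/eqP; rewrite cards_eq0 setIC setI_eq0 disjoints1.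
have c1 S : S :&: D != set0 -> contrB (single D) S = [set set0].
  move=> ne; have /set0Pn[y] := ne; rewrite inE => /andP[yS yD].
  apply/setP => X; rewrite inE; apply/mem_contr/eqP; rewrite rkS ne.
    move=> [B [/imsetP[x xD ->] e ->]]; apply/eqP; rewrite setD_eq0 sub1set.
    by apply: contraT => xS; move/eqP: e; rewrite (_ : S :&: [set x] = set0) ?cards0 //; apply/eqP; rewrite setIC setI_eq0 disjoints1.
  move=> ->; exists [set y]; split; [exact: imset_f| |by apply/esym/eqP; rewrite setD_eq0 sub1set].
  by rewrite (setIidPr _) ?cards1 // sub1set.
have z0 : zval to P A (single D) g 0 = pP A (single D) g 0 + (D != A)%:R.
  rewrite /zval (bigD1 set0) /=; last by rewrite sub0set; apply: fx0.
  rewrite {1}/shiftc rk_set0 leq0n subn0 setD0 contr_set0; congr (_ + _).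
  transitivity (\sum_(S : {set E} | (S \subset A) && fx S && (S != set0)) (S == A :\: D)%:R : algC).
    apply: eq_bigr => S /andP[/andP[sS fS] nS]; rewrite /shiftc rkS leqn0 eqb0 negbK.
    case: eqP => [e|/eqP ne].
      rewrite (c0 S e) subn0; have sDS : D \subset A :\: S.
        by rewrite subsetD sD disjoint_sym -setI_eq0 e eqxx.
      rewrite IH //; first last.
      - by rewrite -(c0 S e); apply: adm_contr1.
      - move: lt; rewrite ltnS; apply: leq_trans; apply: proper_card; apply/properP; split; first exact: subsetDl.
        by have /set0Pn[x xS] := nS; exists x; rewrite ?inE ?xS // (subsetP sS).
      rewrite andbT; congr ((nat_of_bool _)%:R); apply/eqP/eqP => [->|->].
        by rewrite setDDr setDv set0U; apply/esym/setIidPr.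
      by rewrite setDDr setDv set0U; apply/esym/setIidPr.
    rewrite (_ : (S == _) = false) //; apply: contraNF ne => /eqP ->.
    by rewrite setIC setIDA (setIidPl sD) setDv.
  case: (eqVneq D A) => [eDA|nDA].
    rewrite big1 // => S /andP[_ nS]; rewrite eDA setDv (negPf nS) //.
  rewrite (bigD1 (A :\: D)) /=; last first.
    rewrite subsetDl fxD //= setD_eq0; apply: contra nDA => s; by rewrite eqEsubset sD.
  by rewrite eqxx big1 ?addr0 // => S /andP[_ nS]; rewrite (negPf nS).
have z1 : zval to P A (single D) g 1 = 1.
  rewrite /zval (bigD1 A) /=; last by rewrite subxx; apply: fA.
  have AD : A :&: D != set0 by apply/set0Pn; exists d0; rewrite inE d0D (subsetP sD).
  rewrite {1}/shiftc rkS AD /= subnn setDv (pP_set0 hPZ) //; last first.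
    by rewrite -(setDv A); apply: adm_contr1.
  rewrite big1 ?addr0 // => S /andP[/andP[sS fS] nS]; rewrite /shiftc rkS.
  have nAS : A :\: S != set0 by rewrite setD_eq0; apply: contra nS => s; rewrite eqEsubset sS.
  case: (boolP (S :&: D != set0)) => ne /=.
    by rewrite (rk0_pP _ _ nAS) ?c1 //; rewrite -(c1 S ne); apply: adm_contr1.
  have e : S :&: D = set0 by apply/eqP/negPn.
  rewrite (c0 S e) subn0; apply: (pP_deg hPZ) => //; first by rewrite -(c0 S e); apply: adm_contr1.
  by apply: rk_le => B /imsetP[z _ ->]; rewrite (leq_trans (n := 1%N)) // -(cards1 z) subset_leq_card // subsetIr.
have := zval_sym hPZ a (leq0n _); rewrite rkA subn0 z0 z1 => h.
have -> : pP A (single D) g 0 = 1 - (D != A)%:R by apply/eqP; rewrite eq_sym subr_eq h.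
by case: (D == A); rewrite ?subr0 ?subrr.
Qed.
(** Coefficient of P for the uniform matroid of rank [d] on c + d points. The h-convolutions of the
    two sequences are the indicator of n = 0 and h_(c+n). *)
Definition Pcoef c d i :=
  lower hs (fun j => (-1) ^+ j * elem hs j) (fun j => (-1) ^+ j * hook hs c j) d i.

Definition unif (d : nat) A : {set {set E}} := [set X : {set E} | X \subset A & #|X| == d].

Section Uniform.
Variables (d : nat) (A : {set E}).
Hypothesis dA : (d <= #|A|)%N.

Lemma mem_unif X : (X \in unif d A) = (X \subset A) && (#|X| == d).
Proof. by rewrite inE. Qed.

Lemma unif_matroid : is_matroid A (unif d A).
Proof.
apply: is_matroidI.
- by have [X sX cX] := ex_draw dA; exists X; rewrite mem_unif sX cX eqxx.
- by move=> X; rewrite mem_unif => /andP[].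
move=> B1 B2 x; rewrite !mem_unif => /andP[s1 /eqP c1] /andP[s2 /eqP c2] x1 x2.
have [y y2 y1] : exists2 y, y \in B2 & y \notin B1.
  apply/subsetPn/negP => s; have e : B2 = B1 by apply/eqP; rewrite eqEcard s c1 c2 leqnn.
  by rewrite e x1 in x2.
exists y => //; rewrite y1 mem_unif card_swap // c1 eqxx andbT subUset sub1set (subsetP s2) //.
exact: subset_trans (subsetDl _ _) s1.
Qed.

Lemma unif_adm : fx A -> adm A (unif d A) g.
Proof.
move=> /eqP fA; apply: admgI => //; first exact: unif_matroid.
have sub : actF to (unif d A) g \subset unif d A.
  apply/subsetP => Y /imsetP[X]; rewrite mem_unif => /andP[sX cX] {Y}->.
  by rewrite mem_unif card_setact cX andbT -fA imsetS.
apply/eqP; rewrite eqEcard sub /= (_ : #|actF to (unif d A) g| = #|unif d A|) //.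
by apply: card_imset; apply: (can_inj (sactK to g)).
Qed.

Lemma rk_unif S : S \subset A -> rk (unif d A) S = minn d #|S|.
Proof.
move=> sS; case: (leqP d #|S|) => dS.
  have [X sX cX] := ex_draw dS.
  apply: (rk_eq (B := X)); first by rewrite mem_unif (subset_trans sX) // cX eqxx.
    by rewrite (setIidPr sX).
  by move=> B; rewrite mem_unif => /andP[_ /eqP <-]; apply: subset_leq_card; apply: subsetIr.
have [|Y sY cY] := @ex_draw _ (A :\: S) (d - #|S|)%N; first by rewrite cardsD (setIidPr sS); lia.
have dYS : [disjoint Y & S] by move: sY; rewrite subsetD => /andP[].
apply: (rk_eq (B := S :|: Y)).
- rewrite mem_unif subUset sS (subset_trans sY (subsetDl _ _)) /= cardsU cY.
  rewrite (_ : S :&: Y = set0) ?cards0; last by apply/eqP; rewrite setI_eq0 disjoint_sym.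
  by rewrite subn0 subnKC // ltnW.
- by rewrite (setIidPl (subsetUl _ _)).
- by move=> B _; apply: subset_leq_card; apply: subsetIl.
Qed.

Lemma contr_unif_small S : S \subset A -> (#|S| < d)%N -> contrB (unif d A) S = unif (d - #|S|) (A :\: S).
Proof.
move=> sS cS; have rS : rk (unif d A) S = #|S| by rewrite rk_unif //; lia.
apply/setP => X; rewrite [RHS]inE; apply/mem_contr/andP; rewrite rS.
  move=> [B [+ e ->]]; rewrite mem_unif => /andP[sB /eqP cB]; split; first exact: setSD.
  by rewrite cardsD setIC e cB.
rewrite subsetD => -[/andP[sX dX] /eqP cX]; exists (X :|: S).
have XS : X :&: S = set0 by apply/eqP; rewrite setI_eq0.
split; last by rewrite setDUl setDv setU0; apply/esym/setDidPl.
  by rewrite mem_unif subUset sX sS /= cardsU XS cards0 cX; lia.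
by rewrite (setIidPl (subsetUr _ _)).
Qed.

Lemma contr_unif_large S : S \subset A -> (d <= #|S|)%N -> contrB (unif d A) S = [set set0].
Proof.
move=> sS cS; have rS : rk (unif d A) S = d by rewrite rk_unif //; lia.
apply/setP => X; rewrite inE; apply/mem_contr/eqP; rewrite rS.
  move=> [B [+ e ->]]; rewrite mem_unif => /andP[sB /eqP cB]; apply/eqP; rewrite setD_eq0.
  have /eqP <- : S :&: B == B by rewrite eqEcard subsetIr e cB leqnn.
  exact: subsetIl.
move=> ->; have [Y sY cY] := ex_draw cS; exists Y; split.
- by rewrite mem_unif (subset_trans sY) // cY eqxx.
- by rewrite (setIidPr sY).
- by apply/esym/eqP; rewrite setD_eq0.
Qed.

Lemma restr_unif_small S : S \subset A -> (#|S| <= d)%N -> restrB (unif d A) S = [set S].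
Proof.
move=> sS cS; have rS : rk (unif d A) S = #|S| by rewrite rk_unif //; lia.
apply/setP => X; rewrite [RHS]inE; apply/mem_restr/eqP; rewrite rS.
  move=> [B [_ e ->]]; apply/eqP; by rewrite eqEcard subsetIl e leqnn.
move=> ->; have [B b e] := rk_attain S (mat_ne unif_matroid); exists B; split=> //; first by rewrite e rS.
by apply/esym/eqP; rewrite eqEcard subsetIl e rS leqnn.
Qed.
End Uniform.

(** The term of [S] in Z of the uniform matroid, with the expected value in place of P. From size
    [d] on, the contraction consists of loops unless S = A, where it is empty. *)
Definition Tunif d A i S : algC :=
  if (#|S| < d)%N then shiftc (fun j => Pcoef (#|A| - d) (d - #|S|) j (A :\: S)) #|S| i
  else ((S == A) && (i == d))%:R.

Lemma sum_Tunif d A i : (0 < d)%N -> (d <= #|A|)%N -> fx A -> (i <= d)%N ->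
  \sum_(S : {set E} | (S \subset A) && fx S) Tunif d A i S =
  (\sum_(i0 < i.+1) hs (i - i0) * Pcoef (#|A| - d) (d - i + i0) i0) A + (i == d)%:R.
Proof.
move=> d0 dA fA id.
rewrite -(@sum_small (fun k j => Pcoef (#|A| - d) k j)) //; last by move=> j; apply: lower_eq0.
rewrite (bigID (fun S : {set E} => (#|S| < d)%N)) /=; congr (_ + _).
  by apply: eq_big => [S|S /andP[_ h]]; rewrite ?andbA // /Tunif h.
rewrite (bigD1 A) /=; last by rewrite subxx fA -leqNgt.
rewrite {1}/Tunif ltnNge dA /= eqxx big1 ?addr0 // => S /andP[/andP[_ /negPf h] nS].
by rewrite /Tunif h (negPf nS).
Qed.

(** By [lower_sym] the defect sits in degrees 0 and d, where it is balanced by the term t^d of S =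
    A. *)
Lemma sum_Tunif_sym d A i : (0 < d)%N -> (d <= #|A|)%N -> fx A -> (i <= d)%N ->
  \sum_(S : {set E} | (S \subset A) && fx S) Tunif d A i S =
  \sum_(S : {set E} | (S \subset A) && fx S) Tunif d A (d - i) S.
Proof.
move=> d0 dA fA id; rewrite !sum_Tunif //; last exact: leq_subr.
set c := (#|A| - d)%N; rewrite subKn //.
have := lower_sym hs (fun j => (-1) ^+ j * elem hs j) (fun j => (-1) ^+ j * hook hs c j) i (d - i).
rewrite (sum_h_elem hsE0) (sum_h_elem hsE0) (sum_h_hook hsE0) (sum_h_hook hsE0) -/(Pcoef c).
move=> /(congr1 (fun f : setalg E algC => f A)).
have hz n m : (((n == 0)%N%:R : setalg E algC) * hs (c + m)) A = ((n == 0)%N && (m == d))%:R.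
  case: eqP => _ /=; last by rewrite mul0r sa_zeroE.
  by rewrite mul1r ffunE fA /= /c; congr ((nat_of_bool _)%:R); lia.
rewrite !sa_addE !sa_oppE hz hz => /eqP; rewrite subr_eq => /eqP ->.
have -> : (i == 0)%N && (d - i == d)%N = (d - i == d)%N by lia.
have -> : (d - i == 0)%N && (i == d)%N = (i == d)%N by lia.
by ring.
Qed.

(** By induction, Z differs from the palindromic sum of expected terms only by the error at the
    empty set. That error is palindromic and vanishes in degrees at least d/2, so it is zero. *)
Lemma unif_pP d A i : (0 < d)%N -> (d <= #|A|)%N -> fx A ->
  pP A (unif d A) g i = Pcoef (#|A| - d) d i A.
Proof.
have [n] := ubnP #|A|; elim: n A d i => // n IH A d i lt d0 dA fA.
have a := unif_adm dA fA.
have nA : A != set0 by rewrite -card_gt0; lia.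
have rkA : rk (unif d A) A = d by rewrite rk_unif //; lia.
case: (leqP d i.*2) => di.
  by rewrite (pP_deg hPZ a nA) ?rkA // /Pcoef lower_eq0 // sa_zeroE.
have zE j : zval to P A (unif d A) g j =
    pP A (unif d A) g j - Pcoef (#|A| - d) d j A +
    \sum_(S : {set E} | (S \subset A) && fx S) Tunif d A j S.
  rewrite /zval (bigD1 set0) /=; last by rewrite sub0set; apply: fx0.
  rewrite [X in _ = _ + X](bigD1 set0) /=; last by rewrite sub0set; apply: fx0.
  rewrite addrA {1}/shiftc rk_set0 leq0n subn0 setD0 contr_set0; congr (_ + _).
    by rewrite /Tunif cards0 d0 /shiftc leq0n !subn0 setD0 subrK.
  apply: eq_bigr => S /andP[/andP[sS fS] nS].
  have as' := adm_contr1 a fS; rewrite rk_unif // /Tunif.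
  case: (ltnP #|S| d) => cS.
    rewrite contr_unif_small // /shiftc; case: ifP => // _.
    have cD : #|A :\: S| = (#|A| - #|S|)%N by rewrite cardsD (setIidPr sS).
    rewrite IH ?cD; try lia; last exact: fxD.
      by congr (Pcoef _ _ _ _); lia.
    by have := nS; rewrite -card_gt0; lia.
  rewrite contr_unif_large // /shiftc.
  have [eSA|nSA] := eqVneq S A.
    rewrite eSA setDv; have a0 : adm set0 [set set0] g.
      by have := adm_contr1 a fA; rewrite setDv contr_unif_large.
    rewrite ?eqxx /=; case: leqP => dj; first by rewrite (pP_set0 hPZ) //; congr ((nat_of_bool _)%:R); lia.
    by rewrite (_ : (j == d) = false) //; lia.
  rewrite /=; case: ifP => // _; apply: rk0_pP => //.
    by rewrite -(contr_unif_large dA sS cS).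
  by rewrite setD_eq0; apply: contra nSA => s; rewrite eqEsubset sS.
have ir : (i <= rk (unif d A) A)%N by rewrite rkA; lia.
have := zval_sym hPZ a ir; rewrite rkA !zE -(sum_Tunif_sym d0 dA fA) => [/addIr|]; last by lia.
rewrite (pP_deg hPZ a nA (i := (d - i)%N)) ?rkA; last by lia.
rewrite [Pcoef _ d (d - i)]lower_eq0 ?sa_zeroE ?subr0 => [/eqP|]; last by lia.
by rewrite subr_eq0 => /eqP.
Qed.
End Diff.

(** * Effect of a relaxation on P, and Q of Boolean and uniform matroids *)

Section Diff2.
Variables (E : finType) (gT : finGroupType) (to : {action gT &-> E}).
Variables (P Z Q : polyfam E gT).
Hypotheses (hPZ : is_KL_system to P Z) (hQ : is_invKL to P Q).
Variable g : gT.
Implicit Types (A S X H : {set E}) (Bs HH : {set {set E}}).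
Local Notation fx := (fx to g).
Local Notation pP := (pP P).
Local Notation pQ := (pQ Q).
Local Notation adm := (adm to).
Local Notation hs := (hset algC fx).

(** The term of [S] in the contribution of [H] to the change of Z. For |S| >= k the relaxed
    contraction has P = 0, and the old one has P = 1 exactly for S = H, where t^(k-1) is lost. *)
Definition Trelax k H i S : algC :=
  if (#|S| < k)%N then shiftc (fun j => pcoef hs (#|H|.+1 - k) (k - #|S|) j (H :\: S)) #|S| i
  else - ((S == H) && (i == k.-1))%:R.

Lemma sum_Trelax k H i : (0 < k)%N -> (k <= #|H|)%N -> fx H -> (i <= k)%N ->
  \sum_(S : {set E} | (S \subset H) && fx S) Trelax k H i S =
  (\sum_(i0 < i.+1) hs (i - i0) * pcoef hs (#|H|.+1 - k) (k - i + i0) i0) H - (i == k.-1)%:R.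
Proof.
move=> k0 kH fH ik.
rewrite -(@sum_small _ _ to g (fun k' j => pcoef hs (#|H|.+1 - k) k' j)) //; last by move=> j; apply: lower_eq0.
rewrite (bigID (fun S : {set E} => (#|S| < k)%N)) /=; congr (_ + _).
  by apply: eq_big => [S|S /andP[_ h]]; rewrite ?andbA // /Trelax h.
rewrite (bigD1 H) /=; last by rewrite subxx fH -leqNgt.
rewrite {1}/Trelax ltnNge kH /= eqxx big1 ?addr0 // => S /andP[/andP[_ /negPf h] nS].
by rewrite /Trelax h (negPf nS) oppr0.
Qed.

(** For c = |H| + 1 - k the function h_(c+k-1) has value 1 at [H], so the defect of [pcoef] in
    degrees 1 and k - 1 makes up for the asymmetry of the lost term. *)
Lemma sum_Trelax_sym k H i : (0 < k)%N -> (k <= #|H|)%N -> fx H -> (i <= k)%N ->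
  \sum_(S : {set E} | (S \subset H) && fx S) Trelax k H i S =
  \sum_(S : {set E} | (S \subset H) && fx S) Trelax k H (k - i) S.
Proof.
move=> k0 kH fH ik; rewrite !sum_Trelax //; last exact: leq_subr.
set c := (#|H|.+1 - k)%N; rewrite subKn //.
have h0 := hsE0 to g.
have := lower_sym hs (fun j => (-1) ^+ j * hook hs c j)
  (fun j => if j is j'.+1 then (-1) ^+ j' * elem hs j' else 0) i (k - i).
rewrite (sum_h_y h0) (sum_h_y h0) (sum_h_hook h0) (sum_h_hook h0) -/(pcoef hs c).
move=> /(congr1 (fun f : setalg E algC => f H)).
have hz n m : (hs (c + m) * ((n == 1)%N%:R : setalg E algC)) H = ((n == 1)%N && (m == k.-1))%:R.
  case: eqP => _ /=; last by rewrite mulr0 sa_zeroE.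
  by rewrite mulr1 ffunE fH /= /c; congr ((nat_of_bool _)%:R); lia.
rewrite !sa_addE !sa_oppE hz hz => /eqP; rewrite subr_eq => /eqP ->.
have -> : (k - i == 1)%N && (i == k.-1)%N = (i == k.-1)%N by lia.
have -> : (i == 1)%N && (k - i == k.-1)%N = (k - i == k.-1)%N by lia.
by ring.
Qed.

Lemma relax_adm A Bs HH k : adm A Bs g -> rk Bs A = k -> (0 < k)%N ->
  (forall H, H \in HH -> stressed k A Bs H) -> (forall H, H \in HH -> setact to H g \in HH) ->
  adm A (relaxF k Bs HH) g.
Proof.
move=> a rkA k0 sH gH; have m := adm_mat a.
apply: admgI; [exact: relax_matroid|exact/eqP/(adm_fx a)|].
apply/eqP; rewrite eqEcard (_ : #|actF to (relaxF k Bs HH) g| = #|relaxF k Bs HH|) ?leqnn ?andbT; last first.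
  by apply: card_imset; apply: (can_inj (sactK to g)).
apply/subsetP => Y /imsetP[X /mem_relaxF[b|[H [h s c]]] {Y}->]; apply/mem_relaxF.
  by left; rewrite -(adm_actF a (cycle_id g)); apply: (imset_f (fun A => setact to A g) b).
by right; exists (setact to H g); split; [exact: gH|exact: imsetS|rewrite card_setact].
Qed.

(** Stated as a predicate of the ground set so that [contr_diff_pP] can take it for a contraction,
    both inside the induction for P and afterwards for Q. *)
Definition relax_diffP A := forall Bs HH k i, adm A Bs g -> rk Bs A = k -> (0 < k)%N ->
  (forall H, H \in HH -> stressed k A Bs H) -> (forall H, H \in HH -> setact to H g \in HH) ->
  pP A (relaxF k Bs HH) g i - pP A Bs g i =
  \sum_(H in HH | fx H) pcoef hs (#|H|.+1 - k) k i H.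

(** The rank and the size of a hyperplane containing [S] drop together, so the offset |H| + 1 - k is
    the same in all these contractions. *)
Lemma contr_diff_pP A Bs HH k S H0 i : relax_diffP (A :\: S) -> adm A Bs g -> rk Bs A = k ->
  (forall H, H \in HH -> stressed k A Bs H) -> (forall H, H \in HH -> setact to H g \in HH) -> (0 < k)%N ->
  fx S -> H0 \in HH -> S \subset H0 -> (#|S| < k)%N ->
  pP (A :\: S) (contrB (relaxF k Bs HH) S) g i - pP (A :\: S) (contrB Bs S) g i =
  \sum_(H in HH | fx H && (S \subset H)) pcoef hs (#|H|.+1 - k) (k - #|S|) i (H :\: S).
Proof.
move=> IH a rkA sH gH k0 fS h0 sS0 cS; have m := adm_mat a.
have rkS : rk Bs S = #|S| by exact: (rk_small m rkA sH k0 h0 sS0 cS).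
have -> : contrB (relaxF k Bs HH) S =
  relaxF (k - #|S|)%N (contrB Bs S) [set H :\: S | H in [set H in HH | S \subset H]].
  exact: (contr_relax_small m rkA sH k0 h0 sS0 cS).
rewrite IH; first last.
- move=> _ /imsetP[H + ->]; rewrite inE => /andP[h SH]; rewrite sactD (eqP fS); apply: imset_f.
  by rewrite inE gH //= -(eqP fS) imsetS.
- by move=> _ /imsetP[H + ->]; rewrite inE => /andP[h SH]; eapply stressed_contr; eauto.
- by rewrite subn_gt0.
- have [B b SB] : exists2 B, B \in Bs & S \subset B by eapply stressed_indep; eauto.
  rewrite (rk_full (contr_matroid S m) (B := B :\: S)) ?cardsD ?(setIidPr SB) ?(card_basis m rkA b) //.
  by apply/mem_contr; exists B; rewrite rkS (setIidPl SB).
- exact: adm_contr1.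
have fxDS H : S \subset H -> fx (H :\: S) = fx H.
  move=> SH; apply/idP/idP => [f|f]; last exact: fxD.
  have -> : H = S :|: (H :\: S).
    by apply/setP => x; rewrite !inE; have := subsetP SH x; case: (x \in S) => //= /(_ isT) ->.
  exact: fxU.
rewrite big_mkcondr big_imset /=; last first.
  move=> H H'; rewrite !inE => /andP[_ SH] /andP[_ SH'] /setP e; apply/setP => x.
  have := e x; rewrite !inE; case: (boolP (x \in S)) => //= xS _.
  by rewrite (subsetP SH) // (subsetP SH').
rewrite [LHS]big_mkcond [RHS]big_mkcond /=; apply: eq_bigr => H _.
rewrite inE; case: (boolP (H \in HH)) => //= h; case: (boolP (S \subset H)) => SH; last by rewrite andbF.
have -> : (#|H :\: S|.+1 - (k - #|S|) = #|H|.+1 - k)%N.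
  have [_ kH _ _] := sH _ h.
  have cSH := subset_leq_card SH.
  rewrite cardsD (setIidPr SH).
  by clear -cS kH cSH; lia.
by rewrite (fxDS _ SH) andbT.
Qed.

(** The scheme of [unif_pP]: apart from the error at the empty set, the change of Z is a sum of
    palindromic contributions, one for each stable hyperplane. *)
Lemma diff_pP A : relax_diffP A.
Proof.
have [n] := ubnP #|A|; elim: n A => // n IH A lt Bs HH k i a rkA k0 sH gH.
have m := adm_mat a; have a' := relax_adm a rkA k0 sH gH; have m' := adm_mat a'.
have [B0 b0] := mat_ne m.
have rkA' : rk (relaxF k Bs HH) A = k.
  rewrite (rk_full m' (B := B0)) ?(card_basis m rkA b0) //; by apply/mem_relaxF; left.
have nA : A != set0.
  rewrite -card_gt0; apply: leq_trans k0 _; rewrite -(card_basis m rkA b0).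
  exact/subset_leq_card/(mat_sub m).
case: (leqP k i.*2) => di.
  rewrite (pP_deg hPZ a' nA) ?rkA' // (pP_deg hPZ a nA) ?rkA // subrr big1 // => H _.
  by rewrite /pcoef lower_eq0 // sa_zeroE.
have term S j : S \subset A -> fx S -> S != set0 ->
   shiftc (pP (A :\: S) (contrB (relaxF k Bs HH) S) g) (rk (relaxF k Bs HH) S) j -
   shiftc (pP (A :\: S) (contrB Bs S) g) (rk Bs S) j =
   \sum_(H in HH | fx H && (S \subset H)) Trelax k H j S.
  move=> sSA fS nS.
  have aS := adm_contr1 a fS; have aS' := adm_contr1 a' fS.
  case: (boolP [exists H in HH, S \subset H]) => [/exists_inP[H0 h0 sS0]|/exists_inPn no]; last first.
    have -> : rk (relaxF k Bs HH) S = rk Bs S by eapply rk_relax_notin; eauto.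
    have -> : contrB (relaxF k Bs HH) S = contrB Bs S by eapply contr_relax_notin; eauto.
    rewrite subrr big_pred0 // => H.
    by apply/negbTE/negP => /and3P[h _ s]; have := no H h; rewrite s.
  case: (ltnP #|S| k) => cS.
    have rkS' : rk (relaxF k Bs HH) S = #|S| by eapply rk_relax_small; eauto.
    have rkS : rk Bs S = #|S| by eapply rk_small; eauto.
    rewrite rkS rkS'.
    under eq_bigr do rewrite /Trelax cS.
    rewrite /shiftc; case: leqP => Sj; last by rewrite subrr big1.
    rewrite (contr_diff_pP _ _ a rkA sH gH k0 fS h0 sS0 cS) //; apply: IH.
    move: lt; rewrite ltnS; apply: leq_trans; apply: proper_card; apply/properP; split; first exact: subsetDl.
    by have /set0Pn[x xS] := nS; exists x; rewrite ?inE ?xS // (subsetP sSA).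
  have nAS : A :\: S != set0.
    have [x xA xH] := stressed_out m sH h0.
    by apply/set0Pn; exists x; rewrite inE xA andbT; apply: contra xH; apply: (subsetP sS0).
  have cl' : contrB (relaxF k Bs HH) S = [set set0] by eapply contr_relax_large; eauto.
  rewrite cl' in aS' *.
  have -> : shiftc (pP (A :\: S) [set set0] g) (rk (relaxF k Bs HH) S) j = 0.
    by rewrite /shiftc; case: ifP => // _; rewrite (rk0_pP hPZ _ aS').
  have rkS : rk Bs S = k.-1 by eapply rk_large; eauto.
  rewrite sub0r rkS.
  have cl : contrB Bs S = single (A :\: H0) by eapply contr_large; eauto.
  rewrite cl in aS *.
  have uniq H : H \in HH -> S \subset H -> H = H0.
    by move=> h SH; exact: (stressed_inter m rkA sH k0 h h0 SH sS0 (leqW cS)).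
  (* The hyperplane containing [S] is unique, hence stable because [S] is. *)
  have fH0 : fx H0.
    by apply/eqP; apply: uniq; [exact: gH|rewrite -(eqP fS); exact: imsetS].
  rewrite [RHS](bigD1 H0) /=; last by rewrite h0 fH0 sS0.
  rewrite [X in _ = _ + X]big1 ?addr0; last by move=> H /andP[/and3P[h _ SH] /eqP[]]; apply: uniq.
  rewrite /Trelax ltnNge cS /=; congr (- _); rewrite /shiftc.
  have nD : A :\: H0 != set0.
    have [x xA xH] := stressed_out m sH h0.
    by apply/set0Pn; exists x; rewrite inE xA xH.
  have e : (A :\: H0 == A :\: S) = (S == H0).
    apply/eqP/eqP => [/setP e|-> //]; apply/eqP; rewrite eqEsubset sS0; apply/subsetP => x xH.
    have := e x; rewrite !inE xH /= => /esym/negbT; rewrite negb_and negbK => /orP[//|].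
    by have [sA _ _ _] := sH _ h0; rewrite (subsetP sA _ xH).
  case: leqP => kj; first by rewrite (rk1_pP hPZ _ aS (setDS A sS0) nD) e; congr ((nat_of_bool (_ && _))%:R); apply/eqP/eqP; clear -kj k0; lia.
  by have -> : (j == k.-1) = false by [clear -kj; lia]; rewrite andbF.
have zE j : zval to P A (relaxF k Bs HH) g j - zval to P A Bs g j =
    (pP A (relaxF k Bs HH) g j - pP A Bs g j) - \sum_(H in HH | fx H) pcoef hs (#|H|.+1 - k) k j H +
    \sum_(H in HH | fx H) \sum_(S : {set E} | (S \subset H) && fx S) Trelax k H j S.
  have step : zval to P A (relaxF k Bs HH) g j - zval to P A Bs g j =
     (pP A (relaxF k Bs HH) g j - pP A Bs g j) +
     \sum_(S : {set E} | [&& S \subset A, fx S & S != set0]) \sum_(H in HH | fx H && (S \subset H)) Trelax k H j S.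
    rewrite /zval -sumrB (bigD1 set0) /=; last by rewrite sub0set; apply: fx0.
    rewrite {1 2}/shiftc !rk_set0 !leq0n !subn0 !setD0 !contr_set0; congr (_ + _).
    by apply: eq_big => [S|S /andP[/andP[sS fS] nS]]; [rewrite andbA|apply: term].
  rewrite step -[RHS]addrA; congr (_ + _); rewrite [RHS]addrC -sumrB.
  rewrite (exchange_big_dep (fun H => (H \in HH) && fx H)) /=; last by move=> S H _ /and3P[-> ->].
  apply: eq_bigr => H /andP[h fH]; have [sHA kH _ _] := sH _ h.
  rewrite [in RHS](bigD1 set0) /=; last by rewrite sub0set; apply: fx0.
  have -> : Trelax k H j set0 = pcoef hs (#|H|.+1 - k) k j H.
    by rewrite /Trelax cards0 k0 /shiftc leq0n !subn0 setD0.
  rewrite addrAC subrr add0r.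
  apply: eq_bigl => S; rewrite h fH /=; case: (boolP (S \subset H)) => SH; rewrite ?andbF //= andbT.
  by rewrite (subset_trans SH).
have ik : (i <= k)%N by clear -di; lia.
have := zval_sym hPZ a (_ : i <= rk Bs A)%N; rewrite rkA => /(_ ik) z1.
have := zval_sym hPZ a' (_ : i <= rk (relaxF k Bs HH) A)%N; rewrite rkA' => /(_ ik) z2.
have := zE i; rewrite z1 z2 zE.
have -> : \sum_(H in HH | fx H) \sum_(S : {set E} | (S \subset H) && fx S) Trelax k H (k - i) S =
   \sum_(H in HH | fx H) \sum_(S : {set E} | (S \subset H) && fx S) Trelax k H i S.
  by apply: eq_bigr => H /andP[h fH]; have [_ kH _ _] := sH _ h; rewrite (@sum_Trelax_sym k H i).
move=> /addIr; rewrite (pP_deg hPZ a' nA (i := (k - i)%N)) ?rkA' ?(pP_deg hPZ a nA (i := (k - i)%N)) ?rkA; try by clear -di; lia.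
rewrite big1 ?subr0; last by move=> H _; rewrite /pcoef lower_eq0 ?sa_zeroE //; clear -di; lia.
by move=> /esym/eqP; rewrite subr_eq0 => /eqP.
Qed.

Lemma unif_card A : unif #|A| A = [set A].
Proof.
apply/setP => X; rewrite !inE; apply/andP/eqP => [[s /eqP c]|->]; last by rewrite subxx.
by apply/eqP; rewrite eqEcard s c leqnn.
Qed.

(** This is the uniform case with c = 0, where [hook 0 r] vanishes for all positive r. *)
Lemma bool_pP A i : fx A -> pP A [set A] g i = (i == 0%N)%:R.
Proof.
move=> fA; have [->|nA] := eqVneq A set0.
  rewrite (pP_set0 hPZ) //; rewrite -(unif_card set0); apply: unif_adm => //; exact: fx0.
have cA : (0 < #|A|)%N by rewrite card_gt0.
rewrite -{1}unif_card (unif_pP hPZ) // /Pcoef subnn.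
have h0 := hsE0 to g.
case: i => [|i]; last first.
  rewrite /lower (_ : \sum_(r < _ | _) _ = 0) ?sa_zeroE //; apply: big1 => r ri.
  by rewrite /asym !(hook0 h0) (_ : (r - i.+1 == 0)%N = false) ?mulr0 ?subrr ?mulr0 //; lia.
rewrite /lower.
transitivity ((- \sum_(r < #|A|.+1 | (0 < r)%N) hs (#|A| - r) * ((-1) ^+ r * elem hs r)) A).
  apply: (congr1 (fun f : setalg E algC => f A)); rewrite -sumrN; apply: eq_bigr => r r0.
  rewrite /asym subn0 !(hook0 h0) (_ : (nat_of_ord r == 0)%N = false); last by lia.
  by rewrite !mulr0 sub0r expr0 !mulr1 mulrN.
have := sum_h_elem h0 #|A|; rewrite (bigD1 ord0) //= subn0 expr0 !mulr1.
rewrite (_ : (#|A| == 0)%N = false); last by lia.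
rewrite (eq_bigl (fun r : 'I_#|A|.+1 => (0 < r)%N)); last by move=> r; rewrite -val_eqE /=; lia.
move=> /eqP; rewrite addrC addr_eq0 => /eqP ->; rewrite opprK.
by rewrite ffunE fA eqxx.
Qed.

Lemma bool_adm A : fx A -> adm A [set A] g.
Proof. by move=> fA; rewrite -unif_card; apply: unif_adm. Qed.

(** The alternating relation between elementary and complete functions, read at [A], where each
    complete factor has value 1. *)
Lemma sum_sign_elem A : fx A -> A != set0 ->
  \sum_(S : {set E} | (S \subset A) && fx S) (-1) ^+ #|S| * elem hs #|S| S = 0.
Proof.
move=> fA nA; have h0 := hsE0 to g.
pose F j : setalg E algC := if j is j'.+1 then hs j' else 0.
have := @sum_small_elem _ _ to g F A #|A|.+1 erefl.
rewrite big_ord_recr /= subnn mulr0 addr0.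
rewrite [X in _ = fun_of_fin X A -> _](eq_bigr (fun j : 'I_#|A|.+1 => (-1) ^+ j * elem hs j * hs (#|A| - j))); last first.
  by move=> j _; rewrite subSn ?leq_ord.
rewrite sum_elem_h0 // cards_eq0 (negPf nA) sa_zeroE => e; rewrite -[RHS]e.
apply: eq_big => [S|S /andP[sS fS]].
  by case: (boolP (S \subset A)) => //= /subset_leq_card; rewrite -ltnS => ->; rewrite andbT.
have cS := subset_leq_card sS; rewrite subSn //= ffunE fxD //= cardsD (setIidPr sS) eqxx mulr1 //.
Qed.

(** The elementary function takes at [A] the value of the sign character. As P = 1 for all
    contractions, the recursion for Q is [sum_sign_elem] in degree 0 and homogeneous in the
    others. *)
Lemma bool_pQ A i : fx A -> pQ A [set A] g i = (i == 0%N)%:R * elem hs #|A| A.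
Proof.
have [n] := ubnP #|A|; elim: n A i => // n IH A i lt fA.
have a := bool_adm fA.
have [A0|nA] := eqVneq A set0.
  by move: a; rewrite A0 => a; rewrite (pQ_set0 hQ) // cards0 sa_oneE eqxx mulr1.
have := qval_sum hPZ hQ i a nA.
have rS S : S \subset A -> rk [set A] S = #|S|.
  move=> sS; apply: (rk_eq (B := A)); rewrite ?inE // ?(setIidPl sS) //.
  by move=> B; rewrite inE => /eqP ->; rewrite (setIidPl sS).
have reS S : S \subset A -> restrB [set A] S = [set S].
  move=> sS; apply/setP => X; rewrite inE; apply/mem_restr/eqP => [[B [+ _ ->]]|->].
    by rewrite inE => /eqP ->; rewrite (setIidPl sS).
  by exists A; rewrite inE rS // (setIidPl sS).
have coS S : S \subset A -> contrB [set A] S = [set A :\: S].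
  move=> sS; apply/setP => X; rewrite inE; apply/mem_contr/eqP => [[B [+ _ ->]]|->].
    by rewrite inE => /eqP ->.
  by exists A; rewrite inE rS // (setIidPl sS).
have sumE (S : {set E}) : (S \subset A) && (setact to S g == S) ->
   \sum_(j < i.+1) pQ S (restrB [set A] S) g j * pP (A :\: S) (contrB [set A] S) g (i - j) = pQ S [set S] g i.
  move=> /andP[sS fS]; rewrite reS // coS // big_ord_recr /= subnn bool_pP ?fxD // mulr1 big1 ?add0r //.
  by move=> j _; rewrite bool_pP ?fxD // (_ : (i - j == 0)%N = false) ?mulr0 //; have := ltn_ord j; lia.
rewrite (eq_bigr (fun S : {set E} => (-1) ^+ #|S| * pQ S [set S] g i)); last first.
  by move=> S h; rewrite sumE // rS //; case/andP: h.
rewrite (bigD1 A) /=; last by rewrite subxx; apply: fA.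
rewrite (eq_bigr (fun S : {set E} => (i == 0%N)%:R * ((-1) ^+ #|S| * elem hs #|S| S))); last first.
  move=> S /andP[/andP[sS fS] nS]; rewrite IH // 1?mulrCA //.
  by move: lt; rewrite ltnS; apply: leq_trans; apply: proper_card; rewrite properEneq nS.
rewrite -big_distrr /=.
have := sum_sign_elem fA nA; rewrite (bigD1 A) /=; last by rewrite subxx.
move=> /eqP; rewrite addrC addr_eq0 => /eqP ->; rewrite mulrN => /eqP; rewrite subr_eq0 mulrCA => /eqP.
by apply: mulfI; rewrite signr_eq0.
Qed.

(** Besides [A], only subsets of size less than [d] matter. Their restrictions are Boolean and their
    contractions uniform, so the sum is a convolution that [lower_inv] reduces to one
    antisymmetrized product. *)
Lemma unif_pQ d A i : (0 < d)%N -> (d < #|A|)%N -> fx A ->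
  pQ A (unif d A) g i =
  - (if (i.*2 < d)%N then elem hs i * hook hs (#|A| - d) (d - i) - elem hs (d - i) * hook hs (#|A| - d) i else 0) A.
Proof.
move=> d0 dA fA; have dA' := ltnW dA; have a := unif_adm dA' fA; have m := unif_matroid dA'.
have h0 := hsE0 to g.
have nA : A != set0 by rewrite -card_gt0; apply: leq_ltn_trans dA.
have e1 : restrB (unif d A) A = unif d A by apply: restr_full m.
have := qval_sum hPZ hQ i a nA.
rewrite (bigD1 A) /=; last by rewrite subxx; apply: fA.
rewrite (rk_unif dA') // e1 setDv.
have aD : adm set0 (contrB (unif d A) A) g by rewrite -(setDv A); apply: adm_contr1.
rewrite big_ord_recr /= subnn (pP_set0 hPZ) // mulr1 [X in X + pQ _ _ _ _]big1 ?add0r; last first.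
  move=> j _; rewrite (pP_set0 hPZ) // (_ : (i - j == 0)%N = false) ?mulr0 //.
  by have := ltn_ord j; clear; move: (nat_of_ord j) => j'; lia.
rewrite (bigID (fun S : {set E} => (#|S| < d)%N)) /= [X in _ + (_ + X)]big1 ?addr0; last first.
  move=> S /andP[/andP[/andP[sS fS] nS] cS]; rewrite big1 ?mulr0 // => j _.
  have aS := adm_contr1 a fS; have le : (d <= #|S|)%N by rewrite leqNgt.
  rewrite (contr_unif_large dA' sS le) in aS *.
  rewrite (rk0_pP hPZ _ aS) ?mulr0 //; apply/negP => /eqP e.
  by case/negP: nS; rewrite eqEsubset sS -setD_eq0 e eqxx.
pose F l : setalg E algC := Pcoef to g (#|A| - d) l i.
rewrite (eq_big (fun S : {set E} => [&& S \subset A, fx S & (#|S| < d)%N])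
   (fun S => (-1) ^+ #|S| * (elem hs #|S| S * F (d - #|S|)%N (A :\: S)))); first last.
- move=> S /andP[/andP[/andP[sS fS] nS] cS]; rewrite (rk_unif dA') //.
  have -> : minn d #|S| = #|S| by apply/minn_idPr/ltnW.
  congr (_ * _); rewrite (restr_unif_small dA' sS (ltnW cS)) (contr_unif_small dA' sS cS).
  have cD : #|A :\: S| = (#|A| - #|S|)%N by rewrite cardsD (setIidPr sS).
  rewrite (eq_bigr (fun j : 'I_i.+1 => (nat_of_ord j == 0)%N%:R * (elem hs #|S| S * F (d - #|S|)%N (A :\: S)))).
    rewrite big_ord_recl /= mul1r big1 ?addr0 // => j _; by rewrite mul0r.
  move=> j _; rewrite bool_pQ // -mulrA; have [j0|nj] := eqVneq (nat_of_ord j) 0%N; last by rewrite !mul0r.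
  rewrite j0 subn0 (unif_pP hPZ) ?fxD //; last 2 first.
  + by clear -cS; lia.
  + by rewrite cD; clear -cS dA; lia.
  rewrite /F cD (_ : (#|A| - #|S| - (d - #|S|) = #|A| - d)%N) //.
  by clear -cS dA; lia.
- move=> S; rewrite -!andbA; congr (_ && (_ && _)).
  by have [->|//] := eqVneq S A; rewrite ltnNge dA'.
rewrite sum_small_elem; last by apply: lower_eq0.
rewrite lower_inv //; have -> : minn d #|A| = d by apply/minn_idPl.
case: ifP => id; last by rewrite sa_zeroE addr0 oppr0 => /eqP; rewrite mulf_eq0 signr_eq0 => /eqP.
have -> : asym (fun j => (-1) ^+ j * elem hs j) (fun j => (-1) ^+ j * hook hs (#|A| - d) j) i (d - i) =
   (-1) ^+ d * (elem hs i * hook hs (#|A| - d) (d - i) - elem hs (d - i) * hook hs (#|A| - d) i).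
  have -> : (-1) ^+ d = (-1) ^+ i * (-1) ^+ (d - i)%N :> setalg E algC.
    by rewrite -exprD subnKC //; clear -id; lia.
  by rewrite /asym; ring.
rewrite sa_signE -mulrDr => /eqP; rewrite mulf_eq0 signr_eq0 /= addr_eq0 => /eqP //.
Qed.
End Diff2.

(** * Effect of a relaxation on Q *)

Section Diff3.
Variables (E : finType) (gT : finGroupType) (to : {action gT &-> E}).
Variables (P Z Q : polyfam E gT).
Hypotheses (hPZ : is_KL_system to P Z) (hQ : is_invKL to P Q).
Variable g : gT.
Implicit Types (A S X H : {set E}) (Bs HH : {set {set E}}).
Local Notation fx := (fx to g).
Local Notation pP := (pP P).
Local Notation pQ := (pQ Q).
Local Notation adm := (adm to).
Local Notation hs := (hset algC fx).

(** The term of [S] in the contribution of [H] to the change of the recursion for Q. At S = H the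
    sign (-1)^k is that of a lost term of rank k - 1. *)
Definition Urelax k H i S : algC :=
  if (#|S| < k)%N then (-1) ^+ #|S| * (elem hs #|S| S * pcoef hs (#|H|.+1 - k) (k - #|S|) i (H :\: S))
  else (S == H)%:R * ((-1) ^+ k * pQ H (unif k.-1 H) g i).

(** The small subsets give, by [lower_inv], an antisymmetrized product of hooks and shifted
    elementary functions, and the uniform restriction to [H] gives another. Of the four products two
    cancel. *)
Lemma sum_Urelax k H i : (1 < k)%N -> (k <= #|H|)%N -> fx H ->
  \sum_(S : {set E} | (S \subset H) && fx S) Urelax k H i S =
  (-1) ^+ k.-1 * (if (i.*2 < k)%N then qcoef hs (#|H|.+1 - k) k i H else 0).
Proof.
move=> k1 kH fH; have h0 := hsE0 to g.
rewrite (bigID (fun S : {set E} => (#|S| < k)%N)) /=.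
rewrite (eq_big (fun S : {set E} => [&& S \subset H, fx S & (#|S| < k)%N])
   (fun S => (-1) ^+ #|S| * (elem hs #|S| S * pcoef hs (#|H|.+1 - k) (k - #|S|) i (H :\: S)))); first last.
- by move=> S /andP[_ h]; rewrite /Urelax h.
- by move=> S; rewrite andbA.
rewrite (@sum_small_elem _ _ to g (fun l => pcoef hs (#|H|.+1 - k) l i)); last exact: lower_eq0.
rewrite /pcoef lower_inv // (bigD1 H) /=; last by rewrite subxx fH -leqNgt.
rewrite [X in _ + (_ + X)]big1 ?addr0; last first.
  by move=> S /andP[/andP[_ /negPf h] nS]; rewrite /Urelax h (negPf nS) mul0r.
rewrite /Urelax (ltnNge #|H|) kH /= eqxx mul1r.
have -> : pQ H (unif k.-1 H) g i =
  - (if (i.*2 < k)%N then elem hs i * hook hs (#|H|.+1 - k) (k.-1 - i) - elem hs (k.-1 - i) * hook hs (#|H|.+1 - k) i else 0) H.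
  rewrite (unif_pQ hPZ hQ) //; try by clear -k1 kH; lia.
  have -> : (#|H| - k.-1 = #|H|.+1 - k)%N by clear -k1 kH; lia.
  case: (ltnP i.*2 k) => ik; last first.
    by rewrite (_ : (i.*2 < k.-1)%N = false) //; clear -ik; lia.
  case: (ltnP i.*2 k.-1) => ik' //.
  (* The degree bounds for ranks k and k - 1 differ only when 2i = k - 1, and there the two products
     coincide. *)
  have -> : (k.-1 - i = i)%N by clear -ik ik' k1; lia.
  by rewrite subrr.
case: ifP => ik; last by rewrite sa_zeroE oppr0 !mulr0 addr0.
have eS : (-1) ^+ k = - (-1) ^+ k.-1 :> algC.
  by rewrite -[in LHS](prednK (ltnW k1)) exprS mulN1r.
rewrite eS mulrNN -!sa_signE -sa_addE; apply: (congr1 (fun f : setalg E algC => f H)).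
rewrite /asym /qcoef; set c := (#|H|.+1 - k)%N.
have -> : (k.-1 - i = k - i.+1)%N by clear; lia.
have -> : (k - i = (k - i.+1).+1)%N by clear -ik; lia.
have -> : (-1) ^+ k.-1 = (-1) ^+ i * (-1) ^+ (k - i.+1)%N :> setalg E algC.
  by rewrite -exprD; congr (_ ^+ _); clear -ik; lia.
case: i {ik} => [|i]; rewrite ?exprS; ring.
Qed.

Lemma contr_rk_full A Bs S k : is_matroid A Bs -> rk Bs A = k -> rk Bs S = k -> contrB Bs S = [set set0].
Proof.
move=> m rkA rkS.
have sub B : B \in Bs -> #|S :&: B| = k -> B :\: S = set0.
  move=> b e; apply/eqP; rewrite setD_eq0.
  have /eqP <- : S :&: B == B by rewrite eqEcard subsetIr e (card_basis m rkA b) leqnn.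
  exact: subsetIl.
apply/setP => X; rewrite inE; apply/mem_contr/eqP; rewrite rkS; first by move=> [B [b e ->]]; exact: sub.
move=> ->.
by have [B b e] := rk_attain S (mat_ne m); exists B; rewrite sub // -rkS.
Qed.

(** No induction is involved: whenever the restriction to a set other than [A] changes, P of the
    relaxed contraction vanishes, so the only unknown Q in the difference of the two recursions is
    the one at S = A. *)
Lemma diff_pQ A Bs HH k i : adm A Bs g -> rk Bs A = k -> (1 < k)%N ->
  (forall H, H \in HH -> stressed k A Bs H) -> (forall H, H \in HH -> setact to H g \in HH) ->
  pQ A (relaxF k Bs HH) g i - pQ A Bs g i =
  \sum_(H in HH | fx H) (if (i.*2 < k)%N then qcoef hs (#|H|.+1 - k) k i H else 0).
Proof.
move=> a rkA k1 sH gH; have k0 := ltnW k1.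
have m := adm_mat a; have a' := relax_adm a rkA k0 sH gH; have m' := adm_mat a'.
have [B0 b0] := mat_ne m.
have rkA' : rk (relaxF k Bs HH) A = k.
  rewrite (rk_full m' (B := B0)) ?(card_basis m rkA b0) //; by apply/mem_relaxF; left.
have nA : A != set0.
  rewrite -card_gt0; apply: leq_trans k0 _; rewrite -(card_basis m rkA b0).
  exact/subset_leq_card/(mat_sub m).
pose tm B S := (-1) ^+ rk B S *
    (\sum_(j < i.+1) pQ S (restrB B S) g j * pP (A :\: S) (contrB B S) g (i - j)).
have term S : S \subset A -> fx S -> S != A ->
   tm (relaxF k Bs HH) S - tm Bs S = \sum_(H in HH | fx H && (S \subset H)) Urelax k H i S.
  move=> sSA fS nS; rewrite /tm.
  have aS := adm_contr1 a fS; have aS' := adm_contr1 a' fS.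
  have nAS : A :\: S != set0.
    by apply: contra nS => /eqP e; rewrite eqEsubset sSA -setD_eq0 e eqxx.
  case: (boolP [exists H in HH, S \subset H]) => [/exists_inP[H0 h0 sS0]|/exists_inPn no]; last first.
    rewrite [RHS]big_pred0; last first.
      by move=> H; apply/negbTE/negP => /and3P[h _ s]; have := no H h; rewrite s.
    rewrite (rk_relax_notin m rkA sH k0 sSA no) (contr_relax_notin m rkA sH k0 sSA no).
    have [rS|rS] := ltnP (rk Bs S) k.
      by rewrite (restr_relax_notin m rkA sH k0 sSA no rS) subrr.
    have eS : rk Bs S = k.
      apply/eqP; rewrite eqn_leq rS andbT; apply: rk_le => B b.
      by rewrite -(card_basis m rkA b) subset_leq_card // subsetIr.
    (* For a set of full rank the restriction may change, but the contraction is nonempty of rank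
       zero, so its P vanishes. *)
    have cS := contr_rk_full m rkA eS; rewrite cS in aS *.
    by rewrite !big1 ?mulr0 ?subrr // => j _; rewrite (rk0_pP hPZ _ aS) // mulr0.
  case: (ltnP #|S| k) => cS.
    rewrite (rk_relax_small m rkA sH k0 h0 sS0 cS) (rk_small m rkA sH k0 h0 sS0 cS).
    rewrite (restr_relax_small m rkA sH k0 h0 sS0 cS) (restr_small m rkA sH k0 h0 sS0 cS).
    have e (f : nat -> algC) : \sum_(j < i.+1) pQ S [set S] g j * f (i - j)%N = elem hs #|S| S * f i.
      rewrite big_ord_recl /= subn0 (bool_pQ hPZ hQ) // eqxx mul1r big1 ?addr0 // => j _.
      by rewrite (bool_pQ hPZ hQ) // !mul0r.
    rewrite !e -!mulrBr (contr_diff_pP _ (@diff_pP _ _ _ _ _ hPZ g _) a rkA sH gH k0 fS h0 sS0 cS).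
    by rewrite !big_distrr /=; apply: eq_bigr => H _; rewrite /Urelax cS.
  have cl' := contr_relax_large m rkA h0 sS0 cS; rewrite cl' in aS' *.
  rewrite [X in _ * X - _]big1 ?mulr0; last by move=> j _; rewrite (rk0_pP hPZ _ aS') // mulr0.
  rewrite sub0r (rk_large m rkA sH k0 h0 sS0 cS).
  have cl : contrB Bs S = single (A :\: H0) := contr_large m rkA sH k0 h0 sS0 cS.
  rewrite cl in aS *.
  have uniq H : H \in HH -> S \subset H -> H = H0.
    by move=> h SH; exact: (stressed_inter m rkA sH k0 h h0 SH sS0 (leqW cS)).
  have fH0 : fx H0.
    by apply/eqP; apply: uniq; [exact: gH|rewrite -(eqP fS); exact: imsetS].
  rewrite [RHS](bigD1 H0) /=; last by rewrite h0 fH0 sS0.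
  rewrite [X in _ = _ + X]big1 ?addr0; last by move=> H /andP[/and3P[h _ SH] /eqP[]]; apply: uniq.
  rewrite /Urelax ltnNge cS /=.
  have nD : A :\: H0 != set0.
    have [x xA xH] := stressed_out m sH h0.
    by apply/set0Pn; exists x; rewrite inE xA xH.
  have e : (A :\: H0 == A :\: S) = (S == H0).
    apply/eqP/eqP => [/setP e|-> //]; apply/eqP; rewrite eqEsubset sS0; apply/subsetP => x xH.
    have := e x; rewrite !inE xH /= => /esym/negbT; rewrite negb_and negbK => /orP[//|].
    by have [sA _ _ _] := sH _ h0; rewrite (subsetP sA _ xH).
  have eS : (-1) ^+ k = - (-1) ^+ k.-1 :> algC.
    by rewrite -[in LHS](prednK k0) exprS mulN1r.
  rewrite big_ord_recr /= [X in X + _]big1 ?add0r; last first.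
    move=> j _; rewrite (rk1_pP hPZ _ aS (setDS A sS0) nD) (_ : (i - j == 0)%N = false) ?andbF ?mulr0 //.
    by have := ltn_ord j; clear; move: (nat_of_ord j) => j'; lia.
  rewrite (rk1_pP hPZ _ aS (setDS A sS0) nD) e subnn eqxx andbT.
  case: eqP => [->|_]; last by rewrite mulr0 mulr0 mul0r oppr0.
  by rewrite (restr_hyper m rkA sH k0 h0) mulr1 mul1r eS mulNr.
have q1 : \sum_(S : {set E} | (S \subset A) && fx S) tm Bs S = 0 := qval_sum hPZ hQ i a nA.
have q2 : \sum_(S : {set E} | (S \subset A) && fx S) tm (relaxF k Bs HH) S = 0 := qval_sum hPZ hQ i a' nA.
have tA B : adm A B g -> rk B A = k -> tm B A = (-1) ^+ k * pQ A B g i.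
  move=> aB rB; rewrite /tm rB (restr_full (adm_mat aB)) setDv.
  have aD : adm set0 (contrB B A) g by rewrite -(setDv A); apply: adm_contr1 => //; apply: adm_fx aB.
  rewrite big_ord_recr /= subnn (pP_set0 hPZ) // mulr1 big1 ?add0r // => j _.
  rewrite (pP_set0 hPZ) // (_ : (i - j == 0)%N = false) ?mulr0 //.
  by have := ltn_ord j; clear; move: (nat_of_ord j) => j'; lia.
have fA := adm_fx a.
have : \sum_(S : {set E} | (S \subset A) && fx S) (tm (relaxF k Bs HH) S - tm Bs S) = 0.
  by rewrite sumrB q1 q2 subrr.
rewrite (bigD1 A) /=; last by rewrite subxx.
rewrite !tA // -mulrBr.
rewrite (eq_bigr (fun S : {set E} => \sum_(H in HH | fx H && (S \subset H)) Urelax k H i S)); last first.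
  by move=> S /andP[/andP[sS fS] nS]; apply: term.
rewrite (exchange_big_dep (fun H => (H \in HH) && fx H)) /=; last by move=> S H _ /and3P[-> ->].
rewrite (eq_bigr (fun H => (-1) ^+ k.-1 * (if (i.*2 < k)%N then qcoef hs (#|H|.+1 - k) k i H else 0))); last first.
  move=> H /andP[h fH]; have [sHA kH _ _] := sH _ h; rewrite -sum_Urelax //.
  apply: eq_bigl => S; rewrite h fH /=; case: (boolP (S \subset H)) => SH; rewrite ?andbF //= andbT.
  rewrite (subset_trans SH) //=; case: eqP => [e|]; rewrite ?andbT // andbF; apply/esym/negbTE/negP => _.
  by have [x xA xH] := stressed_out m sH h; rewrite -e in xA; rewrite (subsetP SH _ xA) in xH.
rewrite -big_distrr /= -[in (-1) ^+ k](prednK k0) exprS mulN1r mulNr addrC => /eqP.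
rewrite subr_eq0 => /eqP e; symmetry; move: e; apply: mulfI; by rewrite signr_eq0.
Qed.
End Diff3.

(** * The theorem *)

Section Naturality.
Variables (R S : comNzRingType) (f : {rmorphism R -> S}) (hR : nat -> R) (hS : nat -> S).
Hypothesis fh : forall n, f (hR n) = hS n.

Lemma rmorph_hook c r : f (hook hR c r) = hook hS c r.
Proof. by elim: r c => [|r IH] c //=; rewrite rmorphB rmorphM !IH fh. Qed.

Lemma rmorph_elem n : f (elem hR n) = elem hS n.
Proof. by case: n => [|n]; rewrite ?rmorph1 //= rmorph_hook. Qed.

Lemma rmorph_qcoef c k i : f (qcoef hR c k i) = qcoef hS c k i.
Proof.
rewrite /qcoef rmorphB rmorphM rmorph_elem rmorph_hook; congr (_ - _).
by case: i => [|i]; rewrite ?rmorph0 // rmorphM rmorph_elem rmorph_hook.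
Qed.

Lemma rmorph_lower x x' y y' k i : (forall j, f (x j) = x' j) -> (forall j, f (y j) = y' j) ->
  f (lower hR x y k i) = lower hS x' y' k i.
Proof.
move=> fx fy; rewrite /lower rmorph_sum; apply: eq_bigr => r _.
by rewrite rmorphM fh /asym rmorphB !rmorphM !fx !fy.
Qed.

Lemma rmorph_pcoef c k i : f (pcoef hR c k i) = pcoef hS c k i.
Proof.
apply: rmorph_lower => [|[|j]]; rewrite ?rmorph0 // => *; rewrite rmorphM rmorph_sign ?rmorph_elem //.
by rewrite rmorph_hook.
Qed.
End Naturality.

(** The second sequence starts with 0 and its h-convolution vanishes in degree k > 1. This matches
    the range of [p_kh], which starts at i = 1. *)
Lemma pcoef0 (R : comNzRingType) (h : nat -> R) c k : h 0%N = 1 -> (1 < k)%N -> pcoef h c k 0 = 0.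
Proof.
move=> h0 k1; have := sum_h_y h0 k; rewrite big_ord_recl mulr0 add0r /=.
rewrite (_ : (k == 1)%N = false); last by clear -k1; lia.
move=> e; have {}e : \sum_(r < k) h (k - r.+1)%N * ((-1) ^+ r * elem h r) = 0 by exact: e.
rewrite /pcoef /lower big_mkcond big_ord_recl /= add0r.
rewrite (eq_bigr (fun r : 'I_k => h c * (h (k - r.+1)%N * ((-1) ^+ r * elem h r)))) => [|r _].
  by rewrite -big_distrr /= e mulr0.
by rewrite /= /asym /bump leq0n add1n /= subn0 expr0 mul1r mulr0 subr0; ring.
Qed.

Section Induced.
Variables (E : finType) (gT : finGroupType) (to : {action gT &-> E}).

Lemma coef_sumCX (R : nzRingType) (k i : nat) (C : pred nat) (a : nat -> R) :
  (\sum_(j < k | C j) (a j)%:P * 'X^j)`_i = if (i < k)%N && C i then a i else 0.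
Proof.
rewrite coef_sum; case: ltnP => ik /=; last first.
  apply: big1 => j _; rewrite coefCM coefXn (_ : (i == j) = false) ?mulr0 //.
  by have := ltn_ord j; move: (nat_of_ord j) ik => j'; clear; lia.
rewrite big_mkcond (bigD1 (Ordinal ik)) //= coefCM coefXn eqxx mulr1 big1 ?addr0 // => j nj.
case: ifP => // _; rewrite coefCM coefXn (_ : (i == j) = false) ?mulr0 //.
by apply/negbTE; move: nj; rewrite -val_eqE /= eq_sym.
Qed.

Lemma resH0 h (W : {group gT}) (H : {set E}) : resH to W H (0 : 'CF(Sym h)) = 0.
Proof. by rewrite /resH /mkCF big1 // => C _; rewrite cfunE scale0r. Qed.

Lemma coef_map_resH h (W : {group gT}) H (p : {poly 'CF(Sym h)}) i :
  (map_poly (fun phi => 'Ind[W] (resH to W H phi)) p)`_i = 'Ind[W] (resH to W H p`_i).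
Proof. by rewrite coef_map_id0 // resH0 linear0. Qed.

Section HpermE.
Variables (h : nat) (H : {set E}) (cH : #|H| = h).

(** The same numbering of [H] as the one built into [Hperm]. *)
Definition hval (i : 'I_h) : E := enum_val (cast_ord (esym cH) i).

Lemma hval_inj : injective hval.
Proof. by move=> i j /enum_val_inj /cast_ord_inj. Qed.

Lemma hval_setT : hval @: [set: 'I_h] = H.
Proof.
apply/eqP; rewrite eqEcard card_imset ?cardsT ?card_ord ?cH ?leqnn ?andbT; last exact: hval_inj.
by apply/subsetP => y /imsetP[i _ ->]; apply: enum_valP.
Qed.

Lemma hval_Hperm x i : setact to H x = H -> to (hval i) x = hval (Hperm to h H x i).
Proof.
move=> fH; rewrite /Hperm; case: pickP => [x0 _|no]; last by have := no (hval i); rewrite [_ \in _]enum_valP.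
have e (j : 'I_h) : hval j = nth x0 (enum H) j by rewrite /hval (enum_val_nth x0).
set f := fun j : 'I_h => _.
have fE j : hval (f j) = to (hval j) x.
  have yH : to (hval j) x \in enum H by rewrite mem_enum -[in X in _ \in X]fH; apply: imset_f; apply: enum_valP.
  have lt : (index (to (hval j) x) (enum H) < h)%N by rewrite -[X in (_ < X)%N]cH cardE index_mem.
  by rewrite e /f val_insubd -e lt nth_index.
rewrite mkpermE ?fE // => j j' /(congr1 hval); rewrite !fE => /act_inj; exact: hval_inj.
Qed.
End HpermE.

(** [F] is a formula in the h's over every finite type at once. Naturality moves it from 'I_h to [H]
    along the numbering, and from [H] to its translates, which provides the invariance needed in
    [cfInd_stab]. *)
Lemma Ind_resH h (W : {group gT}) (H : {set E}) (phi : 'CF(Sym h)) g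
    (F : forall T : finType, (nat -> setalg T algC) -> setalg T algC) :
  (forall (T U : finType) (j : T -> U) (injj : injective j) hU hT,
     (forall n, sa_pull j (hU n) = hT n) -> sa_pull j (F U hU) = F T hT) ->
  (forall s, phi s = F _ (hset algC (stabp s)) [set: 'I_h]) -> #|H| = h -> g \in W ->
  'Ind[W] (resH to W H phi) g =
  \sum_(S in orbit (set_action to) W H | fx to g S) F _ (hset algC (fx to g)) S.
Proof.
move=> natF phiE cH gW.
have eqv S x w : F _ (hset algC (fx to (x ^ w)%g)) (setact to S w) = F _ (hset algC (fx to x)) S.
  have injw : injective (to ^~ w) by apply: act_inj.
  have := natF _ _ _ injw (hset algC (fx to (x ^ w)%g)) (hset algC (fx to x)) _.
  move=> <-; first by rewrite ffunE.
  by move=> n; apply: sa_pull_hset => // A; apply: fix_conj.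
have val x : x \in 'N_W(H | to)%g -> phi (Hperm to h H x) = F _ (hset algC (fx to x)) H.
  rewrite memN => /andP[_ /eqP fH]; rewrite phiE -{2}(hval_setT cH).
  have := natF _ _ _ (@hval_inj h H cH) (hset algC (fx to x)) (hset algC (stabp (Hperm to h H x))) _.
  move=> <-; first by rewrite ffunE.
  move=> n; apply: sa_pull_hset => [|A]; first exact: hval_inj.
  rewrite /fx /stabp -(inj_eq (imset_inj (@hval_inj h H cH))); congr (_ == _).
  by rewrite /setact -!imset_comp; apply: eq_imset => i /=; apply: hval_Hperm.
apply: (cfInd_stab (psi := fun S x => F _ (hset algC (fx to x)) S)) => // x xN.
rewrite mkCFE // ?val // => {}x y {}xN yN; rewrite !val ?groupJ //.
by move: yN; rewrite memN => /andP[_ /eqP e]; rewrite -{1}e eqv.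
Qed.
End Induced.

Section StressedHyperplanes.
Variables (E : finType) (gT : finGroupType) (to : {action gT &-> E}).
Implicit Types (A X H : {set E}) (Bs : {set {set E}}) (W : {group gT}).

(** [X] is independent because adding a point of [H], available since |H| >= k, gives a circuit. A
    basis through [X] inside [x |: H] cannot lie in [H], so it contains [x] and its size makes it
    [x |: X]. *)
Lemma stressed_hyperplaneP Bs A H k : is_matroid A Bs -> rk Bs A = k -> (0 < k)%N -> (k <= #|H|)%N ->
  stressed_hyperplane Bs A H -> stressed k A Bs H.
Proof.
move=> m rkA k0 kH; rewrite /stressed_hyperplane /is_hyperplane /is_flat rkA.
case/andP => /andP[/andP[sHA /forall_inP fl] /eqP rH] /forallP circ.
have nB B : B \in Bs -> ~~ (B \subset H).
  move=> b; apply/negP => s; have := rk_ge H b; rewrite (setIidPr s) (card_basis m rkA b) rH.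
  by clear -k0; lia.
split=> // X x sX cX xA xH.
have [B2 b2 sB2] : exists2 B, B \in Bs & X \subset B.
  have [y] : exists y, y \in H :\: X.
    by apply/card_gt0P; rewrite cardsD (setIidPr sX); clear -cX kH; lia.
  rewrite inE => /andP[yX yH].
  have := circ (y |: X); rewrite subUset sub1set yH sX cardsU1 yX add1n cX eqxx /= => /andP[_ /forall_inP/(_ y)].
  by rewrite setU11 setU1K // => /(_ isT) /exists_inP.
(* As [H] is a flat of rank k - 1, adding [x] reaches rank k, so some basis lies inside [x |: H]. *)
have [B1 b1 e1] := rk_attain (x |: H) (mat_ne m).
have sB1 : B1 \subset x |: H.
  have : (k <= #|(x |: H) :&: B1|)%N.
    by rewrite e1; have := fl x; rewrite inE xA xH rH => /(_ isT); clear -k0; lia.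
  move=> le; have /eqP <- : (x |: H) :&: B1 == B1 by rewrite eqEcard subsetIr (card_basis m rkA b1).
  exact: subsetIl.
have [B [b XB sB]] := mat_ext m b1 b2 sB2.
have sBH : B \subset x |: H.
  by apply: subset_trans sB _; rewrite subUset sB1 andbT; apply: subset_trans sX (subsetUr _ _).
have xB : x \in B.
  apply: contraT => xB; case/negP: (nB _ b); apply/subsetP => z zB; have := subsetP sBH _ zB.
  by rewrite !inE => /orP[/eqP e|//]; rewrite -e zB in xB.
suff -> : x |: X = B by [].
apply/eqP; rewrite eqEcard subUset sub1set xB XB /= (card_basis m rkA b) cardsU1.
by rewrite (contra (subsetP sX x) xH) add1n cX.
Qed.

Lemma stressed_act W Bs H k w : preserves to W Bs -> w \in W ->
  stressed k [set: E] Bs H -> stressed k [set: E] Bs (setact to H w).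
Proof.
move=> /forall_inP pr wW [_ kH nB sw].
have pV X : (setact to X w^-1%g \in Bs) = (X \in Bs) by apply/eqP/(forallP (pr _ (groupVr wW))).
have subV X : X \subset setact to H w -> setact to X w^-1%g \subset H.
  by move=> s; have := imsetS (to ^~ w^-1%g) s; rewrite -/(setact to _ _) -/(setact to (setact to H w) _) sactK.
split; first exact: subsetT.
- by rewrite card_setact.
- by move=> B; rewrite -pV => /nB; apply: contra; apply: subV.
move=> X x sX cX _ xH; rewrite -pV /setact imsetU1; apply: sw => //; first exact: subV.
- by rewrite card_setact.
apply: contra xH => xH; rewrite -[x](actKV to w); exact: imset_f.
Qed.

Lemma relax_relaxF W Bs H k : rk Bs [set: E] = k ->
  relax to W Bs H = relaxF k Bs (orbit (set_action to) W H).
Proof.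
move=> rkE; apply/setP => X; rewrite !inE rkE; congr (_ || _); apply/exists_inP/exists_inP => [[w wW s]|[S]].
  by exists (setact to H w) => //; apply: mem_orbit.
by move=> /imsetP[w wW ->] s; exists w.
Qed.
End StressedHyperplanes.

Theorem theorem1p2 (E : finType) (gT : finGroupType) (to : {action gT &-> E})
    (P Z Q : polyfam E gT)
    (hPZ : is_KL_system to P Z) (hQ : is_invKL to P Q)
    (W : {group gT}) (k h : nat) (Bs : {set {set E}}) (H : {set E}) :
  (1 < k)%N -> (k <= h)%N ->
  is_matroid [set: E] Bs -> rk Bs [set: E] = k -> preserves to W Bs ->
  stressed_hyperplane Bs [set: E] H -> #|H| = h ->
  P [set: E] (relax to W Bs H) W =
    P [set: E] Bs W + map_poly (fun phi => 'Ind[W] (resH to W H phi)) (p_kh k h)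
  /\
  Q [set: E] (relax to W Bs H) W =
    Q [set: E] Bs W + map_poly (fun phi => 'Ind[W] (resH to W H phi)) (q_kh k h).
Proof.
move=> k1 kh m rkE pr st cH; have k0 := ltnW k1.
pose HH := orbit (set_action to) W H.
have sH S : S \in HH -> stressed k [set: E] Bs S.
  move=> /imsetP[w wW ->]; apply: stressed_act pr wW _.
  by apply: stressed_hyperplaneP => //; rewrite cH.
have cHH S : S \in HH -> #|S| = h by move=> /imsetP[w wW ->]; rewrite card_setact.
have gH w : w \in W -> forall S, S \in HH -> setact to S w \in HH.
  move=> wW _ /imsetP[v vW ->]; rewrite /= -sactM; apply: mem_orbit; exact: groupM.
have sT w : setact to [set: E] w = [set: E].
  by apply/eqP; rewrite eqEcard subsetT card_setact leqnn.
have a : admissible to [set: E] Bs W by apply: admI => // w wW; apply: actF_inv pr wW.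
have ag w : w \in W -> adm to [set: E] Bs w by move=> wW; apply: adm_sub a; rewrite cycle_subG.
have a' : admissible to [set: E] (relaxF k Bs HH) W.
  apply: admI => // [|w wW]; first exact: relax_matroid.
  by apply: (adm_actF (relax_adm (ag w wW) rkE k0 sH (gH w wW))); apply: cycle_id.
have c1 : (h.+1 - k = h - k + 1)%N by clear -kh; lia.
rewrite (relax_relaxF to W H rkE) -/HH; split; apply/polyP => i; apply/cfun_inP => g gW;
  rewrite coefD cfunE coef_map_resH.
- rewrite (P_val hPZ _ a' gW) (P_val hPZ _ a gW).
  apply/eqP; rewrite addrC -subr_eq; apply/eqP.
  rewrite (diff_pP hPZ _ (ag g gW) rkE k0 sH (gH g gW)).
  rewrite (eq_bigr (fun S => pcoef (hset algC (fx to g)) (h - k + 1) k i S)); last first.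
    by move=> S /andP[/cHH -> _]; rewrite c1.
  rewrite /p_kh (coef_sumCX _ _ (fun i => (0 < i)%N && (i.*2 < k)%N)
     (fun i => skewSpecht h (p_lam k h i) (p_mu k h i))).
  case: ifP => [/and3P[_ i0 ik]|].
    rewrite (@Ind_resH _ _ _ _ _ _ _ _ (fun T hT => pcoef hT (h - k + 1) k i)) // => [T U j injj hU hT e|s].
      exact: rmorph_pcoef.
    exact: skewSpecht_pcoef.
  move=> no; rewrite resH0 linear0 cfunE big1 // => S _; case: i no => [|i] no.
    by rewrite pcoef0 ?sa_zeroE // hsE0.
  by rewrite /pcoef lower_eq0 ?sa_zeroE //; clear -no; lia.
rewrite (Q_val hPZ hQ _ a' gW) (Q_val hPZ hQ _ a gW).
apply/eqP; rewrite addrC -subr_eq; apply/eqP.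
rewrite (diff_pQ hPZ hQ _ (ag g gW) rkE k1 sH (gH g gW)).
rewrite /q_kh (coef_sumCX _ _ (fun i => i.*2 < k)%N
   (fun i => (if i == 0%N :> nat then 0 else Specht h (q_lam1 k h i)) +
      (if (0 < i)%N && (k == h) then 0 else Specht h (q_lam2 k h i)))).
case: (ltnP i.*2 k) => ik; last by rewrite andbF resH0 linear0 cfunE big1.
rewrite ifT; last by clear -ik; lia.
rewrite (eq_bigr (fun S => qcoef (hset algC (fx to g)) (h - k + 1) k i S)); last first.
  by move=> S /andP[/cHH -> _]; rewrite c1.
rewrite (@Ind_resH _ _ _ _ _ _ _ _ (fun T hT => qcoef hT (h - k + 1) k i)) // => [T U j injj hU hT e|s].
  exact: rmorph_qcoef.
exact: Specht_qcoef.
Qed.
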